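(* Let $1<p<\infty$, let $\Omega\subset\mathbf{R}^n$ be a nonempty open set, and let $u$ be a $Q$-quasisuperminimizer in $\Omega$, where $Q$ is the optimal quasisuperminimizing constant of $u$ in $\Omega$. Let $I\subset\mathbf{R}$ be an unbounded open interval. Then the function $\bar u=u\otimes 1$, i.e. $\bar u(x,t)=u(x)$ for $(x,t)\in\Omega\times I$, is a $Q$-quasisuperminimizer in $\Omega\times I\subset\mathbf{R}^{n+1}$, with $Q$ again being optimal, i.e. $Q$ is the optimal quasisuperminimizing constant of $\bar u$ in $\Omega\times I$.
   Context: Let $U\subset\mathbf{R}^d$ be a nonempty open set, $1<p<\infty$ and $Q\ge 1$. A (real-valued) function $u\in W^{1,p}_{\rm loc}(U)$ is a $Q$-quasisuperminimizer in $U$ if $$\int_{\{\varphi\neq 0\}}|\nabla u|^p\,dx\le Q\int_{\{\varphi\neq 0\}}|\nabla(u+\varphi)|^p\,dx$$ for all nonnegative $\varphi\in W^{1,p}_0(U)$. The constant $Q$ is the optimal quasisuperminimizing constant of $u$ in $U$ if $u$ is a $Q$-quasisuperminimizer in $U$ and is not a $Q'$-quasisuperminimizer in $U$ for any $1\le Q'<Q$. The same exponent $p$ is used on $\Omega$ and on $\Omega\times I$. *)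

(* Defs.v *)
From HB Require Import structures.
From mathcomp Require Import all_boot all_order all_algebra.
From mathcomp Require Import all_classical all_reals all_analysis.
Set Implicit Arguments.
Unset Strict Implicit.
Unset Printing Implicit Defensive.
Import Order.TTheory GRing.Theory Num.Theory.
Import numFieldNormedType.Exports.
Local Open Scope classical_set_scope.
Local Open Scope ring_scope.

(* R^n is 'rV[R]_n, with the sigma-algebra generated by the coordinates, i.e.
   the Borel one (see [open_measurable_rV] below). *)
Definition measure_rV_display : measure_display -> measure_display.
Proof. exact. Qed.

Section measurable_rV.
Context {d} {T : sigmaRingType d} (n : nat).

Let coord : 'I_n -> 'rV[T]_n -> T := fun i x => x ord0 i.

Let rV_set0 : g_sigma_preimage coord set0.
Proof. exact: sigma_algebra0. Qed.

Let rV_setC A : g_sigma_preimage coord A -> g_sigma_preimage coord (~` A).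
Proof. exact: sigma_algebraC. Qed.

Let rV_bigcup (F : (set 'rV[T]_n)^nat) :
  (forall i, g_sigma_preimage coord (F i)) ->
  g_sigma_preimage coord (\bigcup_i (F i)).
Proof. exact: sigma_algebra_bigcup. Qed.

HB.instance Definition _ := @isMeasurable.Build (measure_rV_display d)
  'rV[T]_n (g_sigma_preimage coord) rV_set0 rV_setC rV_bigcup.

End measurable_rV.

Lemma measurable_coord d (T : sigmaRingType d) n (i : 'I_n) :
  measurable_fun [set: 'rV[T]_n] (fun x : 'rV[T]_n => x ord0 i).
Proof.
move=> _ Y mY; rewrite setTI; apply: sub_sigma_algebra => /=.
rewrite -bigcup_seq/=; exists i => /=; first by rewrite mem_index_enum.
by exists Y => //; rewrite setTI.
Qed.

Lemma measurable_fun_rV d1 d2 (T1 : measurableType d1) (T2 : measurableType d2)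
    n (f : T1 -> 'rV[T2]_n) :
  (forall i, measurable_fun [set: T1] (fun x => f x ord0 i)) ->
  measurable_fun [set: T1] f.
Proof.
move=> mf; pose S := [set B : set 'rV[T2]_n | measurable (f @^-1` B)].
suff sub : measurable `<=` S by move=> _ B /sub; rewrite setTI.
apply: smallest_sub.
- split=> [|A|F].
  + by rewrite /S/= preimage_set0.
  + by rewrite /S/= setTD preimage_setC => /measurableC.
  + by move=> SF; rewrite /S/= preimage_bigcup; apply: bigcup_measurable => k _; exact: SF.
- rewrite -bigcup_seq => A [i _ [B mB <-]].
  by rewrite /S/= setTI -[X in measurable X]setTI; exact: mf.
Qed.

Lemma open_measurable_rV (R : realType) n (U : set 'rV[R]_n) :
  open U -> measurable U.
Proof.
move=> oU.
pose r (k : nat) : R := k.+1%:R^-1.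
pose c (q : 'rV[rat]_n) : 'rV[R]_n := map_mx ratr q.
pose box q k := [set x : 'rV[R]_n | forall i, ball (c q ord0 i) (r k) (x ord0 i)].
have mbox q k : measurable (box q k).
  have -> : box q k = \big[setI/setT]_(i < n)
      ((fun x : 'rV[R]_n => x ord0 i) @^-1` ball (c q ord0 i) (r k)).
    rewrite -bigcap_seq; apply/seteqP; split=> [x bx i _|x bx i]; first exact: bx.
    by apply: bx => /=; rewrite mem_index_enum.
  apply: bigsetI_measurable => i _; rewrite -[X in measurable X]setTI.
  by apply: measurable_coord => //; rewrite ball_itv; exact: measurable_itv.
have -> : U = \bigcup_(qk in [set qk : 'rV[rat]_n * nat | box qk.1 qk.2 `<=` U])
    box qk.1 qk.2.
  apply/seteqP; split=> [x Ux|x [qk /= sU bx]]; last exact: sU.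
  have /nbhs_ballP[e /= e0 sub] : nbhs x U by exact: open_nbhs_nbhs.
  have [k kP] : exists k, r k < e / 2.
    exists (Num.truncn (e / 2)^-1); rewrite /r invf_plt ?posrE ?divr_gt0//.
    exact: truncnS_gt.
  have rk0 : 0 < r k by rewrite invr_gt0.
  have /choice[q qP] : forall i : 'I_n, exists q : rat,
      ball (x ord0 i) (r k) (ratr q).
    move=> i; have : x ord0 i - r k < x ord0 i + r k by rewrite ltrD2l gt0_cp.
    move=> /rat_in_itvoo[q]; rewrite in_itv/= => /andP[q1 q2]; exists q.
    by rewrite /ball/= ltr_distlC q1.
  exists (\row_i q i, k) => /= [y by_|i]; last first.
    by rewrite !mxE; apply: ball_sym; exact: qP.
  apply: sub; split=> // i j; rewrite (ord1 i) [e]splitr.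
  apply: (ball_triangle (y := (ratr (q j) : R))).
    by apply: (@le_ball _ _ _ (r k)); [exact: ltW|exact: qP].
  apply: (@le_ball _ _ _ (r k)); first exact: ltW.
  by have := by_ j; rewrite !mxE.
rewrite bigcup_mkcond; apply: countable_bigcupT_measurable => [|qk].
  exact: countableP.
by case: ifP => // _; exact: mbox.
Qed.

Section lebesgue_measure_rV.
Context {R : realType}.

Definition rV_rcons n (z : 'rV[R]_n * measurableTypeR R) : 'rV[R]_n.+1 :=
  \row_i oapp (fun j => z.1 ord0 j) (z.2 : R) (unlift ord_max i).

Lemma measurable_rV_rcons n : measurable_fun setT (@rV_rcons n).
Proof.
apply: measurable_fun_rV => i.
under eq_fun do rewrite mxE.
case: unliftP => [j _|_] /=.
  apply: (@measurableT_comp _ _ _ _ _ _ (fun x : 'rV[R]_n => x ord0 j)) => //.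
  exact: measurable_coord.
exact: measurable_snd.
Qed.

Section step.
Variables (n : nat) (nu : {measure set 'rV[R]_n -> \bar R}).

Definition lebesgue_rV_step : set 'rV[R]_n.+1 -> \bar R :=
  pushforward (nu \x @lebesgue_measure R)%E (@rV_rcons n).

HB.instance Definition _ := Measure.copy lebesgue_rV_step
  (measure_function_pushforward__canonical__measure_function_Measure
    (nu \x @lebesgue_measure R)%E (@measurable_rV_rcons n)).

End step.

Fixpoint lebesgue_rV n : {measure set 'rV[R]_n -> \bar R} :=
  match n return {measure set 'rV[R]_n -> \bar R} with
  | 0 => @dirac _ 'rV[R]_0 (0 : 'rV[R]_0) R
  | m.+1 => lebesgue_rV_step (lebesgue_rV m)
  end.

End lebesgue_measure_rV.

Section sobolev.
Context {R : realType} (n : nat).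
Implicit Types (U K : set 'rV[R]_n) (f g u phi : 'rV[R]_n -> R).
Implicit Types (G : 'rV[R]_n -> 'rV[R]_n) (p q Q : R).

Local Notation mu := (@lebesgue_rV R n).

(* The library norm on 'rV[R]_n is the sup norm. *)
Definition enorm (v : 'rV[R]_n) : R := Num.sqrt (\sum_i v ord0 i ^+ 2).

Definition partial (i : 'I_n) f : 'rV[R]_n -> R := 'D_(delta_mx ord0 i) f.

(* C^oo: every iterated partial derivative exists and is differentiable, hence
   continuous. *)
Definition smooth f : Prop :=
  forall (s : seq 'I_n) (x : 'rV[R]_n), differentiable (foldr partial f s) x.

Definition test_fun U phi : Prop :=
  [/\ smooth phi, compact (closure [set x | phi x != 0]) &
      closure [set x | phi x != 0] `<=` U].

Definition loc_integrable U f : Prop :=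
  forall K, compact K -> K `<=` U -> mu.-integrable K (EFin \o f).

Definition Lp U p f : Prop :=
  measurable_fun U f /\ (\int[mu]_(x in U) (`|f x| `^ p)%:E < +oo)%E.

Definition Lp_loc U p f : Prop :=
  measurable_fun U f /\ forall K, compact K -> K `<=` U ->
    (\int[mu]_(x in K) (`|f x| `^ p)%:E < +oo)%E.

Definition is_weak_gradient U f G : Prop :=
  loc_integrable U f /\
  forall i, loc_integrable U (fun x => G x ord0 i) /\
    forall phi, test_fun U phi ->
      (\int[mu]_(x in U) (f x * partial i phi x)%:E =
       - \int[mu]_(x in U) (G x ord0 i * phi x)%:E)%E.

Definition has_weak_gradient U f : Prop := exists G, is_weak_gradient U f G.

(* A chosen representative (weak gradients are unique a.e. on U); it is the
   zero field when f is not weakly differentiable on U. *)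
Definition wgrad U f : 'rV[R]_n -> 'rV[R]_n :=
  xget (fun=> 0) [set G | is_weak_gradient U f G].

Definition W1p U p f : Prop :=
  [/\ Lp U p f, has_weak_gradient U f &
      forall i, Lp U p (fun x => wgrad U f x ord0 i)].

Definition W1p_loc U p f : Prop :=
  [/\ Lp_loc U p f, has_weak_gradient U f &
      forall i, Lp_loc U p (fun x => wgrad U f x ord0 i)].

Definition W1p_norm U p f : \bar R :=
  ((\int[mu]_(x in U) (`|f x| `^ p + enorm (wgrad U f x) `^ p)%:E) `^ p^-1)%E.

Definition W1p_0 U p f : Prop :=
  W1p U p f /\ forall e : R, 0 < e ->
    exists2 phi, test_fun U phi & (W1p_norm U p (f \- phi)%R < e%:E)%E.

Definition energy p (A : set 'rV[R]_n) G : \bar R :=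
  (\int[mu]_(x in A) (enorm (G x) `^ p)%:E)%E.

Definition quasisuperminimizer U p Q u : Prop :=
  [/\ 1 <= Q, W1p_loc U p u &
   forall phi, W1p_0 U p phi -> {ae mu, forall x, U x -> 0 <= phi x} ->
    let A := U `&` [set x | phi x != 0] in
    (energy p A (wgrad U u) <= Q%:E * energy p A (wgrad U (u \+ phi)%R))%E].

Definition optimal_quasisuperminimizing_constant U p Q u : Prop :=
  quasisuperminimizer U p Q u /\
  forall Q', 1 <= Q' -> Q' < Q -> ~ quasisuperminimizer U p Q' u.

End sobolev.

(* In R^n x R the last coordinate is the new variable: for z = (x, t),
   [col' ord_max z] is x and [z ord0 ord_max] is t. *)
Definition cylinder {R : realType} n (Omega : set 'rV[R]_n) (I : set R) :
    set 'rV[R]_n.+1 :=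
  [set z | Omega (col' ord_max z) /\ I (z ord0 ord_max)].

Definition tensor1 {R : realType} n (u : 'rV[R]_n -> R) : 'rV[R]_n.+1 -> R :=
  fun z => u (col' ord_max z).

(* Main.v *)
Require Import Defs.
From HB Require Import structures.
From mathcomp Require Import all_boot all_order all_algebra.
From mathcomp Require Import all_classical all_reals all_analysis.
From mathcomp Require Import measurable_realfun.
From mathcomp Require Import ring lra.
Set Implicit Arguments.
Unset Strict Implicit.
Unset Printing Implicit Defensive.
Import Order.TTheory GRing.Theory Num.Theory.
Import numFieldNormedType.Exports.
Local Open Scope classical_set_scope.
Local Open Scope ring_scope.

(** The weak gradient of [u (x) 1] is [(grad u, 0)], so every energy of it over a
    subset of the cylinder [Omega x I] is an integral over the height [t] of
    energies of [u] over the horizontal slices of that subset.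

    Hence [u (x) 1] inherits the inequality by integration.  Let [phi] be a
    competitor in the cylinder.  For almost every [t] the slice [phi(., t)] is a
    competitor for [u], and its weak gradient consists of the first [n]
    components of that of [phi] ([W1p_0_slice]).  Integrating the inequalities
    for these slices gives the claim, because forgetting the derivative in [t]
    only decreases the energy of [u (x) 1 + phi]
    ([quasisuperminimizer_tensor1]).

    Conversely, let [u (x) 1] satisfy the inequality with a constant [Q], and
    let [phi] be a competitor for [u].  Test with [phi(x) eta(t)], where [eta] is
    a cutoff equal to [1] on an interval of length [N] and going down to [0] over
    unit lengths at both ends.  The left side is at least [N] times the energy of
    [u]; the right side is at most [Q] times the sum of [N] times the energy of
    [u + phi] and of a bound for the two ends, which does not depend on [N]
    ([plateau_inequality]).  Dividing by [N] and letting it grow shows that [u]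
    satisfies the inequality with the same [Q] ([base_inequality]); an unbounded
    interval has room for every [N].  So both functions admit the same constants,
    and the optimal ones agree.

    Three facts about weak gradients carry these arguments.
    - They are unique almost everywhere ([weak_gradient_unique]), by the
      fundamental lemma of the calculus of variations; the chosen
      representatives can therefore be replaced by explicit fields.
    - [f (x) eta] has the weak gradient [(eta grad f, f eta')]
      ([weak_gradient_tensor]), by Fubini and integration by parts.
    - A function that is approximated by test functions, together with a
      prescribed field that is approximated by their gradients, has this field
      as its weak gradient and lies in [W^{1,p}_0] ([W1p_0_closed]).  Both the
      slices and the products [phi (x) eta] are treated in this way. *)

(** * Lebesgue measure and Fubini's theorem on cylinders *)

Section cylinder_geometry.
Context {R : realType} (n : nat).
Implicit Types (A : set 'rV[R]_n) (J : set R).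

Lemma col'_rV_rcons (x : 'rV[R]_n) (t : R) :
  col' ord_max (rV_rcons (x, t)) = x.
Proof. by apply/rowP => i; rewrite !mxE liftK. Qed.

Lemma last_rV_rcons (x : 'rV[R]_n) (t : R) :
  rV_rcons (x, t) ord0 ord_max = t.
Proof. by rewrite mxE unlift_none. Qed.

Lemma lift_rV_rcons (x : 'rV[R]_n) (t : R) j :
  rV_rcons (x, t) ord0 (lift ord_max j) = x ord0 j.
Proof. by rewrite mxE liftK. Qed.

Lemma measurable_col' :
  measurable_fun [set: 'rV[R]_n.+1] (col' ord_max : _ -> 'rV[R]_n).
Proof.
by apply: measurable_fun_rV => i; under eq_fun do rewrite mxE; exact: measurable_coord.
Qed.

Lemma preimage_rV_rcons_cylinder A J :
  (@rV_rcons R n) @^-1` (cylinder A J) = A `*` J.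
Proof.
by apply/seteqP; split=> -[x t]; rewrite /cylinder/= col'_rV_rcons last_rV_rcons.
Qed.

Lemma cylinder_rV_rcons A J x t :
  cylinder A J (rV_rcons (x, t)) = (A x /\ J t) :> Prop.
Proof. by rewrite /cylinder/= col'_rV_rcons last_rV_rcons. Qed.

Lemma measurable_cylinder A J :
  measurable A -> measurable (J : set (measurableTypeR R)) ->
  measurable (cylinder A J).
Proof.
move=> mA mJ; apply: measurableI.
  by rewrite -[X in measurable X]setTI; exact: measurable_col'.
by rewrite -[X in measurable X]setTI; exact: measurable_coord.
Qed.

Lemma measurable_rV_rcons1 (t : R) :
  measurable_fun [set: 'rV[R]_n] (fun x => rV_rcons (x, t)).
Proof.
apply: (measurableT_comp (@measurable_rV_rcons R n)).
exact: measurable_pair2.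
Qed.

Lemma lebesgue_rV_cylinder A J :
  measurable A -> measurable (J : set (measurableTypeR R)) ->
  lebesgue_rV n.+1 (cylinder A J) = (lebesgue_rV n A * lebesgue_measure J)%E.
Proof.
move=> mA mJ; rewrite /= /lebesgue_rV_step /pushforward.
rewrite preimage_rV_rcons_cylinder.
exact: product_measure1E.
Qed.

End cylinder_geometry.

Section finite_on_cubes.
Context {R : realType}.

(** Closed balls of the sup norm, described by coordinates so that they are
    cylinders over one another ([cubeS]). *)
Definition cube n (M : R) : set 'rV[R]_n := [set x | forall i, `|x ord0 i| <= M].
Arguments cube n M : clear implicits.

Lemma cubeS n M : cube n.+1 M = cylinder (cube n M) `[- M, M].
Proof.
apply/seteqP; split=> [z zM|z [zM zl] i].
  split=> [i|]; first by rewrite mxE; exact: zM.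
  by rewrite /= in_itv/= -ler_norml; exact: zM.
case: (unliftP ord_max i) => [j ->|->]; first by have := zM j; rewrite mxE.
by move: zl; rewrite /= in_itv/= -ler_norml.
Qed.

Lemma measurable_cube n (M : R) : measurable (cube n M).
Proof.
elim: n => [|n IH]; last by rewrite cubeS; exact: measurable_cylinder.
by rewrite (_ : cube 0 M = setT)//; apply/seteqP; split=> // x _ [].
Qed.

Lemma lebesgue_rV_cube n (M : R) : (lebesgue_rV n (cube n M) < +oo)%E.
Proof.
elim: n => [|n IH].
  by rewrite /= diracE; case: (_ \in _); rewrite ?ltry ?lte_fin.
rewrite cubeS lebesgue_rV_cylinder//; last exact: measurable_cube.
rewrite lebesgue_measure_itv/=; case: ifP => _; last by rewrite mule0 ltry.
by rewrite lte_mul_pinfty// ?ge0_fin_numE// -EFinB ltry.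
Qed.

Lemma bigcup_cube n : \bigcup_k cube n (k%:R : R) = setT.
Proof.
apply/seteqP; split=> // x _.
exists (Num.truncn `|x|).+1 => //= i.
apply: le_trans (ltW (truncnS_gt _)).
by rewrite [leRHS]/Num.Def.normr/= mx_normrE; exact: (le_bigmax _ _ (ord0, i)).
Qed.

Lemma sigma_finite_lebesgue_rV n : sigma_finite setT (@lebesgue_rV R n).
Proof.
exists (fun k => cube n (k%:R : R)); first by rewrite bigcup_cube.
by move=> k; split; [exact: measurable_cube|exact: lebesgue_rV_cube].
Qed.

End finite_on_cubes.
Arguments cube {R} n M.

Section fubini_cylinder.
Local Open Scope ereal_scope.
Context {R : realType} (n : nat).
Local Notation mu := (@lebesgue_rV R n).
Local Notation mu1 := (@lebesgue_rV R n.+1).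
Local Notation leb := (@lebesgue_measure R).

(* Product measures ask for a sigma-finite instance, which is attached to this
   synonym of the measure. *)
Let mu' : set 'rV[R]_n -> \bar R := mu.
HB.instance Definition _ := Measure.on mu'.
HB.instance Definition _ := Measure_isSigmaFinite.Build _ _ _ mu'
  (@sigma_finite_lebesgue_rV R n).

Lemma ge0_integral_rV_rcons (f : 'rV[R]_n.+1 -> \bar R) :
  measurable_fun [set: 'rV[R]_n.+1] f -> (forall z, 0 <= f z) ->
  \int[mu1]_z f z = \int[(mu \x leb)%E]_w f (rV_rcons w).
Proof.
move=> mf f0; rewrite /= /lebesgue_rV_step.
rewrite (ge0_integral_pushforward (@measurable_rV_rcons R n))//.
Qed.

Lemma integral_rV_rcons (f : 'rV[R]_n.+1 -> \bar R) :
  mu1.-integrable [set: 'rV[R]_n.+1] f ->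
  (mu \x leb)%E.-integrable setT (f \o @rV_rcons R n) /\
  \int[mu1]_z f z = \int[(mu \x leb)%E]_w f (rV_rcons w).
Proof.
move=> fi; have mf := measurable_int _ fi.
have fi' : (mu \x leb)%E.-integrable setT (f \o @rV_rcons R n).
  apply/integrableP; split.
    by apply: measurableT_comp => //; exact: measurable_rV_rcons.
  case/integrableP : fi => _; rewrite ge0_integral_rV_rcons//.
  exact: measurableT_comp.
split=> //.
rewrite /= /lebesgue_rV_step.
rewrite (integral_pushforward (@measurable_rV_rcons R n))//.
Qed.

Variables (A : set 'rV[R]_n) (J : set R).
Hypothesis mA : measurable A.
Hypothesis mJ : measurable (J : set (measurableTypeR R)).

Lemma restrict_cylinder_rcons (f : 'rV[R]_n.+1 -> \bar R) x t :
  (f \_ (cylinder A J)) (rV_rcons (x, t)) =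
  ((fun t => (((fun x => f (rV_rcons (x, t))) \_ A) x)) \_ J) t.
Proof.
rewrite !patchE; have [tJ|tJ] := boolP (t \in J).
  have [xA|xA] := boolP (x \in A).
    by rewrite mem_set// cylinder_rV_rcons; split; exact: set_mem.
  rewrite memNset// cylinder_rV_rcons => -[+ _].
  by move: xA; rewrite notin_setE.
by rewrite memNset// cylinder_rV_rcons => -[_]; move: tJ; rewrite notin_setE.
Qed.

(** Everything is reduced to the product measure by extending the integrand by
    zero; measurability of the partial integrals is recorded because almost
    everywhere statements about the height are deduced from them. *)
Lemma tonelli_cylinder (f : 'rV[R]_n.+1 -> \bar R) :
  measurable_fun (cylinder A J) f -> (forall z, cylinder A J z -> 0 <= f z) ->
  [/\ \int[mu1]_(z in cylinder A J) f z =
        \int[leb]_(t in J) \int[mu]_(x in A) f (rV_rcons (x, t)),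
      \int[mu1]_(z in cylinder A J) f z =
        \int[mu]_(x in A) \int[leb]_(t in J) f (rV_rcons (x, t)),
      measurable_fun J (fun t => \int[mu]_(x in A) f (rV_rcons (x, t))) &
      measurable_fun A (fun x => \int[leb]_(t in J) f (rV_rcons (x, t)))].
Proof.
move=> mf f0.
pose g := f \_ (cylinder A J).
have mg : measurable_fun setT g by apply/(measurable_restrictT _ _).1 => //; exact: measurable_cylinder.
have g0 z : 0 <= g z.
  by rewrite /g patchE; case: ifPn => // /set_mem; exact: f0.
have mg' : measurable_fun setT (g \o @rV_rcons R n).
  by apply: measurableT_comp => //; exact: measurable_rV_rcons.
have g0' w : 0 <= (g \o @rV_rcons R n) w by exact: g0.
have E : \int[mu1]_(z in cylinder A J) f z = \int[(mu \x leb)%E]_w g (rV_rcons w).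
  by rewrite integral_mkcond ge0_integral_rV_rcons.
have E1 t : \int[mu]_x g (rV_rcons (x, t)) =
    ((fun t => \int[mu]_(x in A) f (rV_rcons (x, t))) \_ J) t.
  under eq_integral do rewrite /g restrict_cylinder_rcons.
  rewrite patchE; case: ifPn => tJ; last first.
    by rewrite integral0_eq// => x _; rewrite patchE (negbTE tJ).
  rewrite [RHS]integral_mkcond; apply: eq_integral => x _.
  by rewrite patchE tJ.
have E2 x : \int[leb]_t g (rV_rcons (x, t)) =
    ((fun x => \int[leb]_(t in J) f (rV_rcons (x, t))) \_ A) x.
  under eq_integral do rewrite /g restrict_cylinder_rcons.
  rewrite patchE; case: ifPn => xA; last first.
    rewrite integral0_eq// => t _; rewrite patchE; case: ifP => // _.
    by rewrite patchE (negbTE xA).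
  rewrite [RHS]integral_mkcond; apply: eq_integral => t _.
  by rewrite !patchE xA.
split.
- rewrite E (@fubini_tonelli2 _ _ _ _ R mu' leb _ mg' g0').
  by rewrite [RHS]integral_mkcond; apply: eq_integral => t _; rewrite /fubini_G/= E1.
- rewrite E (@fubini_tonelli1 _ _ _ _ R mu' leb _ mg' g0').
  by rewrite [RHS]integral_mkcond; apply: eq_integral => t _; rewrite /fubini_F/= E2.
- apply/(measurable_restrictT _ _).2 => //.
  have := @measurable_fun_fubini_tonelli_G _ _ _ _ R mu' _ mg' g0'.
  by apply: eq_measurable_fun => t _; rewrite /fubini_G/= E1.
- apply/(measurable_restrictT _ _).2 => //.
  have := @measurable_fun_fubini_tonelli_F _ _ _ _ R leb _ mg' g0'.
  by apply: eq_measurable_fun => t _; rewrite /fubini_F/= E2.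
Qed.

Lemma fubini_cylinder (f : 'rV[R]_n.+1 -> \bar R) :
  mu1.-integrable (cylinder A J) f ->
  \int[mu1]_(z in cylinder A J) f z =
    \int[leb]_(t in J) \int[mu]_(x in A) f (rV_rcons (x, t)) /\
  \int[mu1]_(z in cylinder A J) f z =
    \int[mu]_(x in A) \int[leb]_(t in J) f (rV_rcons (x, t)).
Proof.
move=> fi.
pose g := f \_ (cylinder A J).
have gi : mu1.-integrable setT g.
  by apply/integrable_restrict => //; rewrite ?setTI//; exact: measurable_cylinder.
have [gi' E0] := integral_rV_rcons gi.
have E : \int[mu1]_(z in cylinder A J) f z = \int[(mu \x leb)%E]_w g (rV_rcons w).
  by rewrite integral_mkcond.
split.
- rewrite E -(@integral21_prod_meas1 _ _ _ _ R mu' leb _ gi').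
  rewrite [RHS]integral_mkcond; apply: eq_integral => t _; rewrite /fubini_G/=.
  under eq_integral do rewrite /g restrict_cylinder_rcons.
  rewrite patchE; case: ifPn => tJ; last first.
    by rewrite integral0_eq// => x _; rewrite patchE (negbTE tJ).
  rewrite [RHS]integral_mkcond; apply: eq_integral => x _.
  by rewrite patchE tJ.
- rewrite E -(@integral12_prod_meas1 _ _ _ _ R mu' leb _ gi').
  rewrite [RHS]integral_mkcond; apply: eq_integral => x _; rewrite /fubini_F/=.
  under eq_integral do rewrite /g restrict_cylinder_rcons.
  rewrite patchE; case: ifPn => xA; last first.
    rewrite integral0_eq// => t _; rewrite patchE; case: ifP => // _.
    by rewrite patchE (negbTE xA).
  rewrite [RHS]integral_mkcond; apply: eq_integral => t _.
  by rewrite !patchE xA.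
Qed.

End fubini_cylinder.

Section ae_cylinder.
Local Open Scope ereal_scope.
Context {R : realType} (n : nat).
Local Notation mu := (@lebesgue_rV R n).
Local Notation mu1 := (@lebesgue_rV R n.+1).
Local Notation leb := (@lebesgue_measure R).

Lemma cylinderTT : cylinder [set: 'rV[R]_n] [set: R] = setT.
Proof. by apply/seteqP; split. Qed.

Lemma ae_slice (P : 'rV[R]_n.+1 -> Prop) :
  {ae mu1, forall z, P z} ->
  {ae leb, forall t, {ae mu, forall x, P (rV_rcons (x, t))}}.
Proof.
move=> [N [mN N0 PN]].
have mI : measurable_fun setT (fun z => (\1_N z)%:E : \bar R).
  by apply/measurable_EFinP; exact: measurable_indic.
have := @tonelli_cylinder R n setT setT measurableT measurableT (fun z => (\1_N z)%:E).
rewrite cylinderTT => /(_ mI (fun _ _ => _))[//|+ _ mG _].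
rewrite integral_indic// setIT N0 => /esym G0.
have : ae_eq leb setT (fun t => \int[mu]_x (\1_N (rV_rcons (x, t)))%:E) (cst 0).
  apply/(ae_eq_integral_abs leb measurableT mG); rewrite -[RHS]G0.
  by apply: eq_integral => t _; rewrite gee0_abs// integral_ge0// => x _; rewrite lee_fin.
apply: filterS => t /(_ Logic.I)/= Nt0.
have mNt : measurable ((fun x => rV_rcons (x, t)) @^-1` N).
  by rewrite -[X in measurable X]setTI; exact: measurable_rV_rcons1.
exists ((fun x => rV_rcons (x, t)) @^-1` N); split => //.
  by rewrite -[RHS]Nt0 -[X in mu X]setIT -integral_indic.
by move=> x /= nP; apply: PN.
Qed.

Lemma ae_cylinder (P : 'rV[R]_n -> Prop) :
  {ae mu, forall x, P x} -> {ae mu1, forall z, P (col' ord_max z)}.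
Proof.
move=> [N [mN N0 PN]]; exists (cylinder N setT); split.
- exact: measurable_cylinder.
- by rewrite lebesgue_rV_cylinder// N0 mul0e.
- by move=> z /= nP; split => //; exact: PN.
Qed.


End ae_cylinder.

(** * Smooth cutoff functions of one variable *)

Section smooth_functions_of_one_variable.
Context {R : realType}.
Implicit Types (f g : R -> R) (x t c d k : R).

(** The functions [x^(-m) exp(-1/x)], extended by zero: their span is stable
    under differentiation, so that they are smooth and flat at the origin. *)
Definition flat (m : nat) (x : R) : R :=
  if x <= 0 then 0 else x^-1 ^+ m * expR (- x^-1).

Lemma flat_le0 m x : x <= 0 -> flat m x = 0.
Proof. by rewrite /flat => ->. Qed.

Lemma flat_gt0 m x : 0 < x -> flat m x = x^-1 ^+ m * expR (- x^-1).
Proof. by rewrite /flat ltNge => /negbTE ->. Qed.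

Lemma flat_ge0 m x : 0 <= flat m x.
Proof.
rewrite /flat; case: (leP x 0) => // x0.
by rewrite mulr_ge0 ?expR_ge0// exprn_ge0// invr_ge0 ltW.
Qed.

(** The exponential series gives [y^(m+1) / (m+1)! <= exp y] at [y = 1/x]; the
    linear bound that follows, for the index [m+1], is what makes [flat m]
    differentiable at [0]. *)
Lemma flat_le_linear m x : 0 < x -> flat m x <= m.+1`!%:R * x.
Proof.
move=> x0; rewrite flat_gt0//; have y0 : 0 < x^-1 by rewrite invr_gt0.
rewrite -[leRHS]mul1r -ler_pdivrMr ?mulr_gt0 ?ltr0n ?fact_gt0//.
rewrite invfM [leLHS](_ : _ = (x^-1 ^+ m.+1 / m.+1`!%:R) * expR (- x^-1)); last first.
  by rewrite exprSr; ring.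
rewrite expRN ler_pdivrMr ?expR_gt0// mul1r.
apply: le_trans (expR_ge1Dxn m (ltW y0)).
by rewrite lerDr.
Qed.

Lemma is_derive_flat m x :
  is_derive x 1 (flat m) (flat m.+2 x - m%:R * flat m.+1 x).
Proof.
have [x0|x0|->] := ltgtP x 0.
- rewrite !flat_le0 ?ltW// mulr0 subr0.
  have : is_derive x 1 (cst 0 : R -> R) 0 by exact: is_derive_cst.
  apply: near_eq_is_derive.
  near=> y; rewrite /cst flat_le0// ltW//.
  by near: y; exact: lt_nbhsl.
- have xn0 : x != 0 by rewrite gt_eqF.
  have dV : is_derive x 1 (fun y : R => y^-1) (- x ^- 2).
    have := @is_deriveV R id x 1 1 xn0 (is_derive_id _ _).
    by rewrite [X in is_derive _ _ _ X -> _]mulr1.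
  have dE : is_derive x 1 (fun y => expR (- y^-1)) (expR (- x^-1) * x ^- 2).
    apply: is_derive1_comp.
    by rewrite -[X in is_derive _ _ _ X]opprK; apply: is_deriveN.
  have dX : is_derive x 1 (fun y => y^-1 ^+ m) (m%:R * x^-1 ^+ m.-1 * - x ^- 2).
    have -> : (fun y : R => y^-1 ^+ m) = (fun y : R => y^-1) ^+ m.
      by apply/funext => y; rewrite exprfctE.
    have := is_deriveX m dV.
    by rewrite /GRing.scale/= -mulr_natl.
  have := is_deriveM dX dE.
  rewrite !flat_gt0// /GRing.scale/=.
  have -> : x^-1 ^+ m * (expR (- x^-1) * x ^- 2) + expR (- x^-1) * (m%:R * x^-1 ^+ m.-1 * - x ^- 2)
     = x^-1 ^+ m.+2 * expR (- x^-1) - m%:R * (x^-1 ^+ m.+1 * expR (- x^-1)).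
    rewrite -!(exprVn x 2); move: (x^-1) (expR _) => y E.
    by case: m {dX} => [|m]; rewrite ?exprS /=; ring.
  apply: near_eq_is_derive.
  near=> y; rewrite flat_gt0//.
  by near: y; exact: lt_nbhsr.
- rewrite !flat_le0// mulr0 subr0.
  have H : h^-1 *: (flat m (h *: 1 + 0) - flat m 0) @[h --> 0^'] --> (0 : R).
    apply/cvgrPdist_le => e e0; near=> h.
    have h0 : h != 0 by near: h; exact: nbhs_dnbhs_neq.
    rewrite sub0r normrN addr0 [flat m 0]flat_le0// subr0 /GRing.scale/= mulr1.
    case: (leP h 0) => [hle|hgt].
      by rewrite flat_le0// mulr0 normr0 ltW.
    have -> : h^-1 * flat m h = flat m.+1 h by rewrite !flat_gt0// exprS mulrA.
    rewrite ger0_norm ?flat_ge0//.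
    apply: (le_trans (flat_le_linear _ hgt)).
    rewrite mulrC -ler_pdivlMr ?ltr0n ?fact_gt0//.
    apply: le_trans (ler_norm _) _; apply: ltW.
    near: h; apply: dnbhs0_lt.
    by rewrite divr_gt0 ?ltr0n ?fact_gt0.
  apply: DeriveDef; last exact: cvg_lim H.
  by apply/cvg_ex; exists 0.
Unshelve. all: by end_near. Qed.

(** The derivative of a member of this class is a member ([smooth1_derive]), so
    that its members are smooth; no formula for higher derivatives of products
    and compositions is involved. *)
Inductive smooth1 : (R -> R) -> Prop :=
| smooth1_cst c : smooth1 (fun=> c)
| smooth1_id : smooth1 id
| smooth1_flat m : smooth1 (flat m)
| smooth1D f g : smooth1 f -> smooth1 g -> smooth1 (fun x => f x + g x)
| smooth1M f g : smooth1 f -> smooth1 g -> smooth1 (fun x => f x * g x)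
| smooth1_comp f g : smooth1 f -> smooth1 g -> smooth1 (fun x => f (g x)).

Lemma smooth1_derive f : smooth1 f ->
  exists2 f', smooth1 f' & forall x, is_derive x 1 f (f' x).
Proof.
elim=> [c||m|g h sg [g' sg' dg] sh [h' sh' dh]
  |g h sg [g' sg' dg] sh [h' sh' dh]|g h sg [g' sg' dg] sh [h' sh' dh]].
- exists (fun=> 0); first exact: smooth1_cst.
  by move=> x; exact: (is_derive_cst c).
- exists (fun=> 1); first exact: smooth1_cst.
  by move=> x; exact: is_derive_id.
- exists (fun x => flat m.+2 x + (fun x => (fun=> - m%:R) x * flat m.+1 x) x).
    apply: smooth1D; first exact: smooth1_flat.
    by apply: smooth1M; [exact: smooth1_cst|exact: smooth1_flat].
  by move=> x /=; rewrite mulNr; exact: is_derive_flat.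
- by exists (fun x => g' x + h' x); [exact: smooth1D|move=> x; exact: is_deriveD].
- exists (fun x => g x * h' x + h x * g' x).
    by apply: smooth1D; apply: smooth1M.
  by move=> x; exact: is_deriveM.
- exists (fun x => g' (h x) * h' x).
    by apply: smooth1M => //; exact: smooth1_comp.
  by move=> x; exact: is_derive1_comp.
Qed.

Lemma smooth1_continuous f : smooth1 f -> continuous f.
Proof.
move=> /smooth1_derive[f' _ df] x.
by apply: differentiable_continuous; apply/derivable1_diffP; case: (df x).
Qed.

Lemma smooth1_affine k t : smooth1 (fun x => k * x + t).
Proof.
apply: smooth1D; last exact: smooth1_cst.
by apply: smooth1M; [exact: smooth1_cst|exact: smooth1_id].
Qed.

(** Composing [flat] with itself makes the function constant on both sides:
    up to scaling this is [f(1) - f(1 - f(x)/f(1))] with [f := flat 0], whose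
    inner argument is nonpositive exactly when [1 <= x]. *)
Definition step (x : R) : R :=
  1 + - (flat 0 1)^-1 * flat 0 (- (flat 0 1)^-1 * flat 0 x + 1).

Lemma smooth1_step : smooth1 step.
Proof.
rewrite /step; apply: smooth1D; first exact: smooth1_cst.
apply: smooth1M; first exact: smooth1_cst.
apply: (smooth1_comp (smooth1_flat 0)).
apply: (smooth1_comp (smooth1_affine _ _)).
exact: smooth1_flat.
Qed.

Let flat1_gt0 : 0 < flat 0 1. Proof. by rewrite flat_gt0// expr0 mul1r expR_gt0. Qed.

Let flat_mono x t : x <= t -> flat 0 x <= flat 0 t.
Proof.
move=> xt; have [x0|x0] := leP x 0; first by rewrite flat_le0// flat_ge0.
rewrite !flat_gt0//; last exact: lt_le_trans xt.
by rewrite !expr0 !mul1r ler_expR lerN2 lef_pV2// posrE// (lt_le_trans x0).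
Qed.

Lemma step_le0 x : x <= 0 -> step x = 0.
Proof.
move=> x0; rewrite /step (flat_le0 _ x0) mulr0 add0r mulNr mulVf ?subrr//.
by rewrite gt_eqF.
Qed.

Lemma step_ge1 x : 1 <= x -> step x = 1.
Proof.
move=> x1; rewrite /step [flat _ (_ + 1)]flat_le0 ?mulr0 ?addr0//.
by rewrite mulNr addrC subr_le0 mulrC ler_pdivlMr// mul1r flat_mono.
Qed.

Lemma step_ge0 x : 0 <= step x.
Proof.
rewrite /step mulNr subr_ge0 mulrC ler_pdivrMr// mul1r flat_mono//.
by rewrite mulNr gerDr oppr_le0 mulr_ge0 ?flat_ge0// invr_ge0 ltW.
Qed.

Lemma step_le1 x : step x <= 1.
Proof.
by rewrite /step mulNr gerBl mulr_ge0 ?flat_ge0// invr_ge0 ltW.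
Qed.

Lemma step_derive_bounded (step' : R -> R) :
  (forall x, is_derive x 1 step (step' x)) -> smooth1 step' ->
  exists2 M, 0 <= M & forall x, `|step' x| <= M.
Proof.
move=> ds s'; have cs : {within `[0, 1], continuous (fun x => `|step' x|)}.
  apply: continuous_subspaceT => x.
  apply: (@continuous_comp _ _ _ step' Num.norm); first exact: smooth1_continuous.
  exact: norm_continuous.
have [c _ cM] := EVT_max ler01 cs.
exists `|step' c| => // x.
have [x01|] := boolP (x \in `[0, 1]); first exact: cM.
move=> x01; suff -> : step' x = 0 by rewrite normr0.
move: x01; rewrite in_itv/= negb_and -!ltNge => x01.
have [_ <-] := ds x; rewrite -(@derive_cst _ R R (step x) x 1).
apply: near_eq_derive; case/orP: x01 => x01.
- rewrite (step_le0 (ltW x01)); near=> y; rewrite step_le0//; apply: ltW.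
  by near: y; exact: lt_nbhsl.
- rewrite (step_ge1 (ltW x01)); near=> y; rewrite step_ge1//; apply: ltW.
  by near: y; exact: lt_nbhsr.
Unshelve. all: by end_near. Qed.

(** A cutoff between [c] and [d] whose transitions have length [1/k]: a large [k]
    approximates the indicator of the interval, while [k = 1] keeps the
    derivative bounded whatever the length of the interval. *)
Definition plateau k c d t : R := step (k * (t - c)) * step (k * (d - t)).

Lemma smooth1_plateau k c d : smooth1 (plateau k c d).
Proof.
have -> : plateau k c d = fun t => step (k * t + - (k * c)) * step (- k * t + k * d).
  apply/funext => t; rewrite /plateau mulrBr.
  by have -> : k * (d - t) = - k * t + k * d by rewrite mulrBr addrC mulNr.
exact: (smooth1M (smooth1_comp smooth1_step (smooth1_affine _ _))
  (smooth1_comp smooth1_step (smooth1_affine _ _))).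
Qed.

Lemma plateau_ge0 k c d t : 0 <= plateau k c d t.
Proof. by rewrite mulr_ge0// step_ge0. Qed.

Lemma plateau_le1 k c d t : plateau k c d t <= 1.
Proof. by rewrite mulr_ile1// ?step_ge0// step_le1. Qed.

Lemma plateau_out k c d t : 0 < k -> ~~ (c < t < d) -> plateau k c d t = 0.
Proof.
move=> k0; rewrite negb_and -!leNgt => /orP[tc|dt].
  by rewrite /plateau step_le0 ?mul0r// pmulr_rle0// subr_le0.
by rewrite /plateau [X in _ * X]step_le0 ?mulr0// pmulr_rle0// subr_le0.
Qed.

Lemma plateau1 k c d t : 0 < k -> c + k^-1 <= t <= d - k^-1 -> plateau k c d t = 1.
Proof.
move=> k0 /andP[ct td].
have scale s : k^-1 <= s -> 1 <= k * s by rewrite mulrC -ler_pdivrMr// mul1r.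
by rewrite /plateau !step_ge1 ?mulr1//; apply: scale; lra.
Qed.

End smooth_functions_of_one_variable.

(** * Products [f(x) eta(t)] and horizontal slices of smooth functions *)

Section differentiability_in_rV.
Context {R : realType}.

Lemma differentiable_rV (V : normedModType R) n (f : V -> 'rV[R]_n) (x : V) :
  (forall i, differentiable (fun y => f y ord0 i : R) x) -> differentiable f x.
Proof.
move=> df; have -> : f = \sum_(i < n) (fun y => f y ord0 i *: (delta_mx ord0 i : 'rV[R]_n)).
  by apply/funext => y; rewrite fct_sumE -row_sum_delta.
by apply: differentiable_sum => i; exact: differentiableZl.
Qed.

Lemma differentiable_col' n (z : 'rV[R]_n.+1) :
  differentiable (col' ord_max : 'rV[R]_n.+1 -> 'rV[R]_n) z.
Proof.
apply: differentiable_rV => i; under eq_fun do rewrite mxE.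
exact: differentiable_coord.
Qed.

Lemma differentiable_rV_rcons1 n (t : R) (x : 'rV[R]_n) :
  differentiable (fun x : 'rV[R]_n => rV_rcons (x, t)) x.
Proof.
apply: differentiable_rV => i; under eq_fun do rewrite mxE.
case: unliftP => [j _|_] /=; first exact: differentiable_coord.
exact: differentiable_cst.
Qed.

Lemma differentiable_rV_rcons2 n (x : 'rV[R]_n) (t : R) :
  differentiable (fun t : R => rV_rcons (x, t)) t.
Proof.
apply: differentiable_rV => i; under eq_fun do rewrite mxE.
by case: unliftP => [j _|_] /=; [exact: differentiable_cst|].
Qed.

(** The difference quotients of both sides coincide.  All derivatives of
    products and of slices are obtained in this way, by comparing the function
    on a coordinate line with a function of fewer variables. *)
Lemma is_derive_along (V W : normedModType R) (F : V -> R) (f : W -> R)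
    (c : R) z v x w df :
  (forall h, F (h *: v + z) = c * f (h *: w + x)) ->
  is_derive x w f df -> is_derive z v F (c * df).
Proof.
move=> Ff [dfx <-].
have F0 : F z = c * f x by have := Ff 0; rewrite !scale0r !add0r.
have H : h^-1 *: ((F \o shift z) (h *: v) - F z) @[h --> 0^'] --> c * 'D_w f x.
  have -> : (fun h : R => h^-1 *: ((F \o shift z) (h *: v) - F z)) =
            (fun h => c * (h^-1 *: ((f \o shift x) (h *: w) - f x))).
    by apply/funext => h; rewrite /= Ff F0 -mulrBr /GRing.scale/= mulrCA.
  by apply: cvgMr; exact: dfx.
apply: DeriveDef; last exact: cvg_lim H.
by apply/cvg_ex; exists (c * 'D_w f x).
Qed.

Lemma col'_line n (h : R) (z : 'rV[R]_n.+1) j :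
  col' ord_max (h *: delta_mx ord0 (lift ord_max j) + z) =
  h *: delta_mx ord0 j + col' ord_max z.
Proof. by apply/rowP => i; rewrite !mxE (inj_eq lift_inj). Qed.

Lemma last_line n (h : R) (z : 'rV[R]_n.+1) j :
  (h *: delta_mx ord0 (lift ord_max j) + z) ord0 ord_max = z ord0 ord_max.
Proof. by rewrite !mxE (negbTE (neq_lift _ _)) ?andbF mulr0 add0r. Qed.

Lemma col'_vline n (h : R) (z : 'rV[R]_n.+1) :
  col' ord_max (h *: delta_mx ord0 ord_max + z) = col' ord_max z.
Proof.
by apply/rowP => i; rewrite !mxE [lift _ _ == _]eq_sym (negbTE (neq_lift _ _)) ?andbF mulr0 add0r.
Qed.

Lemma last_vline n (h : R) (z : 'rV[R]_n.+1) :
  (h *: delta_mx ord0 ord_max + z) ord0 ord_max = h + z ord0 ord_max.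
Proof. by rewrite !mxE !eqxx ?mulr1. Qed.

Lemma rV_rcons_line n (h : R) (x : 'rV[R]_n) t j :
  rV_rcons (h *: delta_mx ord0 j + x, t) =
  h *: delta_mx ord0 (lift ord_max j) + rV_rcons (x, t).
Proof.
apply/rowP => i; rewrite !mxE; case: unliftP => [k ->|->] /=.
  by rewrite !mxE (inj_eq lift_inj).
by rewrite (negbTE (neq_lift _ _)) ?andbF mulr0 add0r.
Qed.

Lemma rV_rcons_vline n (h : R) (x : 'rV[R]_n) t :
  rV_rcons (x, h + t) = h *: delta_mx ord0 ord_max + rV_rcons (x, t).
Proof.
apply/rowP => i; rewrite !mxE; case: unliftP => [k ->|->] /=.
  by rewrite [lift _ _ == _]eq_sym (negbTE (neq_lift _ _)) ?andbF mulr0 add0r.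
by rewrite ?eqxx mulr1.
Qed.

End differentiability_in_rV.

Section tensor_products_and_slices.
Context {R : realType} (n : nat).
Implicit Types (f : 'rV[R]_n -> R) (F : 'rV[R]_n.+1 -> R) (eta : R -> R).
Implicit Types (x : 'rV[R]_n) (z : 'rV[R]_n.+1) (t : R).

Definition tensor f eta : 'rV[R]_n.+1 -> R :=
  fun z => f (col' ord_max z) * eta (z ord0 ord_max).

Definition slice F t : 'rV[R]_n -> R := fun x => F (rV_rcons (x, t)).

Lemma is_derive_tensor_lift f eta z j df :
  is_derive (col' ord_max z) (delta_mx ord0 j) f df ->
  is_derive z (delta_mx ord0 (lift ord_max j)) (tensor f eta)
    (df * eta (z ord0 ord_max)).
Proof.
rewrite mulrC; apply: is_derive_along => h.
by rewrite /tensor col'_line last_line mulrC.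
Qed.

Lemma is_derive_tensor_last f eta z deta :
  is_derive (z ord0 ord_max : R) 1 eta deta ->
  is_derive z (delta_mx ord0 ord_max) (tensor f eta) (f (col' ord_max z) * deta).
Proof.
apply: is_derive_along => h.
by rewrite /tensor col'_vline last_vline [_%:A]mulr1.
Qed.

Lemma is_derive_slice F t x j dF :
  is_derive (rV_rcons (x, t)) (delta_mx ord0 (lift ord_max j)) F dF ->
  is_derive x (delta_mx ord0 j) (slice F t) dF.
Proof.
move=> dF'; rewrite -[dF]mul1r; apply: is_derive_along dF' => h.
by rewrite mul1r /slice rV_rcons_line.
Qed.

Lemma is_derive_vslice F t x dF :
  is_derive (rV_rcons (x, t)) (delta_mx ord0 ord_max) F dF ->
  is_derive t 1 (fun t => F (rV_rcons (x, t))) dF.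
Proof.
move=> dF'; rewrite -[dF]mul1r; apply: is_derive_along dF' => h.
by rewrite mul1r [_%:A]mulr1 rV_rcons_vline.
Qed.

Lemma differentiable_tensor f eta z :
  differentiable f (col' ord_max z) -> derivable eta (z ord0 ord_max) 1 ->
  differentiable (tensor f eta) z.
Proof.
move=> df /derivable1_diffP deta; apply: differentiableM.
  by apply: differentiable_comp => //; exact: differentiable_col'.
apply: (@differentiable_comp _ _ _ _ (fun z : 'rV[R]_n.+1 => z ord0 ord_max : R) eta) => //.
exact: differentiable_coord.
Qed.

Lemma differentiable_slice F t x :
  differentiable F (rV_rcons (x, t)) -> differentiable (slice F t) x.
Proof.
move=> dF; apply: (@differentiable_comp _ _ _ _ (fun x => rV_rcons (x, t)) F) => //.
exact: differentiable_rV_rcons1.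
Qed.

Lemma smooth_differentiable m (f : 'rV[R]_m -> R) (x : 'rV[R]_m) : smooth f -> differentiable f x.
Proof. by move=> /(_ [::]). Qed.

Lemma smooth_continuous m (f : 'rV[R]_m -> R) : smooth f -> continuous f.
Proof. by move=> sf x; apply: differentiable_continuous; exact: smooth_differentiable. Qed.

Lemma smooth_is_derive m (f : 'rV[R]_m -> R) (x : 'rV[R]_m) i :
  smooth f -> is_derive x (delta_mx ord0 i) f (partial i f x).
Proof. by move=> sf; apply/derivableP/diff_derivable; exact: smooth_differentiable. Qed.

Lemma smooth_partial m (f : 'rV[R]_m -> R) i : smooth f -> smooth (partial i f).
Proof. by move=> sf s x; rewrite -foldr_rcons; exact: sf. Qed.

Lemma partial_val m (f : 'rV[R]_m -> R) i (x : 'rV[R]_m) df :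
  is_derive x (delta_mx ord0 i) f df -> partial i f x = df.
Proof. by move=> [_ <-]. Qed.

Lemma partial_tensor_lift f eta j : smooth f ->
  partial (lift ord_max j) (tensor f eta) = tensor (partial j f) eta.
Proof.
move=> sf; apply/funext => z; apply: partial_val.
by apply: is_derive_tensor_lift; exact: smooth_is_derive.
Qed.

Lemma partial_tensor_last f eta eta' : (forall t, is_derive t 1 eta (eta' t)) ->
  partial ord_max (tensor f eta) = tensor f eta'.
Proof.
move=> deta; apply/funext => z; apply: partial_val.
exact: is_derive_tensor_last.
Qed.

(** Every iterated partial derivative is again a product, since each step
    differentiates only one of the two factors. *)
Lemma smooth_tensor f eta : smooth f -> smooth1 eta -> smooth (tensor f eta).
Proof.
move=> sf seta s.
have [g [eta' [sg seta' ->]]] : exists g eta',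
    [/\ smooth g, smooth1 eta' & foldr (@partial R n.+1) (tensor f eta) s = tensor g eta'].
  elim: s => [|i s [g [eta' [sg seta' /= ->]]]] /=; first by exists f, eta.
  case: (unliftP ord_max i) => [j ->|->].
    exists (partial j g), eta'; split=> //; first exact: smooth_partial.
    exact: partial_tensor_lift.
  have [eta'' seta'' deta'] := smooth1_derive seta'.
  by exists g, eta''; split=> //; exact: partial_tensor_last.
have [eta'' _ deta'] := smooth1_derive seta'.
by move=> z; apply: differentiable_tensor; [exact: smooth_differentiable|case: (deta' (z ord0 ord_max))].
Qed.

Lemma partial_slice F t j : smooth F ->
  partial j (slice F t) = slice (partial (lift ord_max j) F) t.
Proof.
move=> sF; apply/funext => x; apply: partial_val.
by apply: is_derive_slice; exact: smooth_is_derive.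
Qed.

Lemma smooth_slice F t : smooth F -> smooth (slice F t).
Proof.
move=> sF s.
have [G sG ->] : exists2 G, smooth G & foldr (@partial R n) (slice F t) s = slice G t.
  elim: s => [|j s [G sG /= ->]] /=; first by exists F.
  by exists (partial (lift ord_max j) G); [exact: smooth_partial|exact: partial_slice].
by move=> x; apply: differentiable_slice; exact: smooth_differentiable.
Qed.

End tensor_products_and_slices.

Lemma smooth_cst {R : realType} n (c : R) : smooth (fun _ : 'rV[R]_n => c).
Proof.
suff H s : exists d : R, foldr (@partial R n) (fun _ : 'rV[R]_n => c) s = cst d.
  by move=> s x; have [d ->] := H s; exact: differentiable_cst.
elim: s => [|i s [d /= ->]] /=; first by exists c.
exists 0; apply/funext => x; apply: partial_val; exact: is_derive_cst.
Qed.

Lemma widen_ord_lift n (j : 'I_n) : widen_ord (leqnSn n) j = lift ord_max j.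
Proof. by apply: val_inj; rewrite /= /bump leqNgt ltn_ord. Qed.

Lemma smooth_prod_plateau {R : realType} n (eta : 'I_n -> R -> R) :
  (forall i, smooth1 (eta i)) ->
  smooth (fun x : 'rV[R]_n => \prod_i eta i (x ord0 i)).
Proof.
elim: n eta => [|n IH] eta seta.
  rewrite (_ : (fun _ => _) = fun=> 1); first exact: smooth_cst.
  by apply/funext => x; rewrite big_ord0.
rewrite (_ : (fun _ => _) = tensor
    (fun x : 'rV[R]_n => \prod_j eta (lift ord_max j) (x ord0 j)) (eta ord_max)).
  by apply: smooth_tensor => //; apply: (IH (fun j => eta (lift ord_max j))).
apply/funext => z; rewrite big_ord_recr /tensor/=; congr (_ * _).
by apply: eq_bigr => j _; rewrite mxE widen_ord_lift.
Qed.

(** * Compact sets and test functions *)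

Section compact_sets_of_rV.
Context {R : realType} (n : nat).
Implicit Types (K U : set 'rV[R]_n) (f g h : 'rV[R]_n -> R).
Local Notation mu := (@lebesgue_rV R n).

Lemma compact_cube M : compact (cube n M : set 'rV[R]_n).
Proof.
have -> : cube n M = [set v : 'rV[R]_n | forall i, `[- M, M]%classic (v ord0 i)].
  by apply/seteqP; split=> x H i; have := H i; rewrite /= in_itv/= ler_norml.
apply: (rV_compact (A := fun=> `[- M, M]%classic)) => i; exact: segment_compact.
Qed.

Lemma compact_closed_rV K : compact K -> closed K.
Proof. by apply: compact_closed; exact: norm_hausdorff. Qed.

Lemma compact_sub_cube K : compact K -> exists2 M, 0 <= M & K `<=` cube n M.
Proof.
move=> /compact_bounded[M [_ KM]]; exists (`|M| + 1); first by rewrite addr_ge0.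
move=> x Kx i; apply: le_trans (KM _ _ x Kx); last first.
  by rewrite ltr_pwDr// ler_norm.
by rewrite [leRHS]/Num.Def.normr/= mx_normrE; exact: (le_bigmax _ _ (ord0, i)).
Qed.

Lemma compact_measurable_rV K : compact K -> measurable K.
Proof.
move=> cK; rewrite -[K]setCK; apply: measurableC; apply: open_measurable_rV.
by rewrite openC; exact: compact_closed_rV.
Qed.

Lemma lebesgue_rV_compact K : compact K -> (mu K < +oo)%E.
Proof.
move=> cK; have [M _ KM] := compact_sub_cube cK.
apply: le_lt_trans (lebesgue_rV_cube n M).
apply: le_measure => //; rewrite inE; first exact: compact_measurable_rV.
exact: measurable_cube.
Qed.

Lemma continuous_measurable_rV f : continuous f -> measurable_fun setT f.
Proof.
move=> /continuousP cf; apply: (measurability _ (RGenOpens.measurableE R)).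
move=> _ [_ [a [b ->] <-]]; rewrite setTI.
by apply: open_measurable_rV; apply: cf; exact: interval_open.
Qed.

Lemma continuous_bounded_on K f : continuous f -> compact K -> [bounded f x | x in K].
Proof.
move=> cf cK; have : compact (f @` K).
  by apply: continuous_compact => //; exact: continuous_subspaceT.
move=> /compact_bounded[M [Mr fM]]; exists M; split=> // x Mx y Ky.
by apply: fM => //; exists y.
Qed.

Let patch_supp (K U : set 'rV[R]_n) (f : 'rV[R]_n -> \bar R) :
  K `<=` U -> (forall x, ~ K x -> f x = 0%E) -> f \_ U = f \_ K.
Proof.
move=> KU f0; apply/funext => x; rewrite !patchE.
have [xK|xK] := boolP (x \in K); first by rewrite mem_set//; apply/KU/set_mem.
by case: ifPn => // _; apply: f0; move: xK; rewrite notin_setE.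
Qed.

Lemma integral_supp (K U : set 'rV[R]_n) (f : 'rV[R]_n -> \bar R) :
  K `<=` U -> (forall x, ~ K x -> f x = 0%E) ->
  (\int[mu]_(x in U) f x = \int[mu]_(x in K) f x)%E.
Proof.
move=> KU f0; rewrite integral_mkcond [RHS]integral_mkcond.
by rewrite (patch_supp KU).
Qed.

Lemma integrable_supp (K U : set 'rV[R]_n) (f : 'rV[R]_n -> \bar R) :
  measurable K -> measurable U ->
  K `<=` U -> (forall x, ~ K x -> f x = 0%E) ->
  mu.-integrable K f -> mu.-integrable U f.
Proof.
move=> mK mU KU f0 /(integrable_mkcond _ mK) iK; apply/(integrable_mkcond _ mU).
by rewrite (patch_supp KU).
Qed.

Lemma loc_integrable_mul U K h g : measurable U -> compact K -> K `<=` U ->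
  loc_integrable U h -> continuous g -> (forall x, ~ K x -> g x = 0) ->
  mu.-integrable U (fun x => (h x * g x)%:E).
Proof.
move=> mU cK KU ih cg g0; apply: (integrable_supp (K := K)) => //.
- exact: compact_measurable_rV.
- by move=> x nK; rewrite g0// mulr0.
apply: (@integrableMl _ _ _ _ _ (compact_measurable_rV cK) (EFin \o h) g).
- exact: ih.
- by apply: measurable_funTS; exact: continuous_measurable_rV.
- exact: continuous_bounded_on.
Qed.

Lemma continuous_loc_integrable U f : continuous f -> loc_integrable U f.
Proof.
move=> cf K cK KU; apply: measurable_bounded_integrable.
- exact: compact_measurable_rV.
- exact: lebesgue_rV_compact.
- by apply: measurable_funTS; exact: continuous_measurable_rV.
- exact: continuous_bounded_on.
Qed.

Lemma vanish_partial K f i : closed K -> (forall x, ~ K x -> f x = 0) ->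
  forall x, ~ K x -> partial i f x = 0.
Proof.
move=> cK f0 x Kx; rewrite /partial -(@derive_cst R _ R 0 x (delta_mx ord0 i)).
apply: near_eq_derive.
have : nbhs x (~` K) by apply: open_nbhs_nbhs; split => //; rewrite openC.
by apply: filterS => y; exact: f0.
Qed.

(** Any compact set outside which the function vanishes may serve in place of
    the closed support. *)
Lemma test_funP U phi : test_fun U phi <->
  smooth phi /\ exists K, [/\ compact K, K `<=` U & forall x, ~ K x -> phi x = 0].
Proof.
split=> [[sphi cK KU]|[sphi [K [cK KU phi0]]]].
  split=> //; exists (closure [set x | phi x != 0]); split=> // x nx.
  apply/eqP/negP => /negP x0; apply: nx; exact: subset_closure.
have clK := compact_closed_rV cK.
have sub : closure [set x | phi x != 0] `<=` K.
  rewrite [X in _ `<=` X](closure_id K).1//; apply: closure_subset => x /= /eqP x0.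
  by apply: contrapT => /phi0.
split=> //; last exact: subset_trans sub KU.
by apply: subclosed_compact cK sub; exact: closed_closure.
Qed.

Lemma test_fun_partial U phi i : test_fun U phi -> test_fun U (partial i phi).
Proof.
move=> /test_funP[sphi [K [cK KU phi0]]]; apply/test_funP.
split; first exact: smooth_partial.
exists K; split=> //; apply: vanish_partial => //.
exact: compact_closed_rV.
Qed.

Lemma test_fun_continuous U phi : test_fun U phi -> continuous phi.
Proof. by case=> sphi _ _; exact: smooth_continuous. Qed.

Lemma loc_integrable_test U h phi : measurable U ->
  loc_integrable U h -> test_fun U phi ->
  mu.-integrable U (fun x => (h x * phi x)%:E).
Proof.
move=> mU ih tphi; have cphi := test_fun_continuous tphi.
by have /test_funP[_ [K [cK KU phi0]]] := tphi; exact: loc_integrable_mul phi0.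
Qed.

End compact_sets_of_rV.

Lemma measurable_nonzero d (T : measurableType d) (R : realType) (U : set T)
    (f : T -> R) : measurable U -> measurable_fun U f ->
  measurable (U `&` [set x | f x != 0]).
Proof.
move=> mU mf; have -> : U `&` [set x | f x != 0] = U `&` (f @^-1` (~` [set 0])).
  by apply/seteqP; split=> x [Ux /eqP].
by apply: mf => //; apply: measurableC; exact: measurable_set1.
Qed.

Section compact_cylinder.
Context {R : realType} (n : nat).
Implicit Types (K : set 'rV[R]_n) (J : set R) (L : set 'rV[R]_n.+1).

Let continuous_col' : continuous (col' ord_max : 'rV[R]_n.+1 -> 'rV[R]_n).
Proof. by move=> z; apply: differentiable_continuous; exact: differentiable_col'. Qed.

Lemma compact_base L : compact L -> compact ((col' ord_max : _ -> 'rV[R]_n) @` L).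
Proof.
move=> cL; apply: continuous_compact => //.
by apply: continuous_subspaceT; exact: continuous_col'.
Qed.

Lemma compact_height L : compact L ->
  compact ((fun z : 'rV[R]_n.+1 => z ord0 ord_max : R) @` L).
Proof.
move=> cL; apply: continuous_compact => //.
by apply: continuous_subspaceT; exact: coord_continuous.
Qed.

Lemma sub_cylinder L :
  L `<=` cylinder ((col' ord_max : _ -> 'rV[R]_n) @` L)
           ((fun z : 'rV[R]_n.+1 => z ord0 ord_max : R) @` L).
Proof. by move=> z Lz; split; exists z. Qed.

Lemma compact_cylinder K J : compact K -> compact J -> compact (cylinder K J).
Proof.
move=> cK cJ; have [M M0 KM] := compact_sub_cube cK.
have [N [_ JN]] := compact_bounded cJ.
apply: (@subclosed_compact _ _ (cube n.+1 (M + (`|N| + 1)))).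
- apply: closedI.
    apply: preimage_closed; first by move=> z _; exact: continuous_col'.
    exact: compact_closed_rV.
  apply: (@preimage_closed _ _ (fun z : 'rV[R]_n.+1 => z ord0 ord_max : R)).
    by move=> z _; exact: coord_continuous.
  by apply: compact_closed => //; exact: Rhausdorff.
- exact: compact_cube.
- move=> z [Kz Jz]; rewrite cubeS; split=> [i|/=].
    by apply: (le_trans (KM _ Kz i)); rewrite lerDl addr_ge0.
  rewrite in_itv/= -ler_norml.
  apply: (@le_trans _ _ (`|N| + 1)); last by rewrite lerDr.
  by apply: JN => //; rewrite ltr_pwDr// ler_norm.
Qed.

Lemma open_cylinder K J : open K -> open J -> open (cylinder K J).
Proof.
move=> oK oJ; apply: openI.
  by apply: open_comp => // z _; exact: continuous_col'.
apply: (@open_comp _ _ (fun z : 'rV[R]_n.+1 => z ord0 ord_max : R)) => // z _.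
exact: coord_continuous.
Qed.

End compact_cylinder.

(** * Integration by parts *)

Section integration_by_parts.
Context {R : realType}.
Local Notation leb := (@lebesgue_measure R).

Lemma integral_derive_cptsupp (g g' : R -> R) (M : R) :
  (forall t : R, is_derive t 1 g (g' t)) -> continuous g' ->
  (forall t, M < `|t| -> g t = 0) ->
  (\int[leb]_t (g' t)%:E = 0)%E.
Proof.
move=> dg cg' g0; pose N : R := `|M| + 1.
have MN : M < N by rewrite ltr_pwDr// ler_norm.
have N0 : 0 < N by rewrite ltr_wpDl.
have cg : continuous g.
  move=> t; apply: differentiable_continuous; apply/derivable1_diffP.
  by case: (dg t).
have g'0 t : N < `|t| -> g' t = 0.
  move=> Nt; have [_ <-] := dg t.
  rewrite -(@derive_cst R R R 0 t 1); apply: near_eq_derive.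
  have : \forall y \near t, N < `|y|.
    exact: (@cvgr_gt R R (nbhs t) _ Num.norm `|t| (@norm_continuous R R t) N Nt).
  by apply: filterS => y Ny; apply: g0; exact: lt_trans Ny.
have -> : (\int[leb]_t (g' t)%:E = \int[leb]_(t in `[(- N)%R, N]) (g' t)%:E)%E.
  rewrite [RHS]integral_mkcond; apply: eq_integral => t _.
  rewrite patchE; case: ifPn => //; rewrite notin_setE/= in_itv/= -ler_norml.
  by move=> /negP; rewrite -ltNge => /g'0 ->.
rewrite (@continuous_FTC2 _ g' g).
- by rewrite !g0 ?subee// ?normrN ger0_norm// ltW.
- by rewrite gtrN.
- exact: continuous_subspaceT.
- split=> [t _||].
  - by case: (dg t).
  - by apply: cvg_at_right_filter; exact: cg.
  - by apply: cvg_at_left_filter; exact: cg.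
- by move=> t _; rewrite derive1E; case: (dg t).
Qed.

(** Along the last variable this is the fundamental theorem of calculus on each
    vertical line; along the others, Fubini reduces it to the slices. *)
Lemma integral_partial n (f : 'rV[R]_n -> R) (M : R) i :
  (forall (x : 'rV[R]_n) j, derivable f x (delta_mx ord0 j)) ->
  (forall j, continuous (partial j f)) ->
  (forall x, ~ cube n M x -> f x = 0) ->
  (\int[lebesgue_rV n]_x (partial i f x)%:E = 0)%E.
Proof.
elim: n f i => [f []//|n IH f i df cdf f0].
have iF : (lebesgue_rV n.+1).-integrable setT (fun x => (partial i f x)%:E).
  have := @loc_integrable_mul R n.+1 setT (cube n.+1 M) (cst 1) (partial i f)
    measurableT (@compact_cube R n.+1 M) (@subsetT _ _).
  under eq_fun do rewrite mul1r; apply=> //.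
    by apply: continuous_loc_integrable; exact: cst_continuous.
  apply: vanish_partial => //; exact: (compact_closed_rV (@compact_cube R n.+1 M)).
have := @fubini_cylinder R n setT setT measurableT measurableT (fun x => (partial i f x)%:E).
rewrite cylinderTT => /(_ iF)[E1 E2].
case: (unliftP ord_max i) => [j ij|ij].
- rewrite E1 integral0_eq// => t _.
  have dj k (x : 'rV[R]_n) : is_derive x (delta_mx ord0 k) (slice f t)
      (partial (lift ord_max k) f (rV_rcons (x, t))).
    by apply: is_derive_slice; apply/derivableP.
  have pj k x : partial (lift ord_max k) f (rV_rcons (x, t)) = partial k (slice f t) x.
    by rewrite (partial_val (dj k x)).
  rewrite ij; under eq_integral do rewrite pj.
  apply: IH => [x k|k|x Mx].
  + by case: (dj k x).
  + rewrite (_ : partial k _ = fun x => partial (lift ord_max k) f (rV_rcons (x, t))); last first.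
      by apply/funext => x; rewrite pj.
    move=> x; apply: (@continuous_comp _ _ _ (fun x : 'rV[R]_n => rV_rcons (x, t))); last exact: cdf.
    by apply: differentiable_continuous; exact: differentiable_rV_rcons1.
  + apply: f0 => fM; apply: Mx => k.
    by have := fM (lift ord_max k); rewrite lift_rV_rcons.
- rewrite E2 integral0_eq// => x _.
  have dg (t : R) : is_derive t 1 (fun t : R => f (rV_rcons (x, t))) (partial i f (rV_rcons (x, t))).
    by apply: is_derive_vslice; rewrite ij; apply/derivableP.
  apply: (@integral_derive_cptsupp _ _ M dg).
    move=> t; apply: (@continuous_comp _ _ _ (fun t : R => rV_rcons (x, t))); last exact: cdf.
    by apply: differentiable_continuous; exact: differentiable_rV_rcons2.
  move=> t Mt; apply: f0 => /(_ ord_max); rewrite last_rV_rcons.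
  by move=> tM; move: Mt; rewrite ltNge tM.
Qed.

Definition grad n (phi : 'rV[R]_n -> R) : 'rV[R]_n -> 'rV[R]_n :=
  fun x => \row_i partial i phi x.

Lemma weak_gradient_smooth n (U : set 'rV[R]_n) phi : open U -> smooth phi ->
  is_weak_gradient U phi (grad phi).
Proof.
move=> oU sphi; have mU := open_measurable_rV oU.
have cphi := smooth_continuous sphi.
split=> [|i]; first exact: continuous_loc_integrable.
have cdphi j : continuous (partial j phi).
  by apply: smooth_continuous; exact: smooth_partial.
split; first by apply: continuous_loc_integrable; under eq_fun do rewrite mxE; exact: cdphi.
move=> psi tpsi; under [in RHS]eq_integral do rewrite mxE.
have ldphi : loc_integrable U (partial i phi) by exact: continuous_loc_integrable.
have lphi : loc_integrable U phi by exact: continuous_loc_integrable.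
have i1 := loc_integrable_test mU lphi (test_fun_partial i tpsi).
have i2 := loc_integrable_test mU ldphi tpsi.
have /test_funP[spsi [K [cK KU psi0]]] := tpsi.
have [M _ KM] := compact_sub_cube cK.
have dM (x : 'rV[R]_n) j : is_derive x (delta_mx ord0 j) (fun x => phi x * psi x)
    (phi x * partial j psi x + psi x * partial j phi x).
  by apply: is_deriveM; exact: smooth_is_derive.
have pM j : partial j (fun x => phi x * psi x) =
    fun x => phi x * partial j psi x + partial j phi x * psi x.
  by apply/funext => x; rewrite (partial_val (dM x j)) [psi x * _]mulrC.
have sum0 : (\int[lebesgue_rV n]_(x in U) (phi x * partial i psi x)%:E +
             \int[lebesgue_rV n]_(x in U) (partial i phi x * psi x)%:E = 0)%E.
  rewrite -integralD//=.
  have := @integral_partial n (fun x => phi x * psi x) M i.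
  rewrite pM => <-; last 3 first.
  - by move=> x j; case: (dM x j).
  - move=> j; rewrite pM => x.
    have cpsi : continuous psi by exact: smooth_continuous.
    have cdpsi : continuous (partial j psi).
      by apply: smooth_continuous; exact: smooth_partial.
    exact: (cvgD (cvgM (cphi x) (cdpsi x)) (cvgM (cdphi j x) (cpsi x))).
  - by move=> x nM; rewrite psi0 ?mulr0// => /KM.
  have dpsi0 x : ~ K x -> partial i psi x = 0.
    apply: vanish_partial => //; exact: compact_closed_rV.
  have f0 x : ~ K x -> (phi x * partial i psi x + partial i phi x * psi x)%:E = 0%E.
    by move=> nK; rewrite dpsi0// psi0// !mulr0 addr0.
  by rewrite (integral_supp KU f0) (integral_supp (@subsetT _ K) f0).
have f1 := integrable_fin_num mU i1.
have f2 := integrable_fin_num mU i2.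
move: sum0; rewrite -(fineK f1) -(fineK f2) -EFinD => -[/eqP].
by rewrite addr_eq0 => /eqP ->.
Qed.

End integration_by_parts.

(** * The fundamental lemma of the calculus of variations *)

Section boxes.
Context {R : realType} (n : nat).
Implicit Types (a b x : 'rV[R]_n) (U : set 'rV[R]_n).

Definition openbox a b : set 'rV[R]_n :=
  [set x | forall i, a ord0 i < x ord0 i < b ord0 i].

Definition closedbox a b : set 'rV[R]_n :=
  [set x | forall i, a ord0 i <= x ord0 i <= b ord0 i].

Lemma openbox_sub a b : openbox a b `<=` closedbox a b.
Proof. by move=> x H i; have /andP[? ?] := H i; rewrite !ltW. Qed.

Lemma compact_closedbox a b : compact (closedbox a b).
Proof.
have -> : closedbox a b = [set v : 'rV[R]_n | forall i, `[a ord0 i, b ord0 i]%classic (v ord0 i)].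
  by apply/seteqP; split=> x H i; have := H i; rewrite /= in_itv/=.
apply: (rV_compact (A := fun i => `[a ord0 i, b ord0 i]%classic)) => i.
exact: segment_compact.
Qed.

Lemma measurable_openbox a b : measurable (openbox a b).
Proof.
have -> : openbox a b = \big[setI/setT]_(i < n)
    ((fun x : 'rV[R]_n => x ord0 i) @^-1` `]a ord0 i, b ord0 i[%classic).
  rewrite -bigcap_seq; apply/seteqP; split=> [x bx i _|x bx i].
    by rewrite /= in_itv/=; exact: bx.
  by have := bx i; rewrite /= in_itv/=; apply; rewrite mem_index_enum.
apply: bigsetI_measurable => i _; rewrite -[X in measurable X]setTI.
by apply: measurable_coord => //; exact: measurable_itv.
Qed.

Lemma openboxI a b a' b' : openbox a b `&` openbox a' b' =
  openbox (\row_i Num.max (a ord0 i) (a' ord0 i))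
          (\row_i Num.min (b ord0 i) (b' ord0 i)).
Proof.
apply/seteqP; split=> [x [H H'] i|x H].
  rewrite !mxE gt_max lt_min.
  by have /andP[-> ->] := H i; have /andP[? ?] := H' i; apply/andP.
by split=> i; have := H i; rewrite !mxE gt_max lt_min =>
  /andP[/andP[? ?] /andP[? ?]]; apply/andP.
Qed.

Definition openboxes : set (set 'rV[R]_n) := [set B | exists a b, B = openbox a b].

Lemma measurable_rV_openboxes : @measurable _ 'rV[R]_n = <<s openboxes >>.
Proof.
apply/seteqP; split; last first.
  apply: smallest_sub; first exact: sigma_algebra_measurable.
  by move=> _ [a [b ->]]; exact: measurable_openbox.
pose T := g_sigma_algebraType openboxes.
have mcoord i : measurable_fun [set: T] (fun x : T => (x : 'rV[R]_n) ord0 i : R).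
  apply: (measurability _ (RGenOpens.measurableE R)).
  move=> _ [_ [p [q ->]] <-]; rewrite setTI.
  pose e k : R := (k : nat)%:R.
  rewrite [X in measurable X](_ : _ = \bigcup_k
      openbox (\row_j if j == i then p else - e k) (\row_j if j == i then q else e k)).
    apply: bigcupT_measurable => k; apply: sub_sigma_algebra.
    by exists (\row_j if j == i then p else - e k), (\row_j if j == i then q else e k).
  apply/seteqP; split=> [x|x [k _ /(_ i)]]; rewrite /= in_itv/=; last first.
    by rewrite !mxE eqxx.
  move=> pxq; exists (Num.truncn `|x|).+1 => // j; rewrite !mxE.
  case: eqVneq => [->//|_]; rewrite -ltr_norml; apply: le_lt_trans (truncnS_gt _).
  by rewrite [leRHS]/Num.Def.normr/= mx_normrE; exact: (le_bigmax _ _ (ord0, j)).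
apply: smallest_sub; first exact: smallest_sigma_algebra.
rewrite -bigcup_seq => A [i _ [B mB <-]].
exact: (mcoord i).
Qed.

(** Boxes with rational corners; being countable, they turn local statements
    into almost everywhere statements on [U]. *)
Lemma open_box_cover U : open U -> exists (D : set nat) (a b : nat -> 'rV[R]_n),
  (forall k, D k -> closedbox (a k) (b k) `<=` U) /\
  U = \bigcup_(k in D) openbox (a k) (b k).
Proof.
move=> oU; pose c (q : 'rV[rat]_n) : 'rV[R]_n := map_mx ratr q.
pose q k : 'rV[rat]_n * 'rV[rat]_n := odflt (0, 0) (unpickle k).
pose a k := c (q k).1; pose b k := c (q k).2.
exists [set k | closedbox (a k) (b k) `<=` U], a, b; split => //.
apply/seteqP; split=> [x Ux|x [k kU /openbox_sub]]; last exact: kU.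
have /nbhs_ballP[e /= e0 sub] : nbhs x U by exact: open_nbhs_nbhs.
have /choice[l lP] : forall i : 'I_n, exists r : rat, x ord0 i - e / 2 < ratr r < x ord0 i.
  move=> i; have : x ord0 i - e / 2 < x ord0 i by rewrite gtrBl divr_gt0.
  by move=> /rat_in_itvoo[r]; rewrite in_itv/=; exists r.
have /choice[u uP] : forall i : 'I_n, exists r : rat, x ord0 i < ratr r < x ord0 i + e / 2.
  move=> i; have : x ord0 i < x ord0 i + e / 2 by rewrite ltrDl divr_gt0.
  by move=> /rat_in_itvoo[r]; rewrite in_itv/=; exists r.
have qE : q (pickle (\row_i l i, \row_i u i)) = (\row_i l i, \row_i u i).
  by rewrite /q pickleK.
exists (pickle (\row_i l i, \row_i u i)) => [/= y By|i]; last first.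
  rewrite /a /b /c qE/= !mxE. by have /andP[_ ->] := lP i; have /andP[-> _] := uP i.
apply: sub; split=> // i j; rewrite (ord1 i) /ball/= ltr_distlC.
have := By j; rewrite /a /b /c qE/= !mxE.
have := lP j; have := uP j; lra.
Qed.

End boxes.

Section fundamental_lemma.
Context {R : realType} (n : nat).
Implicit Types (U : set 'rV[R]_n) (f h : 'rV[R]_n -> R).
Local Notation mu := (@lebesgue_rV R n).

Lemma loc_integrable_measurable U h : open U -> loc_integrable U h ->
  measurable_fun U h.
Proof.
move=> oU ih; have [D [a [b [abU UE]]]] := open_box_cover oU.
rewrite UE bigcup_mkcond; apply/measurable_fun_bigcup => k.
  by case: ifP => // _; exact: measurable_openbox.
case: ifPn => [/set_mem/abU kU|_]; last exact: measurable_fun_set0.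
have /measurable_int/measurable_EFinP := ih _ (@compact_closedbox R n (a k) (b k)) kU.
apply: measurable_funS; last exact: openbox_sub.
by apply: compact_measurable_rV; exact: compact_closedbox.
Qed.

(** Products of one-dimensional cutoffs are test functions that converge to the
    indicator of the box, and dominated convergence applies on the closed box. *)
Lemma integral_openbox0 U h (a b : 'rV[R]_n) :
  (forall phi, test_fun U phi -> (\int[mu]_(x in U) (h x * phi x)%:E = 0)%E) ->
  loc_integrable U h -> closedbox a b `<=` U ->
  (\int[mu]_(x in openbox a b) (h x)%:E = 0)%E.
Proof.
move=> H ih abU.
have cK := @compact_closedbox R n a b.
have mK := compact_measurable_rV cK.
have mB := @measurable_openbox R n a b.
pose phi (k : nat) (x : 'rV[R]_n) := \prod_i plateau k.+1%:R (a ord0 i) (b ord0 i) (x ord0 i) : R.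
have phi_out k x : ~ openbox a b x -> phi k x = 0.
  move=> /existsNP[i /negP xi]; rewrite /phi (bigD1 i)//= plateau_out ?mul0r//.
have tphi k : test_fun U (phi k).
  apply/test_funP; split.
    apply: (smooth_prod_plateau (eta := fun i => plateau k.+1%:R (a ord0 i) (b ord0 i))) => i.
    exact: smooth1_plateau.
  exists (closedbox a b); split => // x nx; apply: phi_out => /openbox_sub.
  exact: nx.
have phi01 k x : 0 <= phi k x <= 1.
  apply: (big_ind (fun y => 0 <= y <= 1)) => [|y z /andP[y0 y1] /andP[z0 z1]|i _].
  - by rewrite ler01 lexx.
  - by rewrite mulr_ge0// mulr_ile1.
  - by rewrite plateau_ge0 plateau_le1.
have phi_cvg x : openbox a b x -> \forall k \near \oo, phi k x = 1.
  move=> xab; have : \forall k \near \oo, forall i : 'I_n,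
      k.+1%:R^-1 < x ord0 i - a ord0 i /\ k.+1%:R^-1 < b ord0 i - x ord0 i.
    apply: filter_forall => i; have /andP[xa xb] := xab i.
    have xa0 : 0 < x ord0 i - a ord0 i by rewrite subr_gt0.
    have xb0 : 0 < b ord0 i - x ord0 i by rewrite subr_gt0.
    apply: filterS2 (near_infty_natSinv_lt (PosNum xa0)) (near_infty_natSinv_lt (PosNum xb0)).
    by move=> k ? ?.
  apply: filterS => k kP; rewrite /phi big1// => i _.
  rewrite plateau1// ?ltr0n//; have [k1 k2] := kP i.
  by move: (k.+1%:R^-1) k1 k2 => y *; apply/andP; split; lra.
have mh : measurable_fun (closedbox a b) (EFin \o h) by apply: measurable_int (ih _ cK abU).
have mphi k : measurable_fun (closedbox a b) (phi k).
  apply: measurable_funTS; apply: continuous_measurable_rV.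
  exact: test_fun_continuous (tphi k).
have [|||||_ _] := @dominated_convergence _ _ _ mu (closedbox a b) mK
    (fun k x => (h x * phi k x)%:E) ((EFin \o h) \_ (openbox a b))
    (fun x => `|(h x)%:E|%E).
- move=> k; apply/measurable_EFinP; apply: measurable_funM => //.
  exact/measurable_EFinP.
- by apply/measurable_restrict => //; apply: measurable_funS mh.
- apply: aeW => x _; rewrite patchE; case: ifPn => [/set_mem xab|].
    apply: cvg_near_cst; apply: filterS (phi_cvg _ xab) => k ->.
    by rewrite mulr1.
  rewrite notin_setE => xab; apply: cvg_near_cst; apply: nearW => k.
  by rewrite phi_out// mulr0.
- by apply: integrable_abse; exact: ih.
- apply: aeW => x k _; rewrite abse_EFin lee_fin normrM ler_piMr//.
  by have /andP[? ?] := phi01 k x; rewrite ger0_norm.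
rewrite -integral_mkcondr setIidr; last exact: openbox_sub.
rewrite (_ : [sequence _]_k = cst 0%E).
  by move=> /cvg_lim <-//; rewrite lim_cst.
apply/funext => k /=; rewrite -[RHS](H _ (tphi k)).
apply/esym/integral_supp => // x nx; rewrite phi_out ?mulr0// => /openbox_sub.
exact: nx.
Unshelve. all: by end_near. Qed.

(** Inside a fixed box [V], the measurable sets [E] such that [h] has integral
    zero over [V `&` E] form a Dynkin system that contains the boxes, hence all
    measurable sets; so [h] vanishes almost everywhere on [V]. *)
Lemma fundamental_lemma U h : open U -> loc_integrable U h ->
  (forall phi, test_fun U phi -> (\int[mu]_(x in U) (h x * phi x)%:E = 0)%E) ->
  {ae mu, forall x, U x -> h x = 0}.
Proof.
move=> oU ih H; have [D [a [b [abU UE]]]] := open_box_cover oU.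
suff boxk k : {ae mu, forall x, D k -> openbox (a k) (b k) x -> h x = 0}.
  apply: filterS (ae_foralln boxk) => x xk; rewrite UE => -[k Dk xab].
  exact: xk xab.
have [Dk|nDk] := pselect (D k); last by apply: aeW => x /nDk.
set V := openbox (a k) (b k).
have mV : measurable V by exact: measurable_openbox.
have VU : V `<=` U by apply: subset_trans (abU _ Dk); exact: openbox_sub.
have iV : mu.-integrable V (EFin \o h).
  apply: (@integrableS _ _ _ _ (closedbox (a k) (b k))) => //.
  - by apply: compact_measurable_rV; exact: compact_closedbox.
  - exact: openbox_sub.
  - by apply: ih; [exact: compact_closedbox|exact: abU].
have mhV := measurable_int _ iV.
have box0 c d : closedbox c d `<=` U -> (\int[mu]_(x in openbox c d) (h x)%:E = 0)%E.
  exact: integral_openbox0.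
have V0 : (\int[mu]_(x in V) (h x)%:E = 0)%E by apply: box0; exact: abU.
have int0 : forall E, <<s @openboxes R n >> E -> (\int[mu]_(x in V `&` E) (h x)%:E = 0)%E.
  apply: (@dynkin_induction _ 'rV[R]_n (@openboxes R n)
    (fun E => \int[mu]_(x in V `&` E) (h x)%:E = 0)%E).
  - exact: measurable_rV_openboxes.
  - by move=> _ _ [c [d ->]] [c' [d' ->]]; rewrite openboxI; do 2 eexists.
  - by rewrite setIT.
  (* The corners of the intersection may be in the wrong order; the closed box
     is then empty, and in any case it is contained in that of [V]. *)
  - move=> _ [c [d ->]]; rewrite /V openboxI; apply: box0.
    apply: subset_trans (abU _ Dk) => x xcd i; have := xcd i.
    by rewrite !mxE ge_max le_min => /andP[/andP[-> _] /andP[-> _]].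
  - move=> S mS S0; have mVS := measurableI _ _ mV mS.
    have mVC := measurableI _ _ mV (measurableC mS).
    have := V0; rewrite -{1}[V]setIT -(setUv S) setIUr integral_setU//=.
    + by rewrite S0 add0e.
    + by rewrite -setIUr setUv setIT.
    + by apply/disj_setPS => x [[_ Sx] [_ /(_ Sx)]].
  - move=> F mF tF F0; rewrite setI_bigcupr integral_bigcup//=.
    + by rewrite eseries0.
    + exact: trivIset_setIl.
    + by move=> i; exact: measurableI.
    + rewrite -setI_bigcupr; apply: integrableS iV => //.
      by apply: measurableI => //; exact: bigcupT_measurable.
have : ae_eq mu V (EFin \o h) (cst 0%E).
  apply: integral_ae_eq => // E EV mE.
  rewrite integral0 -(setIidr EV); apply: int0.
  by rewrite -measurable_rV_openboxes.
by apply: filterS => x hx _ /hx[].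
Qed.

End fundamental_lemma.

(** * Weak gradients *)

Section weak_gradients.
Context {R : realType} (n : nat).
Implicit Types (U : set 'rV[R]_n) (f g phi : 'rV[R]_n -> R) (G H : 'rV[R]_n -> 'rV[R]_n).
Local Notation mu := (@lebesgue_rV R n).

Lemma wgradP U f : has_weak_gradient U f -> is_weak_gradient U f (wgrad U f).
Proof. by move=> [G fG]; rewrite /wgrad; apply: xgetPex; exists G. Qed.

Lemma loc_integrable_lin U f g (c : R) : loc_integrable U f ->
  loc_integrable U g -> loc_integrable U (fun x => f x + c * g x).
Proof.
move=> if_ ig K cK KU; have mK := compact_measurable_rV cK.
apply: eq_integrable (integrableD mK (if_ K cK KU) (integrableZl mK c (ig K cK KU))) => //.
Qed.

Lemma integral_lin U f g phi (c : R) : measurable U ->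
  loc_integrable U f -> loc_integrable U g -> test_fun U phi ->
  (\int[mu]_(x in U) ((f x + c * g x) * phi x)%:E =
   \int[mu]_(x in U) (f x * phi x)%:E + c%:E * \int[mu]_(x in U) (g x * phi x)%:E)%E.
Proof.
move=> mU ilf ilg tphi.
have i1 := loc_integrable_test mU ilf tphi.
have i2 := loc_integrable_test mU ilg tphi.
rewrite -integralZl// -integralD//; last exact: integrableZl.
by apply: eq_integral => x _; rewrite -EFinM -EFinD mulrDl mulrA.
Qed.

Lemma weak_gradient_lin U f g G H (c : R) : open U ->
  is_weak_gradient U f G -> is_weak_gradient U g H ->
  is_weak_gradient U (fun x => f x + c * g x) (fun x => G x + c *: H x).
Proof.
move=> oU [lf fG] [lg gH]; have mU := open_measurable_rV oU.
split=> [|i]; first exact: loc_integrable_lin.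
have [lG fGi] := fG i; have [lH gHi] := gH i.
have E : (fun x => (G x + c *: H x) ord0 i) = fun x => G x ord0 i + c * H x ord0 i.
  by apply/funext => x; rewrite !mxE.
rewrite E; split=> [|phi tphi]; first exact: loc_integrable_lin.
rewrite integral_lin//; last exact: test_fun_partial.
rewrite fGi// gHi//.
under [in RHS]eq_integral do rewrite (congr1 (fun F => F _) E).
rewrite integral_lin// fin_num_oppeD.
  by rewrite muleN.
rewrite fin_numM//; apply: integrable_fin_num => //; exact: loc_integrable_test.
Qed.

Lemma weak_gradientD U f g G H : open U ->
  is_weak_gradient U f G -> is_weak_gradient U g H ->
  is_weak_gradient U (f \+ g) (fun x => G x + H x).
Proof.
move=> oU fG gH; have := weak_gradient_lin 1 oU fG gH.
by congr is_weak_gradient; apply/funext => x /=; rewrite ?mul1r ?scale1r.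
Qed.

Lemma weak_gradientB U f g G H : open U ->
  is_weak_gradient U f G -> is_weak_gradient U g H ->
  is_weak_gradient U (f \- g) (fun x => G x - H x).
Proof.
move=> oU fG gH; have := weak_gradient_lin (-1) oU fG gH.
by congr is_weak_gradient; apply/funext => x /=; rewrite ?mulN1r ?scaleN1r.
Qed.

Lemma weak_gradient_unique U f G H : open U ->
  is_weak_gradient U f G -> is_weak_gradient U f H ->
  {ae mu, forall x, U x -> G x = H x}.
Proof.
move=> oU [lf fG] [_ fH]; have mU := open_measurable_rV oU.
suff GH i : {ae mu, forall x, U x -> G x ord0 i + -1 * H x ord0 i = 0}.
  have : {ae mu, forall x, forall i, U x -> G x ord0 i + -1 * H x ord0 i = 0}.
    exact: filter_forall.
  apply: filterS => x xGH Ux; apply/rowP => i.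
  by have /eqP := xGH i Ux; rewrite mulN1r subr_eq0 => /eqP.
have [lG fGi] := fG i; have [lH fHi] := fH i.
apply: fundamental_lemma => // [|phi tphi]; first exact: loc_integrable_lin.
rewrite integral_lin// mulN1e.
have /eqP := fGi _ tphi; rewrite fHi// eqe_opp => /eqP ->.
by rewrite subee//; apply: integrable_fin_num => //; exact: loc_integrable_test.
Qed.

Lemma wgrad_ae U f G : open U -> is_weak_gradient U f G ->
  {ae mu, forall x, U x -> wgrad U f x = G x}.
Proof.
move=> oU fG; apply: (weak_gradient_unique oU _ fG).
exact: (wgradP (ex_intro _ G fG)).
Qed.

Lemma weak_gradient_measurable U f G i : open U -> is_weak_gradient U f G ->
  measurable_fun U (fun x => G x ord0 i).
Proof. by move=> oU [_ /(_ i)[lG _]]; exact: loc_integrable_measurable. Qed.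

End weak_gradients.

Section tensor_weak_gradient.
Context {R : realType} (n : nat).
Implicit Types (f : 'rV[R]_n -> R) (eta : R -> R) (A : set 'rV[R]_n) (J : set R).
Local Notation mu := (@lebesgue_rV R n).
Local Notation mu1 := (@lebesgue_rV R n.+1).
Local Notation leb := (@lebesgue_measure R).

Lemma measurable_tensor A J f eta : measurable A ->
  measurable (J : set (measurableTypeR R)) ->
  measurable_fun A f -> measurable_fun J eta ->
  measurable_fun (cylinder A J) (tensor f eta).
Proof.
move=> mA mJ mf meta; apply: measurable_funM.
  apply: (@measurable_comp _ _ _ _ _ _ A f _ (col' ord_max)) => //.
    by move=> _ [z [Az _] <-].
  by apply: measurable_funTS; exact: measurable_col'.
apply: (@measurable_comp _ _ _ _ _ _ J eta _ (fun z : 'rV[R]_n.+1 => z ord0 ord_max)) => //.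
  by move=> _ [z [_ Jz] <-].
by apply: measurable_funTS; exact: measurable_coord.
Qed.

(** A compact subset of the cylinder lies in the product of its two projections,
    over which the integral of the product factors. *)
Lemma loc_integrable_tensor A J f eta :
  loc_integrable A f -> continuous eta ->
  loc_integrable (cylinder A J) (tensor f eta).
Proof.
move=> lf ceta L cL Lsub.
set K := (col' ord_max : _ -> 'rV[R]_n) @` L.
set K2 := (fun z : 'rV[R]_n.+1 => z ord0 ord_max : R) @` L.
have cK : compact K := compact_base cL.
have cK2 : compact K2 := compact_height cL.
have mK := compact_measurable_rV cK.
have mK2 : measurable (K2 : set (measurableTypeR R)) by exact: compact_measurable.
have KA : K `<=` A by move=> _ [z /Lsub[Az _] <-].
have iK := lf _ cK KA.
have mf : measurable_fun K f by apply/measurable_EFinP; exact: measurable_int iK.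
have meta : measurable_fun K2 eta.
  by apply: measurable_funTS; exact: continuous_measurable_fun.
have mt := measurable_tensor mK mK2 mf meta.
apply: (@integrableS _ _ _ _ (cylinder K K2)).
- exact: measurable_cylinder.
- exact: compact_measurable_rV.
- exact: sub_cylinder.
apply/integrableP; split; first exact/measurable_EFinP.
have [|//|_ -> _ _] := @tonelli_cylinder R n K K2 mK mK2 (fun z => `|(tensor f eta z)%:E|%E).
  by apply: measurableT_comp => //; exact/measurable_EFinP.
have ieta : leb.-integrable K2 (EFin \o eta).
  by apply: continuous_compact_integrable => //; exact: (continuous_subspaceT ceta).
under eq_integral => x xK.
  under eq_integral => t tK.
    rewrite /tensor col'_rV_rcons last_rV_rcons EFinM abseM.
    over.
  rewrite ge0_integralZl//; last first.
    by apply: measurableT_comp => //; exact/measurable_EFinP.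
  rewrite muleC.
  over.
rewrite /= ge0_integralZl//; last first.
- by apply: integral_ge0.
- by apply/measurable_EFinP; exact: measurableT_comp.
case/integrableP : ieta => _ ieta; case/integrableP : iK => _ iK.
by rewrite lte_mul_pinfty ?integral_ge0// ge0_fin_numE ?integral_ge0.
Qed.

Lemma test_fun_slice A J F t : test_fun (cylinder A J) F -> test_fun A (slice F t).
Proof.
move=> /test_funP[sF [L [cL Lsub F0]]]; apply/test_funP.
split; first exact: smooth_slice.
exists ((col' ord_max : _ -> 'rV[R]_n) @` L); split.
- exact: compact_base.
- by move=> _ [z /Lsub[Az _] <-].
- move=> x nx; apply: F0 => Lz; apply: nx.
  by exists (rV_rcons (x, t)) => //; exact: col'_rV_rcons.
Qed.

Lemma test_fun_tensor A J f eta (c d : R) : test_fun A f -> smooth1 eta ->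
  `[c, d] `<=` J -> (forall t, ~ `[c, d]%classic t -> eta t = 0) ->
  test_fun (cylinder A J) (tensor f eta).
Proof.
move=> /test_funP[sf [K [cK KA f0]]] seta cdJ eta0; apply/test_funP.
split; first exact: smooth_tensor.
exists (cylinder K `[c, d]); split.
- by apply: compact_cylinder => //; exact: segment_compact.
- by move=> z [Kz /cdJ Jz]; split => //; exact: KA.
- move=> z nz; rewrite /tensor.
  have [Kz|/f0->] := pselect (K (col' ord_max z)); last by rewrite mul0r.
  by rewrite eta0 ?mulr0// => Jz; apply: nz.
Qed.

(** The gradient of [tensor f eta] when [G] is the gradient of [f] and [eta'] the
    derivative of [eta]. *)
Definition tensor_grad f (G : 'rV[R]_n -> 'rV[R]_n) eta eta' :
    'rV[R]_n.+1 -> 'rV[R]_n.+1 :=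
  fun z => rV_rcons (eta (z ord0 ord_max) *: G (col' ord_max z),
                     tensor f eta' z).

(** In a horizontal direction, a slice of the test function is a test function
    for [f], and the resulting identities are integrated against [eta].  In the
    last direction [f] is a constant factor on each vertical line, along which
    [eta] times the test function has compact support. *)
Lemma weak_gradient_tensor A J f G eta eta' : open A -> open J ->
  is_weak_gradient A f G ->
  (forall t : R, is_derive t 1 eta (eta' t)) -> continuous eta' ->
  is_weak_gradient (cylinder A J) (tensor f eta) (tensor_grad f G eta eta').
Proof.
move=> oA oJ [lf fG] deta ceta'.
have mA := open_measurable_rV oA.
have mJ : measurable (J : set (measurableTypeR R)) by exact: open_measurable.
have mC := measurable_cylinder mA mJ.
have ceta : continuous eta.
  move=> t; apply: differentiable_continuous; apply/derivable1_diffP.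
  by case: (deta t).
have lC := loc_integrable_tensor (J := J) lf ceta.
split=> // i; case: (unliftP ord_max i) => [j ij|ij]; rewrite {}ij.
- have [lG fGj] := fG j.
  have -> : (fun z => tensor_grad f G eta eta' z ord0 (lift ord_max j)) =
            tensor (fun x => G x ord0 j) eta.
    by apply/funext => z; rewrite lift_rV_rcons mxE mulrC.
  have lCG := loc_integrable_tensor (J := J) lG ceta.
  split=> // Psi tPsi.
  have sPsi : smooth Psi by case: tPsi.
  have i1 := loc_integrable_test mC lC (test_fun_partial (lift ord_max j) tPsi).
  have i2 := loc_integrable_test mC lCG tPsi.
  have E2 : (- (\int[mu1]_(z in cylinder A J) (tensor_grad f G eta eta' z ord0 (lift ord_max j) * Psi z)%:E)
      = \int[mu1]_(z in cylinder A J) (- (tensor (fun x => G x ord0 j) eta z * Psi z)%:E))%E.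
    rewrite integralN; last exact: integrable_add_def.
    congr (- _)%E; apply: eq_integral => z _.
    by rewrite lift_rV_rcons mxE [eta _ * _]mulrC.
  rewrite E2 (fubini_cylinder mA mJ i1).1 (fubini_cylinder mA mJ (integrableN i2)).1.
  apply: eq_integral => t _.
  have tS := test_fun_slice t tPsi.
  transitivity ((eta t)%:E * \int[mu]_(x in A) (f x * partial j (slice Psi t) x)%:E)%E.
    rewrite -integralZl//; last first.
      by apply: loc_integrable_test => //; exact: test_fun_partial.
    apply: eq_integral => x _; rewrite -EFinM partial_slice// /tensor.
    by rewrite col'_rV_rcons last_rV_rcons /slice mulrA [_ * f x]mulrC.
  rewrite fGj// muleN -mulNe -integralZl//; last exact: loc_integrable_test.
  apply: eq_integral => x _; rewrite /= -EFinM /tensor; congr EFin.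
  by rewrite col'_rV_rcons last_rV_rcons /slice; ring.
- have -> : (fun z => tensor_grad f G eta eta' z ord0 ord_max) = tensor f eta'.
    by apply/funext => z; rewrite last_rV_rcons.
  have lC' := loc_integrable_tensor (J := J) lf ceta'.
  split=> // Psi tPsi.
  have sPsi : smooth Psi by case: tPsi.
  have i1 := loc_integrable_test mC lC (test_fun_partial ord_max tPsi).
  have i2 := loc_integrable_test mC lC' tPsi.
  under [in RHS]eq_integral do rewrite last_rV_rcons.
  have sum0 : (\int[mu1]_(z in cylinder A J) (tensor f eta z * partial ord_max Psi z)%:E +
      \int[mu1]_(z in cylinder A J) (tensor f eta' z * Psi z)%:E = 0)%E.
    rewrite -integralD//.
    rewrite (fubini_cylinder mA mJ (integrableD mC i1 i2)).2.
    rewrite integral0_eq// => x Ax.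
    pose g t := f x * (eta t * Psi (rV_rcons (x, t))).
    pose g' t := f x * (eta t * partial ord_max Psi (rV_rcons (x, t)) + Psi (rV_rcons (x, t)) * eta' t).
    have dPsi (t : R) : is_derive t 1 (fun t => Psi (rV_rcons (x, t))) (partial ord_max Psi (rV_rcons (x, t))).
      by apply: is_derive_vslice; exact: smooth_is_derive.
    have dg (t : R) : is_derive t 1 g (g' t).
      have := @is_deriveM R R _ _ t 1 _ _ (is_derive_cst (f x) t 1) (is_deriveM (deta t) (dPsi t)).
      by rewrite scaler0 addr0.
    have cline (F : 'rV[R]_n.+1 -> R) : continuous F -> continuous (fun t : R => F (rV_rcons (x, t))).
      move=> cF t; apply: (@continuous_comp _ _ _ (fun t : R => rV_rcons (x, t))); last exact: cF.
      by apply: differentiable_continuous; exact: differentiable_rV_rcons2.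
    have c1 := cline _ (smooth_continuous sPsi).
    have c2 := cline _ (smooth_continuous (smooth_partial ord_max sPsi)).
    have cg' : continuous g'.
      have cfx : continuous (cst (f x) : R -> R) by exact: cst_continuous.
      move=> t; apply: (cvgM (cfx t)).
      exact: (cvgD (cvgM (ceta t) (c2 t)) (cvgM (c1 t) (ceta' t))).
    have [_ [L [cL LAJ Psi0]]] := (test_funP _ _).1 tPsi.
    have Psi'0 := @vanish_partial R n.+1 L Psi ord_max (compact_closed_rV cL) Psi0.
    have [M _ LM] := compact_sub_cube cL.
    rewrite -[RHS](@integral_derive_cptsupp _ g g' M dg cg'); last first.
      move=> t Mt; rewrite /g Psi0 ?mulr0// => /LM/(_ ord_max).
      by rewrite last_rV_rcons leNgt Mt.
    rewrite integral_mkcond; apply: eq_integral => t _; rewrite patchE.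
    case: ifPn => tJ.
      rewrite /= -EFinD /tensor col'_rV_rcons last_rV_rcons /g'; congr EFin; ring.
    rewrite /g' Psi0 ?Psi'0 ?mulr0 ?mul0r ?addr0 ?mulr0// => /LAJ;
      rewrite cylinder_rV_rcons => -[_]; move: tJ; rewrite notin_setE; exact.
  have f1 := integrable_fin_num mC i1.
  have f2 := integrable_fin_num mC i2.
  move: sum0; rewrite -(fineK f1) -(fineK f2) -EFinD => -[/eqP].
  by rewrite addr_eq0 => /eqP ->.
Qed.

End tensor_weak_gradient.

(** * Energies, and stability under limits of test functions *)

Section integral_comparison.
Context d (T : measurableType d) {R : realType}.
Variable nu : {measure set T -> \bar R}.

Lemma le_integral_scale (U : set T) (f g : T -> R) (c : R) : measurable U ->
  measurable_fun U f -> measurable_fun U g -> 0 <= c ->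
  (forall x, U x -> 0 <= f x) -> (forall x, U x -> 0 <= g x) ->
  (forall x, U x -> f x <= c * g x) ->
  (\int[nu]_(x in U) (f x)%:E <= c%:E * \int[nu]_(x in U) (g x)%:E)%E.
Proof.
move=> mU mf mg c0 f0 g0 fg.
have mg' : measurable_fun U (fun x => (g x)%:E) by exact/measurable_EFinP.
rewrite -ge0_integralZl_EFin//; apply: ge0_le_integral => //.
- exact/measurable_EFinP.
- exact: measurable_funeM.
Qed.

Lemma ge0_integral_ae_slices_lty (U : set T) (f : T -> \bar R) : measurable U ->
  measurable_fun U f -> (forall x, U x -> (0 <= f x)%E) ->
  (\int[nu]_(x in U) f x < +oo)%E ->
  {ae nu, forall x, U x -> (f x < +oo)%E}.
Proof.
move=> mU mf f0 fi.
have : nu.-integrable U f.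
  apply/integrableP; split => //; apply: le_lt_trans fi.
  rewrite le_eqVlt; apply/orP; left; apply/eqP/eq_integral => x /set_mem Ux.
  by rewrite gee0_abs// f0.
move=> /(integrable_ae mU); apply: filterS => x xf Ux.
by have /fin_numPlt/andP[] := xf Ux.
Qed.

End integral_comparison.

Section power_inequalities.
Context {R : realType}.
Implicit Types (p a b x y : R).

Lemma le_addgt0 (x y k : R) : 0 <= k ->
  (forall e, 0 < e -> x <= y + k * e) -> x <= y.
Proof.
move=> k0 H; apply/ler_addgt0Pr => e e0.
have k1 : 0 < k + 1 by rewrite ltr_wpDl.
apply: (le_trans (H (e / (k + 1)) _)); first by rewrite divr_gt0.
rewrite lerD2l mulrCA ler_piMr//; first exact: ltW.
by rewrite ler_pdivrMr// mul1r lerDl.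
Qed.

Lemma powRD_le p a b : 0 <= p -> 0 <= a -> 0 <= b ->
  (a + b) `^ p <= 2 `^ p * (a `^ p + b `^ p).
Proof.
move=> p0; wlog ab : a b / a <= b => [H a0 b0|a0 b0].
  have [ab|/ltW ba] := leP a b; first exact: H.
  by rewrite addrC [a `^ p + _]addrC; exact: H.
apply: (@le_trans _ _ ((2 * b) `^ p)).
  apply: ge0_ler_powR => //; rewrite ?nnegrE ?addr_ge0 ?mulr_ge0//.
  by rewrite mulr_natl mulr2n lerD2r.
by rewrite powRM// ler_wpM2l ?powR_ge0// lerDr powR_ge0.
Qed.

Lemma normB_powR_le p a b : 0 <= p ->
  `|a - b| `^ p <= 2 `^ p * (`|a| `^ p + `|b| `^ p).
Proof.
move=> p0; apply: le_trans (powRD_le p0 _ _) => //.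
by apply: ge0_ler_powR; rewrite ?nnegrE ?addr_ge0//; exact: ler_normB.
Qed.

Lemma normD_powR_le p a b : 0 <= p ->
  `|a + b| `^ p <= 2 `^ p * (`|a| `^ p + `|b| `^ p).
Proof.
by move=> p0; have := normB_powR_le a (- b) p0; rewrite opprK normrN.
Qed.

Lemma sum_powR_le p n : 0 < p -> exists2 C, 0 <= C &
  forall x : 'I_n -> R, (forall i, 0 <= x i) ->
    (\sum_i x i) `^ p <= C * \sum_i x i `^ p.
Proof.
move=> p0; elim: n => [|n [C C0 IH]].
  exists 0 => // x _; rewrite !big_ord0 mul0r powR0 ?gt_eqF//.
exists (2 `^ p * (C + 1)); first by rewrite mulr_ge0 ?powR_ge0 ?addr_ge0.
move=> x x0; rewrite !big_ord_recr/=.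
apply: le_trans (powRD_le (ltW p0) (sumr_ge0 _ _) (x0 _)) _ => //.
rewrite -mulrA ler_wpM2l ?powR_ge0//.
have s0 : 0 <= \sum_(i < n) x (widen_ord (leqnSn n) i) `^ p.
  by apply: sumr_ge0 => i _; exact: powR_ge0.
rewrite mulrDr lerD//.
  by apply: (le_trans (IH _ _)) => //; rewrite ler_wpM2r// lerDl.
by rewrite ler_peMl ?powR_ge0// lerDr.
Qed.

(** Either [|a| <= e], or [|a| / e] is at least [1] and so at most its [p]-th
    power.  On sets of finite measure this bounds integrals by [p]-norms,
    with an error that is small in [e]. *)
Lemma norm_le_powR p a e : 1 <= p -> 0 < e ->
  `|a| <= e + e * e^-1 `^ p * `|a| `^ p.
Proof.
move=> p1 e0; have [ae|ea] := leP `|a| e.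
  by apply: le_trans ae _; rewrite lerDl !mulr_ge0 ?powR_ge0// ltW.
have e0' : 0 <= e^-1 by rewrite invr_ge0 ltW.
rewrite -mulrA -powRM//.
have ae1 : 1 <= e^-1 * `|a| by rewrite mulrC ler_pdivlMr// mul1r ltW.
apply: (@le_trans _ _ (e * (e^-1 * `|a|))); first by rewrite mulVKf// gt_eqF.
apply: ler_wpDl; first exact: ltW.
apply: ler_wpM2l; first exact: ltW.
have := ler_powR ae1 p1.
by rewrite powRr1// (le_trans ler01 ae1).
Qed.

End power_inequalities.

Section euclidean_norm.
Context {R : realType} (n : nat).
Implicit Types (v w : 'rV[R]_n) (U : set 'rV[R]_n) (G : 'rV[R]_n -> 'rV[R]_n).
Local Notation mu := (@lebesgue_rV R n).

Lemma enorm_ge0 v : 0 <= enorm v.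
Proof. exact: sqrtr_ge0. Qed.

Lemma coord_le_enorm v i : `|v ord0 i| <= enorm v.
Proof.
rewrite -sqrtr_sqr /enorm ler_wsqrtr// (bigD1 i)//= lerDl.
by apply: sumr_ge0 => j _; exact: sqr_ge0.
Qed.

Lemma enorm_le_sum v : enorm v <= \sum_i `|v ord0 i|.
Proof.
have s0 : 0 <= \sum_i `|v ord0 i| by apply: sumr_ge0.
rewrite -[leRHS](ger0_norm s0) -sqrtr_sqr /enorm ler_wsqrtr//.
rewrite expr2 mulr_suml; apply: ler_sum => i _.
rewrite -real_normK ?num_real// expr2 ler_wpM2l// (bigD1 i)//= lerDl.
by apply: sumr_ge0.
Qed.

Lemma coord_powR_le p v i : 0 <= p -> `|v ord0 i| `^ p <= enorm v `^ p.
Proof.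
by move=> p0; apply: ge0_ler_powR; rewrite ?nnegrE ?enorm_ge0//; exact: coord_le_enorm.
Qed.

Lemma enorm_powR_le p : 0 < p -> exists2 C, 0 <= C &
  forall v, enorm v `^ p <= C * \sum_i `|v ord0 i| `^ p.
Proof.
move=> p0; have [C C0 HC] := @sum_powR_le R p n p0; exists C => // v.
apply: le_trans (HC (fun i => `|v ord0 i|) _) => //.
apply: ge0_ler_powR; rewrite ?nnegrE ?enorm_ge0//; last exact: enorm_le_sum.
  exact: ltW.
by apply: sumr_ge0.
Qed.

Lemma measurable_norm_powR U (f : 'rV[R]_n -> R) p : measurable_fun U f ->
  measurable_fun U (fun x => `|f x| `^ p).
Proof.
move=> mf; apply: (measurableT_comp (measurable_powR p)).
exact: measurableT_comp.
Qed.

Lemma measurable_enorm_powR U G p : (forall i, measurable_fun U (fun x => G x ord0 i)) ->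
  measurable_fun U (fun x => enorm (G x) `^ p).
Proof.
move=> mG; apply: (measurableT_comp (measurable_powR p)).
apply: (measurableT_comp (continuous_measurable_fun (@sqrt_continuous R))).
by apply: measurable_sum => i; apply: measurable_funX.
Qed.

Lemma Lp_energy U p G : 0 < p -> measurable U ->
  (forall i, Lp U p (fun x => G x ord0 i)) -> (energy p U G < +oo)%E.
Proof.
move=> p0 mU LG; have [C C0 HC] := enorm_powR_le p0.
have mG i : measurable_fun U (fun x => `|G x ord0 i| `^ p).
  by apply: measurable_norm_powR; case: (LG i).
have le : (energy p U G <= C%:E * \int[mu]_(x in U) (\sum_i `|G x ord0 i| `^ p)%:E)%E.
  apply: le_integral_scale => //.
  - by apply: measurable_enorm_powR => i; case: (LG i).
  - exact: measurable_sum.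
  - by move=> x _; exact: powR_ge0.
  - by move=> x _; apply: sumr_ge0 => i _; exact: powR_ge0.
apply: (le_lt_trans le).
rewrite lte_mul_pinfty//.
under eq_integral do rewrite -sumEFin.
rewrite ge0_integral_sum//; last by move=> i; exact/measurable_EFinP.
by apply: lte_sum_pinfty => i _; case: (LG i).
Qed.

Lemma energy_Lp U p G : 0 <= p -> measurable U ->
  (forall i, measurable_fun U (fun x => G x ord0 i)) ->
  (energy p U G < +oo)%E -> forall i, Lp U p (fun x => G x ord0 i).
Proof.
move=> p0 mU mG Gfin i; split; first exact: mG.
apply: le_lt_trans Gfin.
apply: ge0_le_integral => //.
- by apply/measurable_EFinP; exact: measurable_norm_powR.
- by apply/measurable_EFinP; exact: measurable_enorm_powR.
- by move=> x _; rewrite lee_fin coord_powR_le.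
Qed.

Lemma Lp_loc_integrable U p (f : 'rV[R]_n -> R) : 1 <= p -> measurable U ->
  Lp U p f -> loc_integrable U f.
Proof.
move=> p1 mU [mf fi] K cK KU; have mK := compact_measurable_rV cK.
have mfK : measurable_fun K f by exact: measurable_funS mf.
apply/integrableP; split; first exact/measurable_EFinP.
have mfp := measurable_norm_powR p mfK.
apply: (@le_lt_trans _ _ (\int[mu]_(x in K) (1%:E + (`|f x| `^ p)%:E))%E).
  apply: ge0_le_integral => //.
  - by apply: measurableT_comp => //; exact/measurable_EFinP.
  - by apply: emeasurable_funD => //; exact/measurable_EFinP.
  - move=> x _; have := norm_le_powR (f x) p1 ltr01.
    by rewrite invr1 powR1 !mul1r -EFinD lee_fin.
rewrite ge0_integralD//; last first.
- exact/measurable_EFinP.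
rewrite lte_add_pinfty//.
  by rewrite integral_cst// mul1e lebesgue_rV_compact.
apply: le_lt_trans fi; apply: ge0_subset_integral => //.
  by apply/measurable_EFinP; exact: measurable_norm_powR.
Qed.

End euclidean_norm.

Lemma enorm_col'_le {R : realType} n (v : 'rV[R]_n.+1) :
  enorm (col' ord_max v) <= enorm v.
Proof.
rewrite /enorm ler_wsqrtr// [leRHS]big_ord_recr/=.
apply: ler_wpDr; first exact: sqr_ge0.
by apply: ler_sum => j _; rewrite mxE widen_ord_lift.
Qed.

Section closedness.
Context {R : realType} (n : nat).
Implicit Types (U : set 'rV[R]_n) (f phi psi : 'rV[R]_n -> R) (H : 'rV[R]_n -> 'rV[R]_n).
Local Notation mu := (@lebesgue_rV R n).

(** The [p]-th power of the Sobolev distance from [f] to a smooth [phi], with a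
    given field [H] in the role of the gradient of [f]: here [H] need not be known
    to be a weak gradient. *)
Definition W1p_dist U p f H phi : \bar R :=
  (\int[mu]_(x in U) (`|f x - phi x| `^ p + enorm (H x - grad phi x) `^ p)%:E)%E.

Lemma measurable_W1p_dist U p f H phi : open U -> smooth phi ->
  measurable_fun U f -> (forall i, measurable_fun U (fun x => H x ord0 i)) ->
  measurable_fun U (fun x => `|f x - phi x| `^ p) /\
  measurable_fun U (fun x => enorm (H x - grad phi x) `^ p).
Proof.
move=> oU sphi mf mH; split.
  apply: measurable_norm_powR; apply: measurable_funB => //.
  by apply: measurable_funTS; apply: continuous_measurable_rV; exact: smooth_continuous.
apply: measurable_enorm_powR => i; under eq_fun do rewrite !mxE.
apply: measurable_funB => //.
apply: measurable_funTS; apply: continuous_measurable_rV.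
by apply: smooth_continuous; exact: smooth_partial.
Qed.

(** Integration by parts is exact for the approximating test functions, so the
    defect for [f] and [H] is at most the integral over the support of [psi] of
    [|f - phi| + |H - grad phi|], up to a constant.  By [norm_le_powR] this is
    [O(de) + O_de(e)]: let [e] tend to [0] first and then [de]. *)
Lemma weak_gradient_closed U p f H : 1 <= p -> open U -> Lp U p f ->
  (forall i, Lp U p (fun x => H x ord0 i)) ->
  (forall e : R, 0 < e -> exists2 phi, test_fun U phi & (W1p_dist U p f H phi < e%:E)%E) ->
  is_weak_gradient U f H.
Proof.
move=> p1 oU Lf LH approx; have mU := open_measurable_rV oU.
have lf := Lp_loc_integrable p1 mU Lf.
split=> // i; have lH := Lp_loc_integrable p1 mU (LH i).
split=> // psi tpsi; have tdpsi := test_fun_partial i tpsi.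
have i1 := loc_integrable_test mU lf tdpsi.
have i2 := loc_integrable_test mU lH tpsi.
have f1 := integrable_fin_num mU i1; have f2 := integrable_fin_num mU i2.
set A := (\int[mu]_(x in U) (f x * partial i psi x)%:E)%E in f1 *.
set B := (\int[mu]_(x in U) (H x ord0 i * psi x)%:E)%E in f2 *.
suff : `|fine A + fine B| <= 0.
  rewrite normr_le0 addr_eq0 => /eqP AB.
  by rewrite -(fineK f1) -(fineK f2) AB.
have [_ [K [cK KU psi0]]] := (test_funP _ _).1 tpsi.
have dpsi0 := @vanish_partial R n K psi i (compact_closed_rV cK) psi0.
have mK := compact_measurable_rV cK.
have cpsi := test_fun_continuous tpsi; have cdpsi := test_fun_continuous tdpsi.
have [M M0 HM] : exists2 M, 0 <= M & forall x, `|psi x| <= M /\ `|partial i psi x| <= M.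
  have [M1 [_ HM1]] := continuous_bounded_on cpsi cK.
  have [M2 [_ HM2]] := continuous_bounded_on cdpsi cK.
  exists (`|M1| + `|M2| + 1); first by rewrite !addr_ge0.
  move=> x; have [Kx|nKx] := pselect (K x); last first.
    by rewrite psi0// dpsi0// normr0 !addr_ge0.
  split; [apply: HM1 => //|apply: HM2 => //].
    by rewrite (le_lt_trans (ler_norm _))// -addrA ltr_pwDr// ltr_wpDl.
  rewrite (le_lt_trans (ler_norm _))// addrAC ltrDr ltr_wpDl//.
set ka := fine (mu K).
have ka0 : 0 <= ka by rewrite fine_ge0.
have muK : mu K = ka%:E by rewrite fineK// ge0_fin_numE// lebesgue_rV_compact.
have main de e : 0 < de -> 0 < e ->
    `|fine A + fine B| <= M * (2 * de * ka) + M * (de * de^-1 `^ p) * e.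
  move=> de0 e0; have [phi tphi phie] := approx e e0.
  have sphi : smooth phi by case: tphi.
  have [_ /(_ i)[lG Gphi]] := weak_gradient_smooth oU sphi.
  have lphi : loc_integrable U phi by apply: continuous_loc_integrable; exact: (smooth_continuous sphi).
  have i3 := loc_integrable_test mU lphi tdpsi.
  have i4 := loc_integrable_test mU lG tpsi.
  have il1 := loc_integrable_lin (-1) lf lphi.
  have il2 := loc_integrable_lin (-1) lH lG.
  pose F x := (f x + -1 * phi x) * partial i psi x +
              (H x ord0 i + -1 * grad phi x ord0 i) * psi x.
  have iF1 := loc_integrable_test mU il1 tdpsi.
  have iF2 := loc_integrable_test mU il2 tpsi.
  have iF : mu.-integrable U (EFin \o F) by exact: (integrableD mU iF1 iF2).
  have EF : (A + B = \int[mu]_(x in U) (F x)%:E)%E.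
    rewrite (_ : (\int[mu]_(x in U) (F x)%:E)%E = (\int[mu]_(x in U)
      (((f x + -1 * phi x) * partial i psi x)%:E +
       ((H x ord0 i + -1 * grad phi x ord0 i) * psi x)%:E))%E)//.
    rewrite integralD// !integral_lin// Gphi// -/A -/B.
    have := integrable_fin_num mU i4; move: A B f1 f2 => [a| |] // [b| |] // _ _.
    move: (integral _ _ _) => [q| |] // _.
    by rewrite -!EFinN -!EFinM -!EFinD; congr EFin; ring.
  rewrite -lee_fin -[X in (X <= _)%E]abse_EFin EFinD !fineK// EF.
  apply: le_trans (le_abse_integral mu mU (measurable_int _ iF)) _.
  have F0 x : ~ K x -> `|(F x)%:E|%E = 0%E.
    by move=> nK; rewrite /F psi0// dpsi0// !mulr0 addr0 abse0.
  rewrite (integral_supp KU F0).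
  pose g x := `|f x - phi x| `^ p + enorm (H x - grad phi x) `^ p.
  have [mg1 mg2] := measurable_W1p_dist p oU sphi Lf.1 (fun i => (LH i).1).
  have mg : measurable_fun U g by exact: measurable_funD.
  have mgK : measurable_fun K (fun x => (g x)%:E).
    by apply/measurable_EFinP; exact: measurable_funS mg.
  have g0 x : 0 <= g x by rewrite addr_ge0// powR_ge0.
  pose c := de * de^-1 `^ p.
  have c0 : 0 <= c by rewrite mulr_ge0 ?powR_ge0// ltW.
  have Fle x : `|F x| <= M * (2 * de) + M * c * g x.
    have [psiM dpsiM] := HM x.
    rewrite /F !mulN1r; apply: (le_trans (ler_normD _ _)); rewrite !normrM.
    have n1 := norm_le_powR (f x - phi x) p1 de0.
    have n2 := norm_le_powR (H x ord0 i - grad phi x ord0 i) p1 de0.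
    have n3 : `|H x ord0 i - grad phi x ord0 i| `^ p <= enorm (H x - grad phi x) `^ p.
      have := @coord_powR_le R n p (H x - grad phi x) i (le_trans ler01 p1).
      by rewrite !mxE.
    apply: (@le_trans _ _ ((de + c * `|f x - phi x| `^ p) * M +
              (de + c * enorm (H x - grad phi x) `^ p) * M)).
      apply: lerD; apply: ler_pM => //; apply: (le_trans n2).
      by rewrite lerD2l ler_wpM2l.
    by rewrite /g; lra.
  apply: (@le_trans _ _ (\int[mu]_(x in K) ((M * (2 * de))%:E + (M * c)%:E * (g x)%:E))%E).
    apply: ge0_le_integral => //.
    - apply: measurableT_comp => //; apply: measurable_funS (measurable_int _ iF) => //.
    - by apply: emeasurable_funD => //; exact: measurable_funeM.
    - by move=> x _; rewrite -EFinM -EFinD lee_fin.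
  rewrite ge0_integralD//; last first.
  - exact: measurable_funeM.
  - move=> x _; rewrite -EFinM lee_fin.
    exact: mulr_ge0 (mulr_ge0 M0 c0) (g0 x).
  - by move=> x _; rewrite lee_fin !mulr_ge0// ltW.
  rewrite integral_cst// muK -EFinM ge0_integralZl_EFin//; last 2 first.
  - by move=> x _; rewrite lee_fin.
  - by rewrite mulr_ge0.
  have -> : M * (2 * de * ka) = M * (2 * de) * ka by rewrite !mulrA.
  rewrite EFinD; apply: leeD => //; rewrite -/c [X in (_ <= X)%E]EFinM.
  apply: lee_wpmul2l; first by rewrite lee_fin mulr_ge0.
  apply: le_trans (ltW phie); apply: ge0_subset_integral => //.
  - exact/measurable_EFinP.
  - by move=> x _; rewrite lee_fin.
have step1 de : 0 < de -> `|fine A + fine B| <= M * (2 * de * ka).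
  move=> de0; apply: (@le_addgt0 _ _ _ (M * (de * de^-1 `^ p))).
    by rewrite !mulr_ge0 ?powR_ge0// ltW.
  by move=> e e0; exact: main.
apply: (@le_addgt0 _ _ _ (M * (2 * ka))); first by rewrite !mulr_ge0.
by move=> e e0; rewrite add0r; apply: le_trans (step1 _ e0) _; lra.
Qed.

End closedness.

(** * Membership in [W^{1,p}_0] and its slices *)

Section W1p_0_characterisation.
Context {R : realType}.

Lemma poweR_lt (r : R) (x y : \bar R) : 0 < r -> (0 <= x)%E -> (0 <= y)%E ->
  (x < y)%E -> (x `^ r < y `^ r)%E.
Proof.
move=> r0 x0 y0; rewrite !ltNge; apply: contra => xy.
have inv z : (0 <= z)%E -> ((z `^ r) `^ r^-1 = z)%E.
  by move=> z0; rewrite -poweRrM divff ?gt_eqF// poweRe1.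
rewrite -(inv _ x0) -(inv _ y0); apply: gt0_ler_poweR => //.
- by rewrite invr_ge0 ltW.
- by rewrite in_itv/= poweR_ge0 leey.
- by rewrite in_itv/= poweR_ge0 leey.
Qed.

Context (n : nat).
Implicit Types (U : set 'rV[R]_n) (f phi psi : 'rV[R]_n -> R) (H : 'rV[R]_n -> 'rV[R]_n).
Local Notation mu := (@lebesgue_rV R n).

Lemma W1p_dist_ge0 U p f H phi : (0 <= W1p_dist U p f H phi)%E.
Proof. by apply: integral_ge0 => x _; rewrite lee_fin addr_ge0// powR_ge0. Qed.

Lemma W1p_dist_wgrad U p f H phi : open U -> smooth phi ->
  measurable_fun U f -> is_weak_gradient U f H ->
  (\int[mu]_(x in U) (`|(f \- phi) x| `^ p + enorm (wgrad U (f \- phi) x) `^ p)%:E)%E =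
  W1p_dist U p f H phi.
Proof.
move=> oU sphi mf fH; have mU := open_measurable_rV oU.
have wg := weak_gradientB oU fH (weak_gradient_smooth oU sphi).
have wg' := wgradP (ex_intro _ _ wg).
have mH i := weak_gradient_measurable i oU fH.
have [m1 m2] := measurable_W1p_dist p oU sphi mf mH.
have p_ge0 (a b : R) : (0 <= (a `^ p + b `^ p)%:E)%E by rewrite lee_fin addr_ge0// powR_ge0.
apply: ge0_ae_eq_integral; first exact: mU.
- apply/measurable_EFinP; apply: (measurable_funD m1).
  by apply: measurable_enorm_powR => i; exact: weak_gradient_measurable oU wg'.
- by apply/measurable_EFinP; exact: measurable_funD.
- by move=> x _; exact: p_ge0.
- by move=> x _; exact: p_ge0.
- by apply: filterS (wgrad_ae oU wg) => x xE Ux; rewrite xE.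
Qed.

(** With [weak_gradient_closed] available, only the passage between [W1p_dist]
    and the norm remains, where uniqueness of weak gradients is used. *)
Lemma W1p_0_closed U p f H : 1 < p -> open U -> Lp U p f ->
  (forall i, Lp U p (fun x => H x ord0 i)) ->
  (forall e : R, 0 < e -> exists2 phi, test_fun U phi & (W1p_dist U p f H phi < e%:E)%E) ->
  is_weak_gradient U f H /\ W1p_0 U p f.
Proof.
move=> p1 oU Lf LH approx; have mU := open_measurable_rV oU.
have p0 : 0 < p by exact: lt_trans p1.
have fH := weak_gradient_closed (ltW p1) oU Lf LH approx.
have hw : has_weak_gradient U f by exists H.
have W : W1p U p f.
  split; [exact: Lf|exact: hw|move=> i].
  have mw := weak_gradient_measurable i oU (wgradP hw).
  have [mHi iHi] := LH i; split; first exact: mw.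
  apply: le_lt_trans iHi; rewrite le_eqVlt; apply/orP; left; apply/eqP.
  apply: ge0_ae_eq_integral; first exact: mU.
  - by apply/measurable_EFinP; exact: measurable_norm_powR mw.
  - by apply/measurable_EFinP; exact: measurable_norm_powR mHi.
  - by move=> x _; rewrite lee_fin powR_ge0.
  - by move=> x _; rewrite lee_fin powR_ge0.
  - by apply: filterS (wgrad_ae oU fH) => x xE Ux; rewrite xE.
split; first exact: fH.
split; first exact: W.
move=> e e0; have [phi tphi phie] := approx (e `^ p) (powR_gt0 _ e0).
exists phi => //; have sphi : smooth phi by case: tphi.
rewrite /W1p_norm (W1p_dist_wgrad p oU sphi Lf.1 fH).
have -> : e%:E = ((e `^ p)%:E `^ p^-1)%E.
  by rewrite poweR_EFin -powRrM divff ?gt_eqF// powRr1// ltW.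
by apply: poweR_lt => //; rewrite ?invr_gt0// ?W1p_dist_ge0// lee_fin powR_ge0.
Qed.

Lemma W1p_0_approx U p f : 1 < p -> open U -> W1p_0 U p f ->
  forall e : R, 0 < e ->
    exists2 phi, test_fun U phi & (W1p_dist U p f (wgrad U f) phi < e%:E)%E.
Proof.
move=> p1 oU [[Lf hf _] approx] e e0; have p0 : 0 < p by exact: lt_trans p1.
have [phi tphi phie] := approx (e `^ p^-1) (powR_gt0 _ e0); exists phi => //.
have sphi : smooth phi by case: tphi.
move: phie; rewrite /W1p_norm (W1p_dist_wgrad p oU sphi Lf.1 (wgradP hf)) => phie.
have D0 := W1p_dist_ge0 U p f (wgrad U f) phi.
have e1 : (0 <= (e `^ p^-1)%:E)%E by rewrite lee_fin powR_ge0.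
have := poweR_lt p0 (poweR_ge0 _ _) e1 phie.
rewrite -poweRrM mulVf ?gt_eqF// poweRe1// poweR_EFin -powRrM mulVf ?gt_eqF//.
by rewrite powRr1 // (ltW e0).
Qed.

End W1p_0_characterisation.

(** For these two instances the measure structure has to be found from the bare
    function [lebesgue_measure]. *)
#[global] Instance ae_lebesgue_filter (R : realType) :
  Filter (almost_everywhere (@lebesgue_measure R)).
Proof. exact: ae_filter_ringOfSetsType. Qed.

#[global] Instance ae_lebesgue_nbhs_filter (R : realType) :
  Filter (nbhs (almost_everywhere (@lebesgue_measure R))).
Proof. exact: ae_filter_ringOfSetsType. Qed.

Section slices_of_W1p_0.
Local Open Scope ereal_scope.
Context {R : realType} (n : nat).
Variables (A : set 'rV[R]_n) (J : set R) (p : R).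
Hypotheses (oA : open A) (oJ : open J) (p1 : (1 < p)%R).
Local Notation mu := (@lebesgue_rV R n).
Local Notation mu1 := (@lebesgue_rV R n.+1).
Local Notation leb := (@lebesgue_measure R).
Local Notation C := (cylinder A J).

Let mA : measurable A := open_measurable_rV oA.
Let mJ : measurable (J : set (measurableTypeR R)). Proof. exact: open_measurable. Qed.

Lemma measurable_slice (f : 'rV[R]_n.+1 -> R) t : measurable_fun C f -> J t ->
  measurable_fun A (slice f t).
Proof.
move=> mf Jt; apply: (@measurable_comp _ _ _ _ _ _ C f A (fun x => rV_rcons (x, t))) => //.
- exact: measurable_cylinder.
- by move=> _ [x Ax <-]; rewrite cylinder_rV_rcons.
- by apply: measurable_funTS; exact: measurable_rV_rcons1.
Qed.

Lemma slice_integral_lty (F : 'rV[R]_n.+1 -> R) : measurable_fun C F ->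
  (forall z, (0 <= F z)%R) -> \int[mu1]_(z in C) (F z)%:E < +oo ->
  {ae leb, forall t, J t -> \int[mu]_(x in A) (F (rV_rcons (x, t)))%:E < +oo}.
Proof.
move=> mF F0 iF.
have mF' : measurable_fun C (fun z => (F z)%:E) by exact/measurable_EFinP.
have [|E _ mG _] := tonelli_cylinder mA mJ mF'; first by move=> z _; rewrite lee_fin.
apply: ge0_integral_ae_slices_lty => //; last by rewrite -E.
by move=> t _; apply: integral_ge0 => x _; rewrite lee_fin.
Qed.

Lemma Lp_slice (f : 'rV[R]_n.+1 -> R) : Lp C p f ->
  {ae leb, forall t, J t -> Lp A p (slice f t)}.
Proof.
move=> [mf fi]; have mfp := measurable_norm_powR p mf.
have := slice_integral_lty mfp (fun z => powR_ge0 _ _) fi.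
by apply: filterS => t ft Jt; split; [exact: measurable_slice|exact: ft].
Qed.

Lemma W1p_dist_slice (f phi : 'rV[R]_n.+1 -> R) (H : 'rV[R]_n.+1 -> 'rV[R]_n.+1) t : smooth phi ->
  measurable_fun C f -> (forall i, measurable_fun C (fun z => H z ord0 i)) -> J t ->
  W1p_dist A p (slice f t) (fun x => col' ord_max (H (rV_rcons (x, t)))) (slice phi t) <=
  \int[mu]_(x in A) (`|f (rV_rcons (x, t)) - phi (rV_rcons (x, t))| `^ p +
     enorm (H (rV_rcons (x, t)) - grad phi (rV_rcons (x, t))) `^ p)%:E.
Proof.
move=> sphi mf mH Jt.
have [m1 m2] := measurable_W1p_dist p (open_cylinder oA oJ) sphi mf mH.
have mH' i : measurable_fun A (fun x => col' ord_max (H (rV_rcons (x, t))) ord0 i).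
  under eq_fun do rewrite mxE.
  exact: (measurable_slice (mH (lift ord_max i)) Jt).
have [m3 m4] := measurable_W1p_dist p oA (smooth_slice t sphi) (measurable_slice mf Jt) mH'.
apply: ge0_le_integral; first exact: mA.
- by move=> x _; rewrite lee_fin addr_ge0// powR_ge0.
- by apply/measurable_EFinP; exact: measurable_funD.
- apply/measurable_EFinP; apply: measurable_funD.
    exact: (measurable_slice m1 Jt).
  exact: (measurable_slice m2 Jt).
- move=> x _; rewrite lee_fin lerD2l.
  apply: ge0_ler_powR; rewrite ?nnegrE ?enorm_ge0//; first by rewrite (le_trans _ (ltW p1)).
  have -> : (col' ord_max (H (rV_rcons (x, t))) - grad (slice phi t) x =
      col' ord_max (H (rV_rcons (x, t)) - grad phi (rV_rcons (x, t))))%R.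
    by apply/rowP => j; rewrite !mxE (partial_slice _ _ sphi).
  exact: enorm_col'_le.
Qed.

(** Let [g k t] be the distance between the slices at height [t] of [phi] and of
    an approximating sequence of test functions.  Its integrals over [t] tend to
    [0], so the infimum of [g k t] over [k] vanishes for almost every [t]; there
    the slice of [phi] is a limit of test functions and [W1p_0_closed] applies.
    Working with the infimum makes it unnecessary to extract a subsequence. *)
Lemma W1p_0_slice phi : W1p_0 C p phi ->
  {ae leb, forall t, J t ->
    is_weak_gradient A (slice phi t)
      (fun x => col' ord_max (wgrad C phi (rV_rcons (x, t)))) /\
    W1p_0 A p (slice phi t)}.
Proof.
move=> W0; have oC := open_cylinder oA oJ; have mC := measurable_cylinder mA mJ.
have [[Lphi hphi LH] _] := W0; pose H := wgrad C phi.
have mphi := Lphi.1; have mH i : measurable_fun C (fun z => H z ord0 i) by case: (LH i).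
have p0 : (0 <= p)%R by rewrite (le_trans _ (ltW p1)).
have /choice[phi_ phi_P] : forall k : nat, exists psi, test_fun C psi /\
    W1p_dist C p phi H psi < (k.+1%:R^-1)%:E.
  move=> k; have k0 : (0 < k.+1%:R^-1 :> R)%R by rewrite invr_gt0.
  by have [psi ? ?] := W1p_0_approx p1 oC W0 k0; exists psi.
have sphi k : smooth (phi_ k) by case: (phi_P k) => -[].
pose F k z := (`|phi z - phi_ k z| `^ p + enorm (H z - grad (phi_ k) z) `^ p)%R.
have mF k : measurable_fun C (fun z => (F k z)%:E).
  have [m1 m2] := measurable_W1p_dist p oC (sphi k) mphi mH.
  by apply/measurable_EFinP; exact: measurable_funD.
have F0 k z : 0 <= (F k z)%:E by rewrite lee_fin addr_ge0// powR_ge0.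
pose g k t : \bar R := \int[mu]_(x in A) (F k (rV_rcons (x, t)))%:E.
have g0 k t : 0 <= g k t by apply: integral_ge0.
have mg k : measurable_fun J (g k).
  by have [//|_ _ + _] := tonelli_cylinder mA mJ (mF k).
have ig k : \int[leb]_(t in J) g k t < (k.+1%:R^-1)%:E.
  have [//|<- _ _ _] := tonelli_cylinder mA mJ (mF k).
  by case: (phi_P k).
pose m t := einfs (g ^~ t) 0%N.
have mm : measurable_fun J m by exact: measurable_fun_einfs.
have m0 t : 0 <= m t.
  by rewrite leNgt; apply/negP => /ereal_inf_lt[_ [k _ <-]]; rewrite ltNge g0.
have mg_le k t : m t <= g k t by apply: ereal_inf_lbound; exists k.
have im : \int[leb]_(t in J) m t = 0.
  apply/eqP; rewrite eq_le integral_ge0// andbT; apply/lee_addgt0Pr => e e0.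
  rewrite add0e; have [k _ /(_ k (leqnn k)) ke] := near_infty_natSinv_lt (PosNum e0).
  apply: (@le_trans _ _ (\int[leb]_(t in J) g k t)).
    exact: (ge0_le_integral leb mJ (fun t _ => m0 t) mm (mg k) (fun t _ => mg_le k t)).
  by apply: le_trans (ltW (ig k)) _; rewrite lee_fin ltW.
have am : {ae leb, forall t, J t -> m t = 0}.
  have [+ _] := ae_eq_integral_abs leb mJ mm; apply.
  by rewrite -[RHS]im; apply: eq_integral => t _; rewrite gee0_abs.
have aphi := Lp_slice Lphi.
have aH : {ae leb, forall t i, J t -> Lp A p (slice (fun z => H z ord0 i) t)}.
  by apply: filter_forall => i; exact: Lp_slice (LH i).
apply: filterS3 am aphi aH => t mt0 Lt LHt Jt.
apply: W1p_0_closed => //; first exact: Lt.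
  move=> i; have := LHt (lift ord_max i) Jt.
  by congr Lp; apply/funext => x; rewrite mxE.
move=> e e0; have : m t < e%:E by rewrite mt0.
move=> /ereal_inf_lt[_ [k _ <-]] gke.
have [tk _] := phi_P k.
exists (slice (phi_ k) t); first exact: test_fun_slice tk.
exact: le_lt_trans (W1p_dist_slice (sphi k) mphi mH Jt) gke.
Qed.

End slices_of_W1p_0.

(** * Products [phi(x) eta(t)] in [W^{1,p}_0] of the cylinder *)

Section pointwise_gradient_bounds.
Context {R : realType}.

Lemma enormD_powR_le n (p : R) : 0 < p -> exists2 C, 0 <= C &
  forall v w : 'rV[R]_n, enorm (v + w) `^ p <= C * (enorm v `^ p + enorm w `^ p).
Proof.
move=> p0; have [C C0 HC] := @enorm_powR_le R n p p0.
exists (C * (2 `^ p * n%:R)); first by rewrite !mulr_ge0 ?powR_ge0.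
move=> v w; apply: (le_trans (HC _)); rewrite -!mulrA ler_wpM2l//.
apply: (@le_trans _ _ (\sum_(i < n) 2 `^ p * (enorm v `^ p + enorm w `^ p))).
  apply: ler_sum => i _; rewrite !mxE.
  apply: (le_trans (normD_powR_le _ _ (ltW p0))); rewrite ler_wpM2l ?powR_ge0//.
  by apply: lerD; apply: coord_powR_le; exact: ltW.
by rewrite sumr_const card_ord -[leLHS]mulr_natl mulrCA.
Qed.

Lemma tensor_grad_powR_le n (p M : R) : 0 < p -> 0 <= M -> exists2 C, 0 <= C &
  forall f G eta eta' (z : 'rV[R]_n.+1), `|eta (z ord0 ord_max)| <= M ->
    `|eta' (z ord0 ord_max)| <= M ->
    enorm (tensor_grad f G eta eta' z) `^ p <=
    C * (`|f (col' ord_max z)| `^ p + enorm (G (col' ord_max z)) `^ p).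
Proof.
move=> p0 M0; have [C C0 HC] := @enorm_powR_le R n.+1 p p0.
exists (C * (n.+1%:R * M `^ p)); first by rewrite !mulr_ge0 ?powR_ge0.
move=> f G eta eta' z etaM etaM'; apply: (le_trans (HC _)).
rewrite -!mulrA ler_wpM2l//.
set B := _ + _; apply: (@le_trans _ _ (\sum_(i < n.+1) M `^ p * B)); last first.
  by rewrite sumr_const card_ord -[leLHS]mulr_natl.
have mul (a b : R) : `|a| <= M -> `|a * b| `^ p <= M `^ p * `|b| `^ p.
  move=> aM; rewrite normrM powRM// ler_wpM2r ?powR_ge0//.
  by apply: ge0_ler_powR; rewrite ?nnegrE//; exact: ltW.
apply: ler_sum => i _; case: (unliftP ord_max i) => [j ->|->].
  rewrite lift_rV_rcons mxE; apply: (le_trans (mul _ _ etaM)).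
  rewrite ler_wpM2l ?powR_ge0//; apply: ler_wpDl; first exact: powR_ge0.
  by apply: coord_powR_le; exact: ltW.
rewrite last_rV_rcons /tensor mulrC; apply: (le_trans (mul _ _ etaM')).
by rewrite ler_wpM2l ?powR_ge0//; apply: ler_wpDr; first exact: powR_ge0.
Qed.

Lemma enorm_tensor_grad1 n (f : 'rV[R]_n -> R) G eta eta' (z : 'rV[R]_n.+1) :
  eta (z ord0 ord_max) = 1 -> eta' (z ord0 ord_max) = 0 ->
  enorm (tensor_grad f G eta eta' z) = enorm (G (col' ord_max z)).
Proof.
move=> e1 e0; rewrite /enorm big_ord_recr/= last_rV_rcons /tensor e0 mulr0.
rewrite expr0n addr0; congr Num.sqrt; apply: eq_bigr => j _; rewrite widen_ord_lift.
by rewrite lift_rV_rcons e1 scale1r.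
Qed.

Lemma tensor_gradD n (f g : 'rV[R]_n -> R) G H eta eta' (z : 'rV[R]_n.+1) :
  tensor_grad f G eta eta' z + tensor_grad g H eta eta' z =
  tensor_grad (f \+ g) (fun x => G x + H x) eta eta' z.
Proof.
apply/rowP => i; rewrite !mxE; case: unliftP => [j _|_] /=.
  by rewrite !mxE mulrDr.
by rewrite /tensor mulrDl.
Qed.

Lemma tensor_gradB n (f g : 'rV[R]_n -> R) G H eta eta' (z : 'rV[R]_n.+1) :
  tensor_grad f G eta eta' z - tensor_grad g H eta eta' z =
  tensor_grad (f \- g) (fun x => G x - H x) eta eta' z.
Proof.
apply/rowP => i; rewrite !mxE; case: unliftP => [j _|_] /=.
  by rewrite !mxE mulrBr.
by rewrite /tensor mulrBl.
Qed.

Lemma grad_tensor n (f : 'rV[R]_n -> R) eta eta' : smooth f ->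
  (forall t : R, is_derive t 1 eta (eta' t)) ->
  grad (tensor f eta) = tensor_grad f (grad f) eta eta'.
Proof.
move=> sf deta; apply/funext => z; apply/rowP => i; rewrite mxE.
case: (unliftP ord_max i) => [j ->|->].
  by rewrite lift_rV_rcons partial_tensor_lift// !mxE mulrC.
by rewrite last_rV_rcons (partial_tensor_last f deta).
Qed.

End pointwise_gradient_bounds.

Section integrals_over_cylinders.
Context {R : realType} (n : nat).
Implicit Types (A : set 'rV[R]_n) (J : set R).
Local Notation mu := (@lebesgue_rV R n).
Local Notation mu1 := (@lebesgue_rV R n.+1).
Local Notation leb := (@lebesgue_measure R).

Lemma measurable_base A J (g : 'rV[R]_n -> R) : measurable A ->
  measurable (J : set (measurableTypeR R)) -> measurable_fun A g ->
  measurable_fun (cylinder A J) (fun z => g (col' ord_max z)).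
Proof.
move=> mA mJ mg; apply: (@measurable_comp _ _ _ _ _ _ A g _ (col' ord_max)) => //.
  by move=> _ [z [Az _] <-].
by apply: measurable_funTS; exact: measurable_col'.
Qed.

Lemma integral_cylinder_base A J (g : 'rV[R]_n -> R) : measurable A ->
  measurable (J : set (measurableTypeR R)) -> measurable_fun A g ->
  (forall x, 0 <= g x) ->
  (\int[mu1]_(z in cylinder A J) (g (col' ord_max z))%:E =
   leb J * \int[mu]_(x in A) (g x)%:E)%E.
Proof.
move=> mA mJ mg g0.
have mg' : measurable_fun (cylinder A J) (fun z => (g (col' ord_max z))%:E).
  by apply/measurable_EFinP; exact: measurable_base.
have [|_ -> _ _] := tonelli_cylinder mA mJ mg'; first by move=> z _; rewrite lee_fin.
have mgE : measurable_fun A (fun x => (g x)%:E) by exact/measurable_EFinP.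
rewrite -(@ge0_integralZl _ _ _ mu A mA _ mgE (leb J))//; last first.
  by move=> x _; rewrite lee_fin.
apply: eq_integral => x _; under eq_integral do rewrite col'_rV_rcons.
by rewrite integral_cst// muleC.
Qed.

Lemma le_integral_slab A J K (F : 'rV[R]_n.+1 -> R) (g : 'rV[R]_n -> R) (c : R) :
  measurable A -> measurable (J : set (measurableTypeR R)) ->
  measurable (K : set (measurableTypeR R)) -> K `<=` J ->
  measurable_fun (cylinder A J) F -> measurable_fun A g -> 0 <= c ->
  (forall z, 0 <= F z) -> (forall x, 0 <= g x) ->
  (forall z : 'rV[R]_n.+1, ~ K (z ord0 ord_max) -> F z = 0) ->
  (forall z, cylinder A K z -> F z <= c * g (col' ord_max z)) ->
  (\int[mu1]_(z in cylinder A J) (F z)%:E <=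
   c%:E * (leb K * \int[mu]_(x in A) (g x)%:E))%E.
Proof.
move=> mA mJ mK KJ mF mg c0 F0 g0 Fout Fle.
have AKJ : cylinder A K `<=` cylinder A J by move=> z [Az /KJ].
have mAK := measurable_cylinder mA mK; have mAJ := measurable_cylinder mA mJ.
have -> : (\int[mu1]_(z in cylinder A J) (F z)%:E = \int[mu1]_(z in cylinder A K) (F z)%:E)%E.
  rewrite integral_mkcond [RHS]integral_mkcond; apply: eq_integral => z _.
  rewrite !patchE; have [zK|zK] := boolP (z \in cylinder A K).
    by rewrite mem_set//; apply/AKJ/set_mem.
  case: ifPn => // /set_mem[Az Jz]; rewrite Fout// => Kz.
  by move: zK; rewrite notin_setE; apply.
rewrite -integral_cylinder_base//; apply: le_integral_scale => //.
- exact: measurable_funS mF.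
- exact: measurable_base.
Qed.

Lemma measurable_tensor_grad A J (f : 'rV[R]_n -> R) (G : 'rV[R]_n -> 'rV[R]_n)
    (eta eta' : R -> R) i : measurable A ->
  measurable (J : set (measurableTypeR R)) ->
  measurable_fun A f -> (forall j, measurable_fun A (fun x => G x ord0 j)) ->
  continuous eta -> continuous eta' ->
  measurable_fun (cylinder A J) (fun z => tensor_grad f G eta eta' z ord0 i).
Proof.
move=> mA mJ mf mG ceta ceta'.
have m1 : measurable_fun J eta by apply: measurable_funTS; exact: continuous_measurable_fun.
have m2 : measurable_fun J eta' by apply: measurable_funTS; exact: continuous_measurable_fun.
case: (unliftP ord_max i) => [j ->|->].
  rewrite (_ : (fun z => _) = tensor (fun x => G x ord0 j) eta).
    exact: measurable_tensor.
  by apply/funext => z; rewrite lift_rV_rcons mxE mulrC.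
rewrite (_ : (fun z => _) = tensor f eta'); first exact: measurable_tensor.
by apply/funext => z; rewrite last_rV_rcons.
Qed.

End integrals_over_cylinders.

Section tensor_in_W1p_0.
Context {R : realType} (n : nat).
Local Notation mu := (@lebesgue_rV R n).
Local Notation leb := (@lebesgue_measure R).

Lemma W1p_integral_lty (A : set 'rV[R]_n) p f : 0 < p -> measurable A ->
  W1p A p f ->
  (\int[mu]_(x in A) (`|f x| `^ p + enorm (wgrad A f x) `^ p)%:E < +oo)%E.
Proof.
move=> p0 mA [[mf fi] _ LG].
have mfp := measurable_norm_powR p mf.
have mG : measurable_fun A (fun x => enorm (wgrad A f x) `^ p).
  by apply: measurable_enorm_powR => i; case: (LG i).
have m1 : measurable_fun A (fun x => (`|f x| `^ p)%:E) by exact/measurable_EFinP.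
have m2 : measurable_fun A (fun x => (enorm (wgrad A f x) `^ p)%:E) by exact/measurable_EFinP.
have p_ge0 (a : R) : (0 <= (a `^ p)%:E)%E by rewrite lee_fin powR_ge0.
under eq_integral do rewrite EFinD.
rewrite (ge0_integralD mu mA (fun x _ => p_ge0 _) m1 (fun x _ => p_ge0 _) m2).
exact: lte_add_pinfty fi (Lp_energy p0 mA LG).
Qed.

(** If test functions [psi] approximate [phi], then [tensor psi eta] approximates
    [tensor phi eta]: the errors are products with the bounded functions [eta] and
    [eta'], which vanish off [[c, d]], so [le_integral_slab] controls them. *)
Lemma W1p_0_tensor (A : set 'rV[R]_n) (J : set R) p phi (eta eta' : R -> R) (c d M : R) :
  1 < p -> open A -> open J -> W1p_0 A p phi ->
  smooth1 eta -> (forall t : R, is_derive t 1 eta (eta' t)) -> continuous eta' ->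
  `[c, d] `<=` J -> (forall t, ~ `[c, d]%classic t -> eta t = 0 /\ eta' t = 0) ->
  (forall t, `|eta t| <= M /\ `|eta' t| <= M) ->
  is_weak_gradient (cylinder A J) (tensor phi eta)
    (tensor_grad phi (wgrad A phi) eta eta') /\
  W1p_0 (cylinder A J) p (tensor phi eta).
Proof.
move=> p1 oA oJ W0 seta deta ceta' cdJ eta_out etaM.
have p0 : 0 < p by exact: lt_trans p1.
have M0 : 0 <= M by apply: le_trans (etaM 0).1.
have mA := open_measurable_rV oA.
have mJ : measurable (J : set (measurableTypeR R)) by exact: open_measurable.
have mK : measurable (`[c, d]%classic : set (measurableTypeR R)) by exact: measurable_itv.
have ceta := smooth1_continuous seta.
have [W _] := W0; have [[mphi iphi] hphi LG] := W.
have mG i : measurable_fun A (fun x => wgrad A phi x ord0 i) by case: (LG i).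
have mJeta : measurable_fun J eta by apply: measurable_funTS; exact: continuous_measurable_fun.
have [C C0 HC] := @tensor_grad_powR_le R n p M p0 M0.
have mten := measurable_tensor mA mJ mphi mJeta.
have mtg i := measurable_tensor_grad i mA mJ mphi mG ceta ceta'.
have Iphi := W1p_integral_lty p0 mA W.
have lebK : (leb `[c, d] < +oo)%E.
  by rewrite lebesgue_measure_itv/=; case: ifP => _; rewrite ?ltry// -EFinB ltry.
have tensorM (f : 'rV[R]_n -> R) (z : 'rV[R]_n.+1) : `|tensor f eta z| `^ p <= M `^ p * `|f (col' ord_max z)| `^ p.
  rewrite /tensor normrM mulrC powRM// ler_wpM2r ?powR_ge0//.
  by apply: ge0_ler_powR; rewrite ?nnegrE ?(ltW p0)//; exact: (etaM _).1.
have tensor0 (f : 'rV[R]_n -> R) (z : 'rV[R]_n.+1) : ~ `[c, d]%classic (z ord0 ord_max) -> tensor f eta z = 0.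
  by move=> /eta_out[e0 _]; rewrite /tensor e0 mulr0.
have tg0 f G (z : 'rV[R]_n.+1) : ~ `[c, d]%classic (z ord0 ord_max) ->
    enorm (tensor_grad f G eta eta' z : 'rV[R]_n.+1) `^ p = 0.
  move=> /eta_out[e0 e0']; rewrite (_ : tensor_grad _ _ _ _ _ = 0).
    rewrite /enorm big1 ?sqrtr0 ?powR0 ?gt_eqF// => i _.
    by rewrite mxE expr0n.
  apply/rowP => i; rewrite !mxE; case: unliftP => [j _|_] /=.
    by rewrite e0 mxE mul0r.
  by rewrite /tensor e0' mulr0.
have lty_scale (k : R) (I : \bar R) : 0 <= k -> (0 <= I)%E -> (I < +oo)%E ->
    (k%:E * (leb `[c, d] * I) < +oo)%E.
  move=> k0 I0 Ifin; rewrite lte_mul_pinfty ?lee_fin// lte_mul_pinfty//.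
  by rewrite ge0_fin_numE.
apply: W1p_0_closed => //.
- exact: open_cylinder.
- split; first exact: mten.
  apply: (le_lt_trans (le_integral_slab (K := `[c, d]%classic) (c := M `^ p)
     (g := fun x => `|phi x| `^ p) mA mJ mK cdJ _ _ _ _ _ _ _)).
  + exact: measurable_norm_powR mten.
  + exact: measurable_norm_powR mphi.
  + exact: powR_ge0.
  + by move=> z; exact: powR_ge0.
  + by move=> x; exact: powR_ge0.
  + by move=> z nz; rewrite tensor0// normr0 powR0// gt_eqF.
  + by move=> z _; exact: tensorM.
  apply: lty_scale => //; first exact: powR_ge0.
  by apply: integral_ge0 => x _; rewrite lee_fin powR_ge0.
- apply: energy_Lp; first exact: ltW.
  + exact: measurable_cylinder.
  + exact: mtg.
  apply: (le_lt_trans (le_integral_slab (K := `[c, d]%classic) (c := C)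
     (g := fun x => `|phi x| `^ p + enorm (wgrad A phi x) `^ p) mA mJ mK cdJ _ _ C0 _ _ _ _)).
  + exact: measurable_enorm_powR mtg.
  + apply: measurable_funD; first exact: measurable_norm_powR mphi.
    exact: measurable_enorm_powR mG.
  + by move=> z; exact: powR_ge0.
  + by move=> x; rewrite addr_ge0// powR_ge0.
  + by move=> z nz; exact: tg0.
  + by move=> z _; apply: HC; [exact: (etaM _).1|exact: (etaM _).2].
  apply: lty_scale => //.
  by apply: integral_ge0 => x _; rewrite lee_fin addr_ge0// powR_ge0.
- move=> e e0; set k := M `^ p + C.
  have k0 : 0 <= k by rewrite addr_ge0 ?powR_ge0.
  set l := fine (leb `[c, d]).
  have l0 : 0 <= l by rewrite fine_ge0.
  have lE : leb `[c, d] = l%:E by rewrite fineK// ge0_fin_numE.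
  have e1 : 0 < e / (k * l + 1) by rewrite divr_gt0// ltr_wpDl// mulr_ge0.
  have [psi tpsi psie] := W1p_0_approx p1 oA W0 e1.
  have spsi : smooth psi by case: tpsi.
  exists (tensor psi eta).
    by apply: (test_fun_tensor tpsi seta cdJ) => t /eta_out[].
  have [m1 m2] := measurable_W1p_dist p oA spsi mphi mG.
  have [m3 m4] := measurable_W1p_dist p (open_cylinder oA oJ)
    (smooth_tensor spsi seta) mten mtg.
  have tB (z : 'rV[R]_n.+1) : tensor phi eta z - tensor psi eta z = tensor (phi \- psi) eta z.
    by rewrite /tensor mulrBl.
  have gB (z : 'rV[R]_n.+1) : tensor_grad phi (wgrad A phi) eta eta' z - grad (tensor psi eta) z =
      tensor_grad (phi \- psi) (fun x => wgrad A phi x - grad psi x) eta eta' z.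
    by rewrite (grad_tensor spsi deta) tensor_gradB.
  apply: (le_lt_trans (le_integral_slab (K := `[c, d]%classic) (c := k)
     (g := fun x => `|phi x - psi x| `^ p + enorm (wgrad A phi x - grad psi x) `^ p)
     mA mJ mK cdJ _ _ k0 _ _ _ _)).
  + exact: measurable_funD m3 m4.
  + exact: measurable_funD m1 m2.
  + by move=> z; rewrite addr_ge0// powR_ge0.
  + by move=> x; rewrite addr_ge0// powR_ge0.
  + move=> z nz; rewrite tB gB tensor0// tg0// normr0 powR0 ?addr0// gt_eqF//.
  + move=> z _; rewrite tB gB [leRHS]mulrDl; apply: lerD.
      apply: (le_trans (tensorM _ _)); rewrite ler_wpM2l ?powR_ge0// lerDl.
      exact: powR_ge0.
    exact: (HC _ _ _ _ _ (etaM _).1 (etaM _).2).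
  rewrite lE muleA -EFinM.
  apply: (@le_lt_trans _ _ ((k * l)%:E * (e / (k * l + 1))%:E)%E).
    by apply: lee_wpmul2l; [rewrite lee_fin mulr_ge0|exact: ltW].
  rewrite -EFinM lte_fin mulrCA gtr_pMr// ltr_pdivrMr ?mul1r ?ltrDl//.
  by rewrite ltr_wpDl// mulr_ge0.
Qed.

End tensor_in_W1p_0.

(** The bound [M] is chosen before [c] and [d]: translating and separating the
    two transitions does not change the size of the derivative. *)
Lemma plateau_derive_bounded (R : realType) : exists2 M : R, 1 <= M &
  forall c d : R, exists eta', [/\ continuous eta',
    forall t : R, is_derive t 1 (plateau 1 c d) (eta' t),
    forall t, ~ `[c, d]%classic t -> eta' t = 0,
    forall t, c + 1 < t < d - 1 -> eta' t = 0 &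
    forall t, `|eta' t| <= M].
Proof.
have [s' ss' ds] := smooth1_derive (@smooth1_step R).
have [M M0 HM] := step_derive_bounded ds ss'.
exists (1 + 2 * M); first by rewrite lerDl mulr_ge0.
move=> c d; have [eta' seta' deta] := smooth1_derive (smooth1_plateau 1 c d).
have near_cst (V : set R) (k t : R) : open V -> V t ->
    (forall s, V s -> plateau 1 c d s = k) -> eta' t = 0.
  move=> oV Vt Vk; have [_ <-] := deta t.
  rewrite -(@derive_cst R R R k t 1); apply: near_eq_derive.
  have : nbhs t V by exact: open_nbhs_nbhs.
  by apply: filterS => s; exact: Vk.
exists eta'; split.
- exact: smooth1_continuous.
- exact: deta.
- move=> t nt; apply: (near_cst (~` `[c, d]%classic) 0) => //.
    by rewrite openC; exact: interval_closed.
  move=> s /= ns; apply: plateau_out => //; apply/negP => /andP[cs sd].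
  by apply: ns; rewrite in_itv/= !ltW.
- move=> t t1; apply: (near_cst `]c + 1, d - 1[%classic 1).
  + exact: interval_open.
  + by rewrite /= in_itv.
  + move=> s; rewrite /= in_itv/= => /andP[s1 s2].
    by apply: plateau1 => //; rewrite invr1 !ltW.
- move=> t.
  have dl : is_derive t 1 (fun t : R => 1 * (t - c)) 1.
    rewrite (_ : (fun _ => _) = (fun t : R => t - c)); last first.
      by apply/funext => s; rewrite mul1r.
    have := @is_deriveB R R R id (cst c) t 1 1 0 (is_derive_id _ _) (is_derive_cst _ _ _).
    by rewrite subr0.
  have dr : is_derive t 1 (fun t : R => 1 * (d - t)) (-1).
    rewrite (_ : (fun _ => _) = (fun t : R => d - t)); last first.
      by apply/funext => s; rewrite mul1r.
    have := @is_deriveB R R R (cst d) id t 1 0 1 (is_derive_cst _ _ _) (is_derive_id _ _).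
    by rewrite sub0r.
  have D := is_deriveM (is_derive1_comp (ds _) dl) (is_derive1_comp (ds _) dr).
  have [_ <-] := deta t; have [_ E] := D.
  rewrite [X in `|X|](E : _ = _) /GRing.scale/=.
  have step1 x : `|step x| <= 1 :> R by rewrite ger0_norm ?step_ge0// step_le1.
  apply: (le_trans (ler_normD _ _)); rewrite !normrM normrN1 !normr1 !mulr1.
  have b x y : `|step x| * `|s' y| <= M.
    by rewrite -[leRHS]mul1r; apply: ler_pM.
  by apply: (le_trans (lerD (b _ _) (b _ _))); lra.
Qed.

(** * The inequality on the cylinder *)

Section integrals_by_slices.
Context {R : realType} (n : nat).
Local Notation mu := (@lebesgue_rV R n).
Local Notation mu1 := (@lebesgue_rV R n.+1).
Local Notation leb := (@lebesgue_measure R).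

Lemma integral_slices (D : set 'rV[R]_n.+1) (F : 'rV[R]_n.+1 -> R) :
  measurable D -> measurable_fun D F -> (forall z, 0 <= F z) ->
  (\int[mu1]_(z in D) (F z)%:E =
    \int[leb]_t \int[mu]_(x in [set x | D (rV_rcons (x, t))]) (F (rV_rcons (x, t)))%:E)%E /\
  measurable_fun setT (fun t : measurableTypeR R =>
    \int[mu]_(x in [set x | D (rV_rcons (x, t))]) (F (rV_rcons (x, t)))%:E)%E.
Proof.
move=> mD mF F0; pose f z := (F z)%:E.
have mf : measurable_fun D f by exact/measurable_EFinP.
have mfD : measurable_fun (cylinder [set: 'rV[R]_n] [set: R]) (f \_ D).
  by rewrite cylinderTT; apply/(measurable_restrictT _ _).1.
have f0 z : (0 <= (f \_ D) z)%E by rewrite patchE; case: ifP => //; rewrite lee_fin.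
have E t : (\int[mu]_x (f \_ D) (rV_rcons (x, t)) =
    \int[mu]_(x in [set x | D (rV_rcons (x, t))]) (F (rV_rcons (x, t)))%:E)%E.
  rewrite [RHS]integral_mkcond; apply: eq_integral => x _; rewrite !patchE.
  by have [/set_mem Dx|Dx] := boolP (rV_rcons (x, t) \in D);
    [rewrite mem_set|rewrite memNset//; move: Dx; rewrite notin_setE].
have [//|E1 _ m1 _] := @tonelli_cylinder R n setT setT measurableT measurableT _ mfD.
split.
  rewrite integral_mkcond; move: E1; rewrite cylinderTT => ->.
  by apply: eq_integral => t _; exact: E.
by apply: eq_measurable_fun m1 => t _; exact: E.
Qed.

Lemma measurable_slice_set (D : set 'rV[R]_n.+1) t : measurable D ->
  measurable [set x : 'rV[R]_n | D (rV_rcons (x, t))].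
Proof.
by move=> mD; rewrite -[X in measurable X]setTI; exact: measurable_rV_rcons1.
Qed.

End integrals_by_slices.

(** This is where the chosen representative of the weak gradient is traded for
    an explicit one. *)
Lemma energy_wgrad (R : realType) n (p : R) (U D : set 'rV[R]_n) f G : open U ->
  measurable D -> D `<=` U -> is_weak_gradient U f G ->
  energy p D (wgrad U f) = energy p D G.
Proof.
move=> oU mD DU fG; have mU := open_measurable_rV oU.
have p_ge0 (a : R) : (0 <= (a `^ p)%:E)%E by rewrite lee_fin powR_ge0.
apply: ge0_ae_eq_integral; first exact: mD.
- apply/measurable_EFinP; apply: (measurable_funS mU DU).
  apply: measurable_enorm_powR => i; apply: (weak_gradient_measurable i oU (wgradP _)).
  by exists G.
- apply/measurable_EFinP; apply: (measurable_funS mU DU).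
  by apply: measurable_enorm_powR => i; exact: weak_gradient_measurable oU fG.
- by move=> x _.
- by move=> x _.
- by apply: filterS (wgrad_ae oU fG) => x xE /DU Ux; rewrite xE.
Qed.

Section tensor_with_one.
Context {R : realType} (n : nat).
Variables (p : R) (Omega : set 'rV[R]_n) (u : 'rV[R]_n -> R) (J : set R).
Hypotheses (p1 : 1 < p) (oO : open Omega) (oJ : open J).
Local Notation mu := (@lebesgue_rV R n).
Local Notation mu1 := (@lebesgue_rV R n.+1).
Local Notation leb := (@lebesgue_measure R).
Local Notation C := (cylinder Omega J).

Let p0 : 0 < p. Proof. exact: lt_trans p1. Qed.
Let mO : measurable Omega := open_measurable_rV oO.
Let mJ : measurable (J : set (measurableTypeR R)). Proof. exact: open_measurable. Qed.
Let oC : open C := open_cylinder oO oJ.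
Let mC : measurable C := measurable_cylinder mO mJ.

Hypothesis Wu : W1p_loc Omega p u.

Let tg : 'rV[R]_n.+1 -> 'rV[R]_n.+1 := tensor_grad u (wgrad Omega u) (fun=> 1) (fun=> 0).

Let mfu : measurable_fun Omega u. Proof. by case: Wu => -[]. Qed.
Let mgu i : measurable_fun Omega (fun x => wgrad Omega u x ord0 i).
Proof. by case: Wu => _ _ /(_ i)[]. Qed.

Let c1 : continuous ((fun=> 1) : R -> R). Proof. exact: cst_continuous. Qed.
Let c0 : continuous ((fun=> 0) : R -> R). Proof. exact: cst_continuous. Qed.

Let mtg i : measurable_fun C (fun z => tg z ord0 i).
Proof. exact: measurable_tensor_grad. Qed.

Lemma enorm_tg z : enorm (tg z) = enorm (wgrad Omega u (col' ord_max z)).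
Proof. exact: enorm_tensor_grad1. Qed.

Lemma weak_gradient_tensor1 : is_weak_gradient C (tensor1 u) tg.
Proof.
have -> : tensor1 u = tensor u (fun=> 1).
  by apply/funext => z; rewrite /tensor mulr1.
have [_ hu _] := Wu.
exact: (weak_gradient_tensor oO oJ (wgradP hu) _ c0).
Qed.

(** A compact subset of the cylinder has a compact projection to the base and a
    bounded height. *)
Lemma Lp_loc_base (f : 'rV[R]_n -> R) (F : 'rV[R]_n.+1 -> R) :
  Lp_loc Omega p f -> measurable_fun C F ->
  {ae mu1, forall z, C z -> `|F z| <= `|f (col' ord_max z)|} -> Lp_loc C p F.
Proof.
move=> [mf fi] mF aF; split; first exact: mF.
move=> L cL LC; set K := (col' ord_max : _ -> 'rV[R]_n) @` L.
set K2 := (fun z : 'rV[R]_n.+1 => z ord0 ord_max : R) @` L.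
have cK : compact K := compact_base cL.
have cK2 : compact K2 := compact_height cL.
have mK := compact_measurable_rV cK.
have mK2 : measurable (K2 : set (measurableTypeR R)) by exact: compact_measurable.
have KO : K `<=` Omega by move=> _ [z /LC[Oz _] <-].
have mL := compact_measurable_rV cL.
have mfK : measurable_fun K (fun x => `|f x| `^ p).
  by apply: measurable_norm_powR; exact: measurable_funS mf.
have mFL : measurable_fun L F by exact: measurable_funS mF.
have LKK2 : L `<=` cylinder K K2 by exact: sub_cylinder.
have mKK2 := measurable_cylinder mK mK2.
have mb := measurable_base mK mK2 mfK.
have lebK2 : (leb K2 < +oo)%E by exact: compact_finite_measure.
have p_ge0 (a : R) : (0 <= (a `^ p)%:E)%E by rewrite lee_fin powR_ge0.
apply: (@le_lt_trans _ _ (\int[mu1]_(z in L) (`|f (col' ord_max z)| `^ p)%:E)%E).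
  apply: ae_ge0_le_integral.
  - exact: mL.
  - by move=> z _.
  - by apply/measurable_EFinP; exact: measurable_norm_powR.
  - by move=> z _.
  - by apply/measurable_EFinP; exact: measurable_funS mb.
  - apply: filterS aF => z Fz Lz; rewrite lee_fin.
    by apply: ge0_ler_powR; rewrite ?nnegrE ?(ltW p0)//; apply: Fz; exact: LC.
apply: (@le_lt_trans _ _ (\int[mu1]_(z in cylinder K K2) (`|f (col' ord_max z)| `^ p)%:E)%E).
  apply: ge0_subset_integral => //.
  exact/measurable_EFinP.
rewrite (@integral_cylinder_base _ _ _ _ (fun x => `|f x| `^ p))//.
apply: lte_mul_pinfty; [exact: measure_ge0| |exact: fi].
by rewrite ge0_fin_numE.
Qed.

Lemma W1p_loc_tensor1 : W1p_loc C p (tensor1 u).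
Proof.
have [Lu hu LGu] := Wu; have hw : has_weak_gradient C (tensor1 u).
  by exists tg; exact: weak_gradient_tensor1.
split; [|exact: hw|move=> i].
  apply: (Lp_loc_base Lu); first exact: measurable_base.
  exact: aeW.
have mw := weak_gradient_measurable i oC (wgradP hw).
have aw := wgrad_ae oC weak_gradient_tensor1.
case: (unliftP ord_max i) => [j ij|ij].
  apply: (Lp_loc_base (LGu j) mw); apply: filterS aw => z zE Cz.
  by rewrite zE// ij lift_rV_rcons scale1r.
apply: (Lp_loc_base Lu mw); apply: filterS aw => z zE Cz.
by rewrite zE// ij last_rV_rcons /tensor mulr0 normr0.
Qed.

(** The slice of the set where [phi] does not vanish is the set where the slice of
    [phi] does not vanish, so the inequality for [u] can be used at almost every
    height and then integrated. *)
Lemma quasisuperminimizer_tensor1 (Q : R) :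
  quasisuperminimizer Omega p Q u -> quasisuperminimizer C p Q (tensor1 u).
Proof.
move=> [Q1 _ qu]; split=> //; first exact: W1p_loc_tensor1.
move=> phi W0 phi_ge0 /=; set D := C `&` _.
have hu : has_weak_gradient Omega u by case: Wu.
have wu := wgradP hu; have wtu := weak_gradient_tensor1.
pose H := wgrad C phi.
have [[[mphi _] hphi LH] _] := W0; have wphi := wgradP hphi.
have wsum := weak_gradientD oC wtu wphi.
have mD : measurable D := measurable_nonzero mC mphi.
have DC : D `<=` C by move=> z [].
have mtgH i : measurable_fun C (fun z => (tg z + H z) ord0 i).
  exact: weak_gradient_measurable oC wsum.
pose F1 z := enorm (tg z) `^ p; pose F2 z := enorm (tg z + H z) `^ p.
have mF1 : measurable_fun D F1.
  by apply: measurable_funS (measurable_enorm_powR p mtg).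
have mF2 : measurable_fun D F2.
  by apply: measurable_funS (measurable_enorm_powR p mtgH).
rewrite (energy_wgrad p oC mD DC wtu) (energy_wgrad p oC mD DC wsum).
have F1_ge0 z : 0 <= F1 z by exact: powR_ge0.
have F2_ge0 z : 0 <= F2 z by exact: powR_ge0.
have [E1 m1] := integral_slices mD mF1 F1_ge0.
have [E2 m2] := integral_slices mD mF2 F2_ge0.
rewrite [energy p D tg]E1 [energy p D _]E2.
have Q0 : 0 <= Q by rewrite (le_trans _ Q1).
pose S F t := (\int[mu]_(x in [set x | D (rV_rcons (x, t))]) (F (rV_rcons (x, t)))%:E)%E.
have S_ge0 F t : (forall z, 0 <= F z) -> (0 <= S F t)%E.
  by move=> F_ge0; apply: integral_ge0 => x _; rewrite lee_fin.
have S1 t : (0 <= S F1 t)%E by exact: S_ge0.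
have S2 t : (0 <= S F2 t)%E by exact: S_ge0.
rewrite -(ge0_integralZl_EFin leb measurableT (fun t _ => S2 t) m2 Q0).
apply: (ae_ge0_le_integral measurableT (fun t _ => S1 t) m1).
- by move=> t _; apply: mule_ge0; [rewrite lee_fin|exact: S2].
- exact: measurable_funeM.
have aslice := W1p_0_slice oO oJ p1 W0.
have age0 := ae_slice phi_ge0.
apply: filterS2 aslice age0 => t sl ge0t _.
have [Jt|nJt] := pselect (J t); last first.
  rewrite /S (_ : [set x | D _] = set0) ?integral_set0 ?mule0//.
  by apply/seteqP; split=> // x [[_ /=]]; rewrite last_rV_rcons.
have [wst W0t] := sl Jt; rewrite /S; set Dt := [set x | D _].
have DtE : Dt = Omega `&` [set x | slice phi t x != 0].
  apply/seteqP; split=> x; rewrite /Dt /D /=.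
    by move=> [[]]; rewrite col'_rV_rcons.
  by move=> [Ox nx]; split=> //; rewrite cylinder_rV_rcons.
have mDt : measurable Dt by exact: measurable_slice_set.
have DtO : Dt `<=` Omega by rewrite DtE => x [].
have := qu _ W0t; rewrite -DtE => /(_ _)/wrap[].
  apply: filterS ge0t => x xge0 Ox; apply: xge0.
  by rewrite cylinder_rV_rcons.
move=> qut.
have wsumt := weak_gradientD oO wu wst.
under eq_integral do rewrite /F1 enorm_tg col'_rV_rcons.
apply: (le_trans qut); apply: lee_wpmul2l; first by rewrite lee_fin.
rewrite /energy.
apply: ae_ge0_le_integral; first exact: mDt.
- by move=> x _; rewrite lee_fin powR_ge0.
- apply/measurable_EFinP; apply: (measurable_funS mO DtO).
  apply: measurable_enorm_powR => i; apply: weak_gradient_measurable oO (wgradP _).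
  by eexists; exact: wsumt.
- by move=> x _; rewrite lee_fin F2_ge0.
- apply/measurable_EFinP; rewrite DtE.
  have mF2C : measurable_fun C F2 by exact: measurable_enorm_powR.
  exact: (measurable_funS mO (@subIsetl _ _ _) (measurable_slice oO oJ mF2C Jt)).
- apply: filterS (wgrad_ae oO wsumt) => x xE /DtO Ox; rewrite xE// lee_fin.
  apply: ge0_ler_powR; rewrite ?nnegrE ?enorm_ge0 ?(ltW p0)//.
  apply: le_trans (enorm_col'_le _); rewrite le_eqVlt; apply/orP; left; apply/eqP.
  congr enorm; apply/rowP => i; rewrite !mxE liftK /= !mxE.
  by rewrite mul1r col'_rV_rcons.
Qed.

End tensor_with_one.

(** * Optimality of the constant *)

Lemma unbounded_interval_long (R : realType) (J : set R) :
  is_interval J -> ~ bounded_set J ->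
  forall L : R, 0 <= L -> exists c, `[c, c + L] `<=` J.
Proof.
move=> iJ unbJ L L0.
have far (M : R) : exists2 x, J x & M < `|x|.
  apply: contrapT => H; apply: unbJ; exists M; split; first exact: num_real.
  move=> N MN x Jx; apply: le_trans (ltW MN); rewrite leNgt; apply/negP => Mx.
  by apply: H; exists x.
have [x0 Jx0 _] := far 0; have [y Jy yfar] := far (`|x0| + L).
have n1 := ler_norm x0; have n2 := ler_norm (- x0); rewrite normrN in n2.
have [y0|y0] := leP 0 y.
  exists x0 => t; rewrite /= in_itv/= => /andP[xt tx].
  rewrite (ger0_norm y0) in yfar.
  by apply: (iJ _ _ Jx0 Jy); apply/andP; split => //; lra.
exists y => t; rewrite /= in_itv/= => /andP[xt tx].
rewrite (ltr0_norm y0) in yfar.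
by apply: (iJ _ _ Jy Jx0); apply/andP; split => //; lra.
Qed.

Section optimality.
Context {R : realType} (n : nat).
Variables (p : R) (Omega : set 'rV[R]_n) (u : 'rV[R]_n -> R) (J : set R).
Hypotheses (p1 : 1 < p) (oO : open Omega) (oJ : open J).
Local Notation mu := (@lebesgue_rV R n).
Local Notation mu1 := (@lebesgue_rV R n.+1).
Local Notation leb := (@lebesgue_measure R).
Local Notation C := (cylinder Omega J).

Let p0 : 0 < p. Proof. exact: lt_trans p1. Qed.
Let mO : measurable Omega := open_measurable_rV oO.
Let mJ : measurable (J : set (measurableTypeR R)). Proof. exact: open_measurable. Qed.
Let oC : open C := open_cylinder oO oJ.
Let mC : measurable C := measurable_cylinder mO mJ.

Hypothesis Wu : W1p_loc Omega p u.
Hypothesis long : forall L : R, 0 <= L -> exists c, `[c, c + L] `<=` J.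

Section fixed_test_function.
Variables (Q : R) (phi : 'rV[R]_n -> R).
Hypothesis qC : quasisuperminimizer C p Q (tensor1 u).
Hypothesis W0 : W1p_0 Omega p phi.
Hypothesis phi_ge0 : {ae mu, forall x, Omega x -> 0 <= phi x}.

Let A := Omega `&` [set x | phi x != 0].
Let Gu := wgrad Omega u.
Let G := wgrad Omega phi.
(* [h] is the energy density of [u + phi]; up to a constant, [g] dominates that of
   [u(x) + phi(x) eta(t)] at every height [t]. *)
Let h x := enorm (Gu x + G x) `^ p.
Let g x := enorm (Gu x) `^ p + (`|phi x| `^ p + enorm (G x) `^ p).

Lemma weak_gradient_u : is_weak_gradient Omega u Gu. Proof. by apply: wgradP; case: Wu. Qed.
Lemma weak_gradient_phi : is_weak_gradient Omega phi G. Proof. by apply: wgradP; case: W0 => -[]. Qed.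
Lemma measurable_phi : measurable_fun Omega phi. Proof. by case: W0 => -[[]]. Qed.

Lemma support_sub : A `<=` Omega. Proof. by move=> x []. Qed.

Lemma measurable_support : measurable A.
Proof. exact: measurable_nonzero measurable_phi. Qed.

Lemma measurable_Gu i : measurable_fun Omega (fun x => Gu x ord0 i).
Proof. exact: weak_gradient_measurable oO weak_gradient_u. Qed.

Lemma measurable_G i : measurable_fun Omega (fun x => G x ord0 i).
Proof. exact: weak_gradient_measurable oO weak_gradient_phi. Qed.

Lemma measurable_Gu_powR : measurable_fun A (fun x => enorm (Gu x) `^ p).
Proof. apply: (measurable_funS mO support_sub); exact: measurable_enorm_powR measurable_Gu. Qed.

Lemma measurable_h : measurable_fun A h.
Proof.
apply: (measurable_funS mO support_sub); apply: measurable_enorm_powR => i.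
exact: (weak_gradient_measurable i oO (weak_gradientD oO weak_gradient_u weak_gradient_phi)).
Qed.

Lemma measurable_phi_powR : measurable_fun A (fun x => `|phi x| `^ p + enorm (G x) `^ p).
Proof.
apply: (measurable_funS mO support_sub); apply: measurable_funD.
  exact: measurable_norm_powR measurable_phi.
exact: measurable_enorm_powR measurable_G.
Qed.

Lemma h_ge0 x : 0 <= h x. Proof. exact: powR_ge0. Qed.
Lemma phi_powR_ge0 x : 0 <= `|phi x| `^ p + enorm (G x) `^ p.
Proof. by rewrite addr_ge0// powR_ge0. Qed.
Lemma g_ge0 x : 0 <= g x.
Proof. exact: addr_ge0 (powR_ge0 _ _) (phi_powR_ge0 x). Qed.

Lemma integral_phi_lty : (\int[mu]_(x in A) (`|phi x| `^ p + enorm (G x) `^ p)%:E < +oo)%E.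
Proof.
have [W _] := W0; apply: le_lt_trans (W1p_integral_lty p0 mO W).
apply: ge0_subset_integral;
  [exact: measurable_support|exact: mO| | |exact: support_sub].
- apply/measurable_EFinP; apply: measurable_funD.
    exact: measurable_norm_powR measurable_phi.
  exact: measurable_enorm_powR measurable_G.
- by move=> x _; rewrite lee_fin phi_powR_ge0.
Qed.

Lemma energy_sum : energy p A (wgrad Omega (u \+ phi)) = (\int[mu]_(x in A) (h x)%:E)%E.
Proof.
exact: (energy_wgrad p oO measurable_support support_sub
  (weak_gradientD oO weak_gradient_u weak_gradient_phi)).
Qed.

(** [Gu] is the difference of [Gu + G] and of [G], both [p]-integrable on the
    support of [phi]. *)
Lemma integral_g_lty : (\int[mu]_(x in A) (h x)%:E < +oo)%E ->
  (\int[mu]_(x in A) (g x)%:E < +oo)%E.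
Proof.
move=> hfin; have [K K0 HK] := @enormD_powR_le R n p p0.
have gle x : g x <= (K + 1) * (h x + (`|phi x| `^ p + enorm (G x) `^ p)).
  have := HK (Gu x + G x) (- G x); rewrite addrK.
  have -> : enorm (- G x) = enorm (G x).
    by rewrite /enorm; congr Num.sqrt; apply: eq_bigr => i _; rewrite mxE sqrrN.
  rewrite -/(h x) /g => Gule.
  apply: (@le_trans _ _ (K * (h x + enorm (G x) `^ p) + (`|phi x| `^ p + enorm (G x) `^ p))).
    by rewrite lerD2r.
  rewrite [leRHS]mulrDl mul1r; apply: lerD.
    by apply: ler_wpM2l => //; rewrite lerD2l lerDr powR_ge0.
  by rewrite lerDr h_ge0.
have K1 : 0 <= K + 1 by rewrite addr_ge0.
have mgA : measurable_fun A g by exact: measurable_funD measurable_Gu_powR measurable_phi_powR.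
have msum := measurable_funD measurable_h measurable_phi_powR.
apply: (le_lt_trans (le_integral_scale mu measurable_support mgA msum K1 (fun x _ => g_ge0 x)
  (fun x _ => addr_ge0 (h_ge0 x) (phi_powR_ge0 x)) (fun x _ => gle x))).
apply: lte_mul_pinfty; [by rewrite lee_fin|by []|].
under eq_integral do rewrite EFinD.
have m1 : measurable_fun A (fun x => (h x)%:E).
  by apply/measurable_EFinP; exact: measurable_h.
have m2 : measurable_fun A (fun x => (`|phi x| `^ p + enorm (G x) `^ p)%:E).
  by apply/measurable_EFinP; exact: measurable_phi_powR.
have h0 x : A x -> (0 <= (h x)%:E)%E by move=> _; rewrite lee_fin h_ge0.
have phi0 x : A x -> (0 <= (`|phi x| `^ p + enorm (G x) `^ p)%:E)%E.
  by move=> _; rewrite lee_fin phi_powR_ge0.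
rewrite (ge0_integralD mu measurable_support h0 m1 phi0 m2).
exact: lte_add_pinfty hfin integral_phi_lty.
Qed.

(** Outside the plateau, which has length [N], the transitions of [eta] have total
    length at most [2]; there the energy density is bounded by [g], with a constant
    that depends on the bounds for [eta] and its derivative only. *)
Lemma plateau_inequality : exists2 K : R, 0 <= K & forall N : nat,
  (N%:R%:E * energy p A Gu <=
   Q%:E * (N%:R%:E * \int[mu]_(x in A) (h x)%:E + K%:E * \int[mu]_(x in A) (g x)%:E))%E.
Proof.
have [M M1 HM] := plateau_derive_bounded R.
have M0 : 0 <= M by rewrite (le_trans _ M1).
have [K1 K10 HK1] := @enormD_powR_le R n.+1 p p0.
have [K2 K20 HK2] := @tensor_grad_powR_le R n p M p0 M0.
pose K3 := K1 * (1 + K2).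
have K30 : 0 <= K3 by rewrite mulr_ge0 ?addr_ge0.
exists (K3 * 2); first by rewrite mulr_ge0.
move=> N; have [c cJ] := long (addr_ge0 (ler0n R N) (ler0n R 2)).
set d := c + (N%:R + 2) in cJ.
have [eta' [ceta' deta eta'_out eta'_in eta'M]] := HM c d.
set eta := plateau 1 c d in deta.
have eta_out t : ~ `[c, d]%classic t -> eta t = 0 /\ eta' t = 0.
  move=> nt; split; last exact: eta'_out.
  apply: plateau_out => //; apply/negP => /andP[ct td].
  by apply: nt; rewrite /= in_itv/= !ltW.
have etaM t : `|eta t| <= M /\ `|eta' t| <= M.
  by split=> //; rewrite ger0_norm ?plateau_ge0// (le_trans (plateau_le1 _ _ _ _)).
have [wT W0T] := W1p_0_tensor p1 oO oJ W0 (smooth1_plateau 1 c d) deta ceta' cJ eta_out etaM.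
have T_ge0 : {ae mu1, forall z, C z -> 0 <= tensor phi eta z}.
  apply: filterS (ae_cylinder phi_ge0) => z zge0 [Oz _].
  by rewrite mulr_ge0 ?plateau_ge0// zge0.
have [_ _ /(_ _ W0T T_ge0) /=] := qC.
set D := C `&` _.
have mten : measurable_fun C (tensor phi eta) by case: W0T => -[[]].
have mD : measurable D := measurable_nonzero mC mten.
have DC : D `<=` C by move=> z [].
have wtu := weak_gradient_tensor1 oO oJ Wu.
have wsum := weak_gradientD oC wtu wT.
rewrite (energy_wgrad p oC mD DC wtu) (energy_wgrad p oC mD DC wsum).
pose K : set R := `]c + 1, d - 1[%classic.
pose E : set R := `[c, c + 1]%classic `|` `[d - 1, d]%classic.
have mK : measurable (K : set (measurableTypeR R)) by exact: measurable_itv.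
have mE : measurable (E : set (measurableTypeR R)).
  by apply: measurableU; exact: measurable_itv.
have dE : d = c + (N%:R + 2) by [].
have N0 : 0 <= N%:R :> R by [].
have lebK : leb K = N%:R%:E.
  rewrite lebesgue_measure_itv/= lte_fin; case: ifPn => [_|].
    by rewrite -EFinB; congr EFin; rewrite dE; ring.
  by rewrite -leNgt => le; congr EFin; lra.
have lebE : (leb E <= 2%:E)%E.
  have m1 : measurable (`[c, c + 1]%classic : set (measurableTypeR R)) by exact: measurable_itv.
  have m2 : measurable (`[d - 1, d]%classic : set (measurableTypeR R)) by exact: measurable_itv.
  have unit_length (a b : R) : b = a + 1 -> leb `[a, b] = 1%:E.
    by move=> ->; rewrite lebesgue_measure_itv/= lte_fin ltrDl ltr01 -EFinB addrAC subrr add0r.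
  apply: (le_trans (measureU2 leb m1 m2)).
  rewrite [X in (X + _ <= _)%E](unit_length c)// [X in (_ + X <= _)%E](unit_length (d - 1)).
    by rewrite -EFinD lee_fin; lra.
  by rewrite subrK.
have KJ : K `<=` J.
  move=> t; rewrite /K /= in_itv/= => /andP[t1 t2]; apply: cJ.
  by rewrite /= in_itv/=; apply/andP; split; lra.
have EJ : E `<=` J.
  move=> t [|]; rewrite /= in_itv/= => /andP[t1 t2]; apply: cJ;
    by rewrite /= in_itv/=; apply/andP; split; lra.
have etaK t : K t -> eta t = 1.
  rewrite /K /= in_itv/= => /andP[t1 t2]; apply: plateau1 => //.
  by rewrite invr1 !ltW.
have eta'K t : K t -> eta' t = 0 by rewrite /K /= in_itv/=; exact: eta'_in.
have mAK := measurable_cylinder measurable_support mK; have mAE := measurable_cylinder measurable_support mE.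
have AKC : cylinder A K `<=` C by move=> z [[Oz _] /KJ].
have AEC : cylinder A E `<=` C by move=> z [[Oz _] /EJ].
pose tg := tensor_grad u Gu (fun=> 1) (fun=> 0) : 'rV[R]_n.+1 -> 'rV[R]_n.+1.
pose F z := enorm (tg z + tensor_grad phi G eta eta' z) `^ p.
have F_ge0 z : 0 <= F z by exact: powR_ge0.
have mFC : measurable_fun C F.
  by apply: measurable_enorm_powR => i; exact: weak_gradient_measurable oC wsum.
have mtgC : measurable_fun C (fun z => enorm (tg z) `^ p).
  by apply: measurable_enorm_powR => i; exact: weak_gradient_measurable oC wtu.
have enorm_tgE z : enorm (tg z) = enorm (Gu (col' ord_max z)) by exact: enorm_tg.
have lhs : (N%:R%:E * energy p A Gu <= energy p D tg)%E.
  rewrite -lebK -(integral_cylinder_base measurable_support mK measurable_Gu_powR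
    (fun x => powR_ge0 _ _)).
  rewrite (_ : (\int[mu1]_(z in _) _)%E = (\int[mu1]_(z in cylinder A K) (enorm (tg z) `^ p)%:E)%E); last first.
    by apply: eq_integral => z _; rewrite enorm_tgE.
  apply: ge0_subset_integral; [exact: mAK|exact: mD| | |].
  - by apply/measurable_EFinP; exact: measurable_funS DC mtgC.
  - by move=> z _; rewrite lee_fin powR_ge0.
  - move=> z [[Oz /= nz] Kz]; split; first by apply: AKC.
    by rewrite /= /tensor -/eta etaK// mulr1.
have mid : (\int[mu1]_(z in cylinder A K) (F z)%:E = N%:R%:E * \int[mu]_(x in A) (h x)%:E)%E.
  rewrite -lebK -(integral_cylinder_base measurable_support mK measurable_h h_ge0).
  apply: eq_integral => z /set_mem[_ Kz]; congr EFin; rewrite /F /h.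
  have -> : tensor_grad phi G eta eta' z = tensor_grad phi G (fun=> 1) (fun=> 0) z.
    by rewrite /tensor_grad /tensor etaK// eta'K.
  by rewrite /tg tensor_gradD enorm_tensor_grad1.
have mgA : measurable_fun A g by exact: measurable_funD measurable_Gu_powR measurable_phi_powR.
have Fle z : F z <= K3 * g (col' ord_max z).
  have X0 : 0 <= enorm (tg z) `^ p by exact: powR_ge0.
  have le := HK2 phi G eta eta' z (etaM _).1 (etaM _).2.
  apply: (le_trans (HK1 _ _)); rewrite /K3 -mulrA; apply: ler_wpM2l => //.
  rewrite /g -enorm_tgE; move: X0 le (phi_powR_ge0 (col' ord_max z)).
  move: (enorm (tg z) `^ p) (enorm (tensor_grad _ _ _ _ _) `^ p) => X T.
  move: (`|phi (col' ord_max z)| `^ p + enorm (G (col' ord_max z)) `^ p) => Y.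
  move=> X0 le Y0; rewrite mulrDl mul1r mulrDr.
  have K2X0 : 0 <= K2 * X by exact: mulr_ge0.
  by rewrite -addrA lerD2l; apply: ler_wpDl => //; apply: ler_wpDl.
have ends : (\int[mu1]_(z in cylinder A E) (F z)%:E <=
    (K3 * 2)%:E * \int[mu]_(x in A) (g x)%:E)%E.
  have mbE := measurable_base measurable_support mE mgA.
  apply: (le_trans (le_integral_scale mu1 mAE (measurable_funS mC AEC mFC) mbE K30
    (fun z _ => F_ge0 z) (fun z _ => g_ge0 _) (fun z _ => Fle z))).
  rewrite (integral_cylinder_base measurable_support mE mgA g_ge0).
  rewrite [X in (_ <= X * _)%E]EFinM -[X in (_ <= X)%E]muleA.
  apply: lee_wpmul2l; first by rewrite lee_fin.
  apply: lee_wpmul2r => //.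
  by apply: integral_ge0 => x _; rewrite lee_fin g_ge0.
have rhs : (energy p D (fun z => tg z + tensor_grad phi G eta eta' z)%R <=
    N%:R%:E * \int[mu]_(x in A) (h x)%:E + (K3 * 2)%:E * \int[mu]_(x in A) (g x)%:E)%E.
  rewrite -mid; apply: le_trans (leeD (lexx _) ends).
  have mAKE := measurableU _ _ mAK mAE.
  rewrite -(ge0_integral_setU mu1 mAK mAE).
  - apply: ge0_subset_integral; [exact: mD|exact: mAKE| |by move=> z _; rewrite lee_fin powR_ge0|].
    + apply/measurable_EFinP; apply: (measurable_funS mC _ mFC).
      by move=> z [/AKC|/AEC].
    + move=> z [[Oz Jz]] /=; rewrite /tensor mulf_eq0 negb_or => /andP[phiz etaz].
      have [cdz|/eta_out[e0 _]] := pselect (`[c, d]%classic (z ord0 ord_max)); last first.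
        by move: etaz; rewrite -/eta e0 eqxx.
      move: cdz; rewrite /= in_itv/= => /andP[cz zd].
      set t := z ord0 ord_max in cz zd *.
      have [t1|t1] := leP t (c + 1).
        by right; split=> //; left; rewrite /= in_itv/= cz.
      have [t2|t2] := leP (d - 1) t.
        by right; split=> //; right; rewrite /= in_itv/= t2.
      by left; split=> //; rewrite /K /= in_itv/= t1.
  - apply/measurable_EFinP; apply: (measurable_funS mC _ mFC).
    by move=> z [/AKC|/AEC].
  - by move=> z _; rewrite lee_fin F_ge0.
  - apply/disj_setPS => z [[_ Kz] [_ Ez]]; move: Kz Ez.
    by rewrite /K /E /= !in_itv/= => /andP[t1 t2] [|] /andP[t3 t4]; lra.
have Q0 : 0 <= Q by case: qC => Q1 _ _; rewrite (le_trans _ Q1).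
move=> ineq; apply: (le_trans lhs); apply: (le_trans ineq).
by apply: lee_wpmul2l => //; rewrite lee_fin.
Qed.

(** If the right side is finite then so is the integral of [g], and dividing
    [plateau_inequality] by [N] leaves an error of order [1/N]. *)
Lemma base_inequality :
  (energy p A Gu <= Q%:E * energy p A (wgrad Omega (u \+ phi)%R))%E.
Proof.
have Q1 : 1 <= Q by case: qC.
rewrite energy_sum; set b := (\int[mu]_(x in A) (h x)%:E)%E.
have b0 : (0 <= b)%E by apply: integral_ge0 => x _; rewrite lee_fin h_ge0.
have [boo|bfin] := eqVneq b +oo%E.
  by rewrite boo gt0_muley ?leey// lte_fin (lt_le_trans ltr01).
have {}bfin : (b < +oo)%E by rewrite ltey.
have [K K0 HK] := plateau_inequality; have gfin := integral_g_lty bfin.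
set m := (\int[mu]_(x in A) (g x)%:E)%E in gfin HK.
have m0 : (0 <= m)%E by apply: integral_ge0 => x _; rewrite lee_fin g_ge0.
have a0 : (0 <= energy p A Gu)%E by apply: integral_ge0 => x _; rewrite lee_fin powR_ge0.
have afin : (energy p A Gu < +oo)%E.
  apply: le_lt_trans gfin; apply: ge0_le_integral; first exact: measurable_support.
  - by move=> x _; rewrite lee_fin powR_ge0.
  - by apply/measurable_EFinP; exact: measurable_Gu_powR.
  - by apply/measurable_EFinP; exact: measurable_funD measurable_Gu_powR measurable_phi_powR.
  - by move=> x _; rewrite lee_fin lerDl phi_powR_ge0.
rewrite -/b in HK; clearbody b m.
move: (energy p A Gu) b m a0 afin b0 bfin m0 gfin HK => [a'| |] // [b'| |] // [m'| |] //.
move=> _ _ _ _ m'0 _ HK; rewrite lee_fin in m'0.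
rewrite -EFinM lee_fin.
have Q0 : 0 <= Q by rewrite (le_trans _ Q1).
apply: (@le_addgt0 _ _ _ (Q * (K * m'))); first by rewrite !mulr_ge0.
move=> e e0; have [N _ /(_ N (leqnn N)) Ne] := near_infty_natSinv_lt (PosNum e0).
have HN : N.+1%:R * a' <= Q * (N.+1%:R * b' + K * m').
  by rewrite -lee_fin; exact: (HK N.+1).
have N1 : 0 < N.+1%:R :> R by rewrite ltr0n.
have : a' <= Q * b' + Q * (K * m') * N.+1%:R^-1.
  rewrite -(ler_pM2l N1); apply: (le_trans HN).
  have Nn0 : N.+1%:R != 0 :> R by rewrite gt_eqF.
  move: (N.+1%:R) Nn0 => r rn0.
  have -> // : r * (Q * b' + Q * (K * m') / r) = Q * (r * b' + K * m') by field.
move=> /le_trans; apply; rewrite lerD2l ler_wpM2l ?mulr_ge0//.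
exact: ltW.
Qed.

End fixed_test_function.

Lemma quasisuperminimizer_of_tensor1 (Q : R) :
  quasisuperminimizer C p Q (tensor1 u) -> quasisuperminimizer Omega p Q u.
Proof.
move=> qC; split; [by case: qC|exact: Wu|move=> phi W0 phi_ge0 /=].
exact: base_inequality qC W0 phi_ge0.
Qed.

End optimality.

Theorem theorem4p2 (R : realType) (p : R) (n : nat) (Omega : set 'rV[R]_n)
    (u : 'rV[R]_n -> R) (Q : R) (I : set R) :
  1 < p ->
  open Omega -> Omega !=set0 ->
  optimal_quasisuperminimizing_constant Omega p Q u ->
  open I -> is_interval I -> ~ bounded_set I ->
  optimal_quasisuperminimizing_constant (cylinder Omega I) p Q (tensor1 u).
Proof.
move=> p1 oO _ [qu opt] oI iI unbI; have [_ Wu _] := qu.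
split; first exact: quasisuperminimizer_tensor1.
move=> Q' Q'1 Q'Q qC; apply: (opt Q' Q'1 Q'Q).
apply: (quasisuperminimizer_of_tensor1 p1 oO oI Wu _ qC).
exact: unbounded_interval_long.
Qed.
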